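(* Let $K$ be an algebraically closed field of characteristic zero, let $\Phi=(f_1,f_2,f_3)$ be a polynomial automorphism of $K^3$, let $\deg_1$ be the standard homogeneous degree on $K[x_1,x_2,x_3]$, let $d_i=\deg_1(f_i)$, and assume $d_1\le d_2\le d_3$. Let $\deg_2$ be the weighted degree assigning weight $d_i$ to $x_i$. Let $I=\{P : P(\overline{f_1},\overline{f_2},\overline{f_3})=0\}$, where $\overline{f_i}$ is the homogeneous component of highest degree of $f_i$, and assume $I=(R)$ is principal. Then there exists a $\deg_2$-homogeneous polynomial $h(x_1,x_2)$ (possibly zero) whose $\deg_2$ equals $d_3$ or $-\infty$ such that, setting $x_3'=x_3+h(x_1,x_2)$, $R$ is a nonzero scalar multiple of (or, in the first case, equal to) one of the following: (1) $0$; (2) $x_3'$; (3) $x_1^{e_1}+cx_2^{e_2}$ with $c\in K^*$, $\gcd(e_1,e_2)=1$; (4) $(x_2+ax_1^{e_1})x_3'+cx_1^k$ with $c\in K^*$, $a\in K$, $k\ge 2$, $e_1\ge 1$; (5) $x_1^kx_3'+P(x_1,x_2)$ with $k\ge 1$ and $P$ $\deg_2$-homogeneous; (6) ${x_3'}^2+cx_2^3$ with $c\in K^*$; (7) ${x_3'}^2+cx_1x_2^2$ with $c\in K^*$; (8) ${x_3'}^2+cx_1^{r_1}$ with $c\in K^*$, $r_1\in 3+2\mathbb{N}$; (9) ${x_3'}^2+cx_1^{r_1}x_2$ with $c\in K^*$, $r_1\ge 1$; (10) ${x_3'}^2+ax_1^{e_1}+bx_2^2$ with $ab\ne 0$, $e_1\in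 3+2\mathbb{N}$; (11) ${x_3'}^2+(ax_1^{e_1}+bx_2)x_1^{r_1}$ with $ab\ne 0$, $e_1\ge 1$; (12) ${x_3'}^2+(a_1x_1^{e_1}+b_1x_2)(a_2x_1^{e_1}+b_2x_2)$ with $a_1b_2-b_1a_2\ne 0$, $e_1\ge 1$; (13) ${x_3'}^2+(a_1x_1+b_1x_2)(a_2x_1+b_2x_2)^2$ with $(a_i,b_i)\ne(0,0)$ for $i=1,2$; (14) ${x_3'}^2+(ax_1^{e_1}+bx_2)^2x_1$ with $ab\ne 0$, $e_1\ge 2$.
   Context: $\mathbb{N}=\{0,1,2,\dots\}$; $\deg_2(0)=-\infty$. *)

(* Defs.v *)
From HB Require Import structures.
From mathcomp Require Import all_boot all_order all_algebra.
From mathcomp Require Import mpoly.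
Set Implicit Arguments. Unset Strict Implicit. Unset Printing Implicit Defensive.
Import Order.TTheory GRing.Theory.
Local Open Scope ring_scope.

(* Variables x1, x2, x3 of K[x1,x2,x3] are 'X_i0, 'X_i1, 'X_i2. *)
Definition i0 : 'I_3 := @Ordinal 3 0 isT.
Definition i1 : 'I_3 := @Ordinal 3 1 isT.
Definition i2 : 'I_3 := @Ordinal 3 2 isT.

Section Defs.
Context (K : fieldType).

(* standard degree deg_1 (deg_1 0 is irrelevant here; we use msize p - 1) *)
Definition deg1 (p : {mpoly K[3]}) : nat := (msize p).-1.

Definition top_comp (p : {mpoly K[3]}) : {mpoly K[3]} :=
  \sum_(m <- msupp p | mdeg m == deg1 p) p@_m *: 'X_[m].

Definition wdeg (w : 'I_3 -> nat) (m : 'X_{1..3}) : nat := (\sum_i m i * w i)%N.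

(* p is w-homogeneous of weighted degree k (vacuously true for p = 0) *)
Definition whomog_of (w : 'I_3 -> nat) (k : nat) (p : {mpoly K[3]}) : Prop :=
  forall m, m \in msupp p -> wdeg w m = k.

Definition whomog (w : 'I_3 -> nat) (p : {mpoly K[3]}) : Prop :=
  exists k, whomog_of w k p.

Definition in_x1x2 (p : {mpoly K[3]}) : Prop :=
  forall m, m \in msupp p -> m i2 = 0%N.

Definition poly_aut (f : 3.-tuple {mpoly K[3]}) : Prop :=
  exists g : 3.-tuple {mpoly K[3]},
    (forall i : 'I_3, (tnth g i) \mPo f = 'X_i) /\
    (forall i : 'I_3, (tnth f i) \mPo g = 'X_i).

Definition odd_ge3 (e : nat) : Prop := exists j : nat, e = (3 + 2 * j)%N.

(* The list (1)-(14) of normal forms, in the variables x1, x2 and y = x3'. *)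
Definition normal_form (w : 'I_3 -> nat) (y F : {mpoly K[3]}) : Prop :=
  let x1 := 'X_i0 : {mpoly K[3]} in
  let x2 := 'X_i1 : {mpoly K[3]} in
  (* (1) *) F = 0
  \/ (* (2) *) F = y
  \/ (* (3) *) (exists (c : K) (e1 e2 : nat), c != 0 /\ gcdn e1 e2 = 1%N /\
                 F = x1 ^+ e1 + c *: x2 ^+ e2)
  \/ (* (4) *) (exists (c a : K) (k e1 : nat), c != 0 /\ (2 <= k)%N /\ (1 <= e1)%N /\
                 F = (x2 + a *: x1 ^+ e1) * y + c *: x1 ^+ k)
  \/ (* (5) *) (exists (k : nat) (P : {mpoly K[3]}), (1 <= k)%N /\ in_x1x2 P /\ whomog w P /\
                 F = x1 ^+ k * y + P)
  \/ (* (6) *) (exists c : K, c != 0 /\ F = y ^+ 2 + c *: x2 ^+ 3)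
  \/ (* (7) *) (exists c : K, c != 0 /\ F = y ^+ 2 + c *: (x1 * x2 ^+ 2))
  \/ (* (8) *) (exists (c : K) (r1 : nat), c != 0 /\ odd_ge3 r1 /\
                 F = y ^+ 2 + c *: x1 ^+ r1)
  \/ (* (9) *) (exists (c : K) (r1 : nat), c != 0 /\ (1 <= r1)%N /\
                 F = y ^+ 2 + c *: (x1 ^+ r1 * x2))
  \/ (* (10) *) (exists (a b : K) (e1 : nat), a * b != 0 /\ odd_ge3 e1 /\
                 F = y ^+ 2 + a *: x1 ^+ e1 + b *: x2 ^+ 2)
  \/ (* (11) *) (exists (a b : K) (e1 r1 : nat), a * b != 0 /\ (1 <= e1)%N /\
                 F = y ^+ 2 + (a *: x1 ^+ e1 + b *: x2) * x1 ^+ r1)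
  \/ (* (12) *) (exists (a1 b1 a2 b2 : K) (e1 : nat), a1 * b2 - b1 * a2 != 0 /\ (1 <= e1)%N /\
                 F = y ^+ 2 + (a1 *: x1 ^+ e1 + b1 *: x2) * (a2 *: x1 ^+ e1 + b2 *: x2))
  \/ (* (13) *) (exists (a1 b1 a2 b2 : K), (a1, b1) != (0, 0) /\ (a2, b2) != (0, 0) /\
                 F = y ^+ 2 + (a1 *: x1 + b1 *: x2) * (a2 *: x1 + b2 *: x2) ^+ 2)
  \/ (* (14) *) (exists (a b : K) (e1 : nat), a * b != 0 /\ (2 <= e1)%N /\
                 F = y ^+ 2 + (a *: x1 ^+ e1 + b *: x2) ^+ 2 * x1).

End Defs.

(* Main.v *)
(* Let [N] be the weighted degree of [R], [d_i = deg1 f_i] and [g] the inverse of [f].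

   Degree bound.  If the leading part of [P] is [R^s * Q] with [Q] prime to [R], then
   [deg2 P <= deg1 (P(f)) + s * (d_1 + d_2 + d_3 - 3)]: differentiate [s] times and use that the
   inverse of the jacobian matrix of [f] has polynomial entries of small degree.  Applied to a
   component of [g] whose leading part is divisible by [R], this gives
   [N <= d_1 + d_2 + d_3 - 2], which leaves few monomials in [R].  Reading off the list is then
   elementary, except that squarefree equations [x3'^2 + C(x1, x2)] of Kleinian singularities of
   type D and E satisfy the bound and must be excluded.

   Rigidity.  For a suitable [l], the leading part of [d/dx_l] written in the coordinates [f],
   once divided by a power of [R], is a homogeneous locally nilpotent derivation killing [R] and
   nonzero modulo [R].  Its flow yields a nonconstant
   polynomial curve in [R = 0] along which some homogeneous form of positive degree is a nonzero
   constant.  Splitting that form into binary factors, one meets equations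
   [a p^m + b q^n = c] with [m, n >= 2] and [a b c <> 0] in [K[s]], which force [p] and [q] to be
   constant: no such curve exists for the types D and E. *)
Require Import Defs.
From HB Require Import structures.
From mathcomp Require Import all_boot all_order all_algebra.
From mathcomp Require Import mpoly.
From mathcomp Require Import zify ring.
Set Implicit Arguments. Unset Strict Implicit.
Import Order.TTheory GRing.Theory Num.Theory.
Local Open Scope ring_scope.

(** * Weighted degrees *)

(** A component [g_j] of the inverse whose leading part is [R ^+ s * Q] with [s > 0] serves twice:
    it gives the degree bound, and it fixes the choice of [l]. Any [l] other than [j] will do,
    because d/dx_l kills [g_j(f) = x_j]; its leading part then kills [R ^+ s * Q], hence [R], since
    a locally nilpotent derivation that kills a nonzero product kills the factors. As [R] is a
    constant of this derivation, powers of [R] can be divided out of it without losing nilpotency.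
    The delicate point is the form that stays constant along the flow: in degree 0 it would say
    nothing. Powers of [x1] and [x2] of equal degree are combined to avoid this, which requires that
    no binomial in them vanishes on the leading parts of [f]; this is verified where [R] is
    quadratic in [x3], the only case in which rigidity is called upon. Positivity of the degree also
    keeps the curve away from the origin. The factors in the equation of the surface are then
    coprime along the curve and become perfect powers, which is how equations in two powers arise
    where the surface is not given by one. *)

Section Grading.
Variable K : fieldType.
Implicit Types (p q : {mpoly K[3]}) (w v : 'I_3 -> nat) (j k : int) (m : 'X_{1..3}).

Lemma wdegD w m1 m2 : wdeg w (m1 + m2)%MM = (wdeg w m1 + wdeg w m2)%N.
Proof. by rewrite /wdeg -big_split; apply: eq_bigr => i _; rewrite mnmDE mulnDl. Qed.

Lemma wdeg0 w : wdeg w 0%MM = 0%N.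
Proof. by rewrite /wdeg big1 // => i _; rewrite mnm0E. Qed.

Lemma wdegU w i : wdeg w U_(i)%MM = w i.
Proof.
rewrite /wdeg (bigD1 i) //= mnm1E eqxx mul1n big1 ?addn0 // => j ji.
by rewrite mnm1E eq_sym (negPf ji).
Qed.

Lemma wdeg_mdeg m : wdeg (fun=> 1%N) m = mdeg m.
Proof. by rewrite /wdeg mdegE; apply: eq_bigr => i _; rewrite muln1. Qed.

(** Degrees are integers so that derivatives and derivations of negative degree need no truncation;
    a negative [k] forces [p = 0], here and in [whom]. *)
Definition wle w k p := forall m, p@_m != 0 -> (wdeg w m)%:Z <= k.
Definition whom w k p := forall m, p@_m != 0 -> (wdeg w m)%:Z = k.
Definition wpart w k p : {mpoly K[3]} :=
  \sum_(m <- msupp p | (wdeg w m)%:Z == k) p@_m *: 'X_[m].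

Lemma whomE w (n : nat) p : whom w n p <-> whomog_of w n p.
Proof.
split=> h m; first by rewrite mcoeff_msupp => /h [].
by rewrite -mcoeff_msupp => /h ->.
Qed.

Lemma coef_wpart w k p m :
  (wpart w k p)@_m = if (wdeg w m)%:Z == k then p@_m else 0.
Proof.
rewrite /wpart raddf_sum /= (eq_bigr (fun m' => p@_m' * (m' == m)%:R)); last first.
  by move=> m' _; rewrite mcoeffZ mcoeffX.
have [mk|mk] := ifPn.
  have [ms|ms] := boolP (m \in msupp p); last first.
    rewrite (memN_msupp_eq0 ms) big_seq_cond big1 // => m' /andP[m's _].
    by case: eqP => [e|]; rewrite ?mulr0 //; move: ms; rewrite -e m's.
  rewrite big_mkcond (bigD1_seq m) ?msupp_uniq //= mk eqxx mulr1 big1 ?addr0 //.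
  by move=> m' /negPf ->; rewrite mulr0 if_same.
rewrite big1 // => m' /eqP m'k; case: eqP => [e|]; rewrite ?mulr0 //.
by rewrite -e m'k eqxx in mk.
Qed.

Lemma wpartD w k p q : wpart w k (p + q) = wpart w k p + wpart w k q.
Proof.
by apply/mpolyP => m; rewrite !(mcoeffD, coef_wpart); case: ifP; rewrite ?addr0.
Qed.

Lemma wpartZ w k c p : wpart w k (c *: p) = c *: wpart w k p.
Proof.
by apply/mpolyP => m; rewrite !(mcoeffZ, coef_wpart); case: ifP; rewrite ?mulr0.
Qed.

Lemma wpart0 w k : wpart w k 0 = 0.
Proof. by apply/mpolyP => m; rewrite coef_wpart mcoeff0; case: ifP. Qed.

Lemma wpart_sum w k (I : Type) (r : seq I) (P : pred I) (F : I -> {mpoly K[3]}) :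
  wpart w k (\sum_(i <- r | P i) F i) = \sum_(i <- r | P i) wpart w k (F i).
Proof. exact: (big_morph _ (wpartD w k) (wpart0 w k)). Qed.

Lemma whom_wpart w k p : whom w k (wpart w k p).
Proof. by move=> m; rewrite coef_wpart; case: ifP => [/eqP // |_]; rewrite eqxx. Qed.

Lemma wpart_id w k p : whom w k p -> wpart w k p = p.
Proof.
move=> h; apply/mpolyP => m; rewrite coef_wpart; case: eqP => // mk.
by case: (eqVneq p@_m 0) => [->//|/h].
Qed.

Lemma wpart_whom w j k p : whom w k p -> j != k -> wpart w j p = 0.
Proof.
move=> h jk; apply/mpolyP => m; rewrite coef_wpart mcoeff0; case: eqP => // mk.
by apply/eqP; apply: contraNT jk => /h <-; rewrite mk.
Qed.

Lemma whom_wle w k p : whom w k p -> wle w k p.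
Proof. by move=> h m /h ->. Qed.

Lemma whom0 w k : whom w k 0.
Proof. by move=> m; rewrite mcoeff0 eqxx. Qed.

Lemma whomD w k p q : whom w k p -> whom w k q -> whom w k (p + q).
Proof.
move=> hp hq m; rewrite mcoeffD; have [->|/hp //] := eqVneq p@_m 0.
by rewrite add0r; apply: hq.
Qed.

Lemma whomZ w k c p : whom w k p -> whom w k (c *: p).
Proof. by move=> hp m; rewrite mcoeffZ mulf_eq0 negb_or => /andP[_ /hp]. Qed.

Lemma whomN w k p : whom w k p -> whom w k (- p).
Proof. by move=> hp; rewrite -scaleN1r; apply: whomZ. Qed.

Lemma whomB w k p q : whom w k p -> whom w k q -> whom w k (p - q).
Proof. by move=> hp hq; apply/whomD/whomN. Qed.

Lemma whom_sum w k (I : Type) (r : seq I) (P : pred I) (F : I -> {mpoly K[3]}) :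
  (forall i, P i -> whom w k (F i)) -> whom w k (\sum_(i <- r | P i) F i).
Proof. by move=> h; apply: big_ind h; [apply: whom0|apply: whomD]. Qed.

Lemma wle0 w k : wle w k 0.
Proof. by move=> m; rewrite mcoeff0 eqxx. Qed.

Lemma wleD w k p q : wle w k p -> wle w k q -> wle w k (p + q).
Proof.
move=> hp hq m; rewrite mcoeffD; have [->|/hp //] := eqVneq p@_m 0.
by rewrite add0r; apply: hq.
Qed.

Lemma wleZ w k c p : wle w k p -> wle w k (c *: p).
Proof. by move=> hp m; rewrite mcoeffZ mulf_eq0 negb_or => /andP[_ /hp]. Qed.

Lemma wle_sum w k (I : Type) (r : seq I) (P : pred I) (F : I -> {mpoly K[3]}) :
  (forall i, P i -> wle w k (F i)) -> wle w k (\sum_(i <- r | P i) F i).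
Proof. by move=> h; apply: big_ind h; [apply: wle0|apply: wleD]. Qed.

Lemma wle_trans w j k p : j <= k -> wle w j p -> wle w k p.
Proof. by move=> jk h m /h /le_trans; apply. Qed.

Lemma mcoeffM_neq0 p q m : (p * q)@_m != 0 ->
  exists m1 m2, [/\ p@_m1 != 0, q@_m2 != 0 & m = (m1 + m2)%MM].
Proof.
rewrite -mcoeff_msupp => /msuppM_le/allpairsP[[m1 m2]] /= [h1 h2 ->].
by exists m1, m2; rewrite -!mcoeff_msupp.
Qed.

Lemma whomM w j k p q : whom w j p -> whom w k q -> whom w (j + k) (p * q).
Proof.
move=> hp hq m /mcoeffM_neq0[m1 [m2 [/hp <- /hq <- ->]]].
by rewrite wdegD PoszD.
Qed.

Lemma wleM w j k p q : wle w j p -> wle w k q -> wle w (j + k) (p * q).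
Proof.
move=> hp hq m /mcoeffM_neq0[m1 [m2 [/hp h1 /hq h2 ->]]].
by rewrite wdegD PoszD lerD.
Qed.

Lemma whomC w c : whom w 0 c%:MP.
Proof.
move=> m; rewrite mcoeffC; case: (eqVneq m 0%MM) => [->|]; rewrite ?mulr0 ?eqxx //.
by rewrite wdeg0.
Qed.

Lemma whomU w i : whom w (w i) 'X_i.
Proof.
move=> m; rewrite mcoeffX; case: (eqVneq U_(i)%MM m) => [<-|]; last by rewrite eqxx.
by rewrite wdegU.
Qed.

Lemma whomXn w k p n : whom w k p -> whom w (k * n%:Z) (p ^+ n).
Proof.
move=> hp; elim: n => [|n IH]; first by rewrite mulr0; apply: whomC.
by rewrite exprS intS mulrDr mulr1; apply: whomM.
Qed.

Lemma wleXn w k p n : wle w k p -> wle w (k * n%:Z) (p ^+ n).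
Proof.
move=> hp; elim: n => [|n IH]; first by rewrite mulr0; apply/whom_wle/whomC.
by rewrite exprS intS mulrDr mulr1; apply: wleM.
Qed.

Lemma wpartMl w j k p q : whom w j p ->
  wpart w (j + k) (p * q) = p * wpart w k q.
Proof.
move=> hp; rewrite -{1}[q](subrK (wpart w k q)) mulrDr wpartD.
rewrite [X in _ + X]wpart_id; last exact/whomM/whom_wpart.
rewrite (_ : wpart w _ _ = 0) ?add0r //; apply/mpolyP => m.
rewrite coef_wpart mcoeff0; case: eqP => // mk; apply/eqP; apply: contraT.
move=> /mcoeffM_neq0[m1 [m2 [/hp h1]]]; rewrite mcoeffB coef_wpart => h2 e.
move: mk; rewrite e wdegD PoszD h1 => /addrI mk.
by move: h2; rewrite mk eqxx subrr eqxx.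
Qed.

Lemma wpart_wle w j k p : wle w k p -> k < j -> wpart w j p = 0.
Proof.
move=> h jk; apply/mpolyP => m; rewrite coef_wpart mcoeff0; case: eqP => // mk.
by apply/eqP; apply: contraTT jk => /h; rewrite mk -leNgt.
Qed.

(** Only components of degrees [j] and [k] can meet in degree [j + k]. The bounds need not be
    attained. *)
Lemma wpartM w j k p q : wle w j p -> wle w k q ->
  wpart w (j + k) (p * q) = wpart w j p * wpart w k q.
Proof.
move=> hp hq; rewrite -{1}[p](subrK (wpart w j p)) mulrDl wpartD.
rewrite (wpartMl _ _ (@whom_wpart w j p)) (_ : wpart w _ _ = 0) ?add0r //.
apply/mpolyP => m; rewrite coef_wpart mcoeff0; case: eqP => // mk.
apply/eqP; apply: contraT => /mcoeffM_neq0[m1 [m2 []]].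
rewrite mcoeffB coef_wpart; case: ifP => [_|/eqP ne]; rewrite ?subrr ?eqxx // subr0.
move=> /hp h1 /hq h2 e; move: mk; rewrite e wdegD; lia.
Qed.

Lemma wle_pred w k p : wle w k p -> wpart w k p = 0 -> wle w (k - 1) p.
Proof.
move=> hp h0 m hm; have := hp m hm; have := coef_wpart w k p m.
rewrite h0 mcoeff0; case: eqP => [_ e|]; first by rewrite -e eqxx in hm.
lia.
Qed.

Lemma wpart_neq0P w k p : reflect (exists2 m, p@_m != 0 & (wdeg w m)%:Z = k)
  (wpart w k p != 0).
Proof.
apply: (iffP idP) => [|[m pm mk]]; last first.
  by apply: contraNneq pm => /mpolyP/(_ m); rewrite coef_wpart mk eqxx mcoeff0 => ->.
rewrite -msupp_eq0; case e: (msupp _) => [//|m s] _; exists m.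
  have : m \in msupp (wpart w k p) by rewrite e mem_head.
  by rewrite mcoeff_msupp coef_wpart; case: ifP; rewrite ?eqxx.
have : m \in msupp (wpart w k p) by rewrite e mem_head.
by rewrite mcoeff_msupp => /whom_wpart.
Qed.

Lemma mpoly_neq0P p : reflect (exists m, p@_m != 0) (p != 0).
Proof.
apply: (iffP idP) => [|[m]]; last by apply: contraNneq => ->; rewrite mcoeff0.
rewrite -msupp_eq0; case e: (msupp _) => [//|m s] _; exists m.
by rewrite -mcoeff_msupp e mem_head.
Qed.

Lemma wle_exists w p : exists k : nat, wle w k p.
Proof.
exists (\max_(m <- msupp p) wdeg w m)%N => m; rewrite -mcoeff_msupp => hm.
by rewrite lez_nat; apply: leq_bigmax_seq.
Qed.

Lemma wtop_exists w p : p != 0 ->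
  exists k : nat, wle w k p /\ wpart w k p != 0.
Proof.
move=> p0; have [k hk] := wle_exists w p; elim: k hk => [|k IH] hk.
  exists 0%N; split=> //; apply: contraNneq p0 => h0; apply/eqP/mpolyP => m.
  by rewrite mcoeff0; apply/eqP; apply: contraT => /(wle_pred hk h0).
have [h0|] := eqVneq (wpart w k.+1 p) 0; last by exists k.+1.
by apply: IH; have := wle_pred hk h0; rewrite intS addrC addKr.
Qed.

Lemma whom_ge0 w k p : whom w k p -> p != 0 -> 0 <= k.
Proof. by move=> h /mpoly_neq0P[m /h <-]. Qed.

Lemma whom_uniq w j k p : whom w j p -> whom w k p -> p != 0 -> j = k.
Proof. by move=> h1 h2 /mpoly_neq0P[m hm]; rewrite -(h1 m hm) -(h2 m hm). Qed.

Lemma whom_wle_le w j k p : whom w j p -> wle w k p -> p != 0 -> j <= k.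
Proof. by move=> h1 h2 /mpoly_neq0P[m hm]; rewrite -(h1 m hm) h2. Qed.

(** A component of [q] in another degree, multiplied by [p], would give a nonzero component of
    [p * q] outside degree [k]. *)
Lemma whom_divl w j k p q : p != 0 ->
  whom w j p -> whom w k (p * q) -> whom w (k - j) q.
Proof.
move=> p0 hp hpq m hm; apply/eqP; apply: contraT => mk.
have := wpartMl (wdeg w m) q hp; rewrite (wpart_whom hpq); last first.
  by apply: contraNneq mk => <-; rewrite addrC addKr.
move/esym/eqP; rewrite mulf_eq0 (negPf p0) /= => /negPn/negP[].
by apply/wpart_neq0P; exists m.
Qed.

Lemma wpart_mderiv w k i p :
  wpart w (k - (w i)%:Z) p^`M(i) = (wpart w k p)^`M(i).
Proof.
apply/mpolyP => m; rewrite !(coef_wpart, mcoeff_deriv) wdegD wdegU PoszD.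
by rewrite -subr_eq0 opprB addrA subr_eq0; case: ifP; rewrite ?mul0rn.
Qed.

Lemma wle_mderiv w k i p : wle w k p -> wle w (k - (w i)%:Z) p^`M(i).
Proof.
move=> h m; rewrite mcoeff_deriv => hm.
have /h : p@_(m + U_(i)) != 0 by apply: contraNneq hm => ->; rewrite mul0rn.
by rewrite wdegD wdegU PoszD lerBrDr.
Qed.

Lemma whom_mderiv w k i p : whom w k p -> whom w (k - (w i)%:Z) p^`M(i).
Proof. by move=> h; rewrite -(wpart_id h) -wpart_mderiv; apply: whom_wpart. Qed.

Lemma wle_wpartXn w k p n : wle w k p ->
  wpart w (k * n%:Z) (p ^+ n) = wpart w k p ^+ n.
Proof.
move=> hp; elim: n => [|n IH]; first by rewrite mulr0 wpart_id //; apply: whomC.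
by rewrite !exprS intS mulrDr mulr1 wpartM ?IH //; apply: wleXn.
Qed.

(** * Leading parts under substitution *)

Section Comp.
Variables (w v : 'I_3 -> nat) (f : 3.-tuple {mpoly K[3]}).
Hypothesis hf : forall i, wle v (w i) (tnth f i).
Let fb := [tuple wpart v (w i) (tnth f i) | i < 3].

Lemma comp_monom_top m :
  wle v (wdeg w m) ('X_[m] \mPo f) /\
  wpart v (wdeg w m) ('X_[m] \mPo f) = 'X_[m] \mPo fb.
Proof.
rewrite !comp_mpolyX /wdeg.
pose Q (n : nat) p q := wle v n p /\ wpart v n p = q.
suff: Q (\sum_i m i * w i)%N (\prod_i tnth f i ^+ m i) (\prod_i tnth fb i ^+ m i) by [].
apply: (big_ind3 Q); rewrite /Q.
- by split; [apply/whom_wle/whomC|apply/wpart_id/whomC].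
- move=> n1 p1 q1 n2 p2 q2 [h1 <-] [h2 <-]; rewrite PoszD.
  by split; [apply: wleM|apply: wpartM].
move=> i _; rewrite tnth_mktuple mulnC PoszM.
by split; [apply: wleXn|apply: wle_wpartXn].
Qed.

Lemma wle_comp k p : wle w k p -> wle v k (p \mPo f).
Proof.
move=> h; rewrite comp_mpolyEX big_seq; apply: wle_sum => m hm; apply: wleZ.
have [h1 _] := comp_monom_top m; apply: wle_trans h1.
by apply: h; rewrite -mcoeff_msupp.
Qed.

(** When the leading part of [p] vanishes on the leading parts of [f], this says that the degree of
    [p \mPo f] drops below [k]: membership in the ideal is read off from degrees. *)
Lemma wpart_comp k p : wle w k p ->
  wpart v k (p \mPo f) = (wpart w k p) \mPo fb.
Proof.
move=> h; rewrite comp_mpolyEX wpart_sum [in RHS]/wpart raddf_sum.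
rewrite [RHS]big_mkcond; apply: eq_big_seq => m hm; rewrite wpartZ.
have [h1 h2] := comp_monom_top m; case: eqP => mk.
  by rewrite -mk h2 [RHS]comp_mpolyZ.
rewrite (wpart_wle h1) ?scaler0 // lt_neqAle; apply/andP; split; first exact/eqP.
by apply: h; rewrite -mcoeff_msupp.
Qed.

End Comp.

Lemma whom_comp w v (f : 3.-tuple {mpoly K[3]}) k p :
  (forall i, whom v (w i) (tnth f i)) -> whom w k p -> whom v k (p \mPo f).
Proof.
move=> hf hp; have hf' i : wle v (w i) (tnth f i) by apply/whom_wle/hf.
have := wpart_comp hf' (whom_wle hp); rewrite (wpart_id hp).
have -> : [tuple wpart v (w i) (tnth f i) | i < 3] = f; last first.
  by move=> <-; apply: whom_wpart.
by apply: eq_from_tnth => i; rewrite tnth_mktuple wpart_id.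
Qed.

End Grading.

(** * Pencils of polynomials and sums of powers *)

Section Pencil.
Variables (K : closedFieldType) (A : comAlgType K).
Implicit Types (a b : A) (p : {poly K}) (n : nat).

(** The binary form of degree [n] with dehomogenization [p], evaluated at [(a, b)]; if [p] has
    degree below [n], the missing degree becomes a power of [a]. *)
Definition pencil n p a b : A := \sum_(j < n.+1) p`_j *: (a ^+ (n - j) * b ^+ j).

Lemma pencilZ n c p a b : pencil n (c *: p) a b = c *: pencil n p a b.
Proof. by rewrite scaler_sumr; apply: eq_bigr => j _; rewrite coefZ scalerA. Qed.

Lemma pencilS n p r a b : (size p <= n.+1)%N ->
  pencil n.+1 (p * ('X - r%:P)) a b = pencil n p a b * (b - r *: a).
Proof.
move=> sp; rewrite /pencil !mulrBr !mulr_suml.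
rewrite (eq_bigr (fun j : 'I_n.+2 => (p * 'X)`_j *: (a ^+ (n.+1 - j) * b ^+ j)
  - r *: (p`_j *: (a ^+ (n.+1 - j) * b ^+ j)))); last first.
  by move=> j _; rewrite coefB scalerBl [p * r%:P]mulrC mul_polyC coefZ -!scalerA.
rewrite sumrB; congr (_ - _).
  rewrite big_ord_recl coefMX eqxx scale0r add0r; apply: eq_bigr => j _.
  by rewrite coefMX /= -scalerAl -mulrA -exprSr /bump add1n subSS.
rewrite big_ord_recr /= [p`_n.+1]nth_default // scale0r scaler0 addr0.
apply: eq_bigr => j _; rewrite -!scalerAl -!scalerAr scalerA mulrC -scalerA.
by rewrite mulrAC -exprSr subSn // -ltnS.
Qed.

Lemma pencil_factor n c (rs : seq K) a b : (size rs <= n)%N ->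
  pencil n (c *: \prod_(r <- rs) ('X - r%:P)) a b =
  c *: (a ^+ (n - size rs) * \prod_(r <- rs) (b - r *: a)).
Proof.
rewrite pencilZ => hs; congr (_ *: _); elim: rs n hs => [|r rs IH] n /=.
  rewrite !big_nil subn0 mulr1 /pencil big_ord_recl coefC eqxx scale1r mulr1 subn0.
  by rewrite big1 ?addr0 // => j _; rewrite coefC scale0r.
case: n => // n hs; rewrite !big_cons [_ * \prod_(_ <- rs) _]mulrC pencilS.
  by rewrite IH // subSS -mulrA [_ * (b - _)]mulrC.
by rewrite size_prod_XsubC.
Qed.

Lemma pencil_split n p a b : (size p <= n.+1)%N -> p != 0 ->
  exists rs : seq K, [/\ size rs = (size p).-1,
    p = lead_coef p *: \prod_(r <- rs) ('X - r%:P) &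
    pencil n p a b = lead_coef p *: (a ^+ (n - size rs) * \prod_(r <- rs) (b - r *: a))].
Proof.
move=> sp p0; have [rs hrs] := closed_field_poly_normal p.
have srs : size rs = (size p).-1.
  by rewrite hrs size_scale ?lead_coef_eq0 // size_prod_XsubC.
exists rs; split=> //; rewrite [in LHS]hrs pencil_factor // srs.
by case: (size p) sp.
Qed.

End Pencil.

(** * Sums of powers and coprime powers in one variable *)

Section PolyCurves.
Variable K : closedFieldType.
Hypothesis hchar : [pchar K] =i pred0.
Implicit Types (F G P Q u v : {poly K}) (a b c : K) (m n k : nat).

Lemma natf_neq0_char0 n : (n.+1%:R : K) != 0.
Proof. by rewrite ((pcharf0P K).1 hchar). Qed.

Lemma deriv_neq0 P : (1 < size P)%N -> P^`() != 0.
Proof.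
case e: (size P) => [|[|n]] // _; apply/eqP => /polyP/(_ n).
rewrite coef_deriv coef0 => /eqP; rewrite -mulr_natr mulf_eq0 (negPf (natf_neq0_char0 _)).
have := lead_coef_eq0 P; rewrite lead_coefE e /= orbF => ->.
by rewrite -size_poly_eq0 e.
Qed.

Lemma size_expgt1 P n : (0 < n)%N -> (1 < size P)%N -> (1 < size (P ^+ n))%N.
Proof.
move=> n0 sP; rewrite -subn_gt0 subn1 size_exp muln_gt0 n0 andbT.
by case: (size P) sP => [|[]].
Qed.

Lemma size_le1_of_exp P n : (0 < n)%N -> (size (P ^+ n) <= 1)%N -> (size P <= 1)%N.
Proof. by move=> n0; apply: contraTT; rewrite -!ltnNge; apply: size_expgt1. Qed.

(** A common factor of [P] and [Q] divides [c], so they are coprime. Differentiating the relation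
    shows that [P ^+ (m - 1)] divides the derivative of [Q] times a power of [Q], hence the
    derivative itself, which has smaller degree than [Q]. Exchanging [P] and [Q] gives the
    contradiction used in [sum_of_powers]. *)
Lemma sum_of_powers_deriv P Q a b c m n : a != 0 -> b != 0 -> c != 0 ->
    (1 < m)%N -> (1 < n)%N -> a *: P ^+ m + b *: Q ^+ n = c%:P ->
    (1 < size P)%N -> (1 < size Q)%N -> (size P < size Q)%N.
Proof.
move=> a0 b0 c0; case: m => [|[|m]] //; case: n => [|[|n]] // _ _ e sP sQ.
have cop : coprimep P Q.
  apply/coprimepP => d /dvdpP[u hu] /dvdpP[v hv]; rewrite -size_poly_eq1 -dvdp1.
  have : d %| c%:P.
    rewrite -e; apply: dvdp_add; rewrite dvdpZr // exprS dvdp_mulr //.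
      by rewrite hu dvdp_mull.
    by rewrite hv dvdp_mull.
  by rewrite -[c%:P]mulr1 mul_polyC dvdpZr.
have : (a *: P ^+ m.+2 + b *: Q ^+ n.+2)^`() = 0 by rewrite e derivC.
rewrite derivD !derivZ !deriv_exp /=.
move/eqP; rewrite addr_eq0 => /eqP e'.
have dv : P ^+ m.+1 %| Q^`().
  have : P ^+ m.+1 %| b *: (Q^`() * Q ^+ n.+1 *+ n.+2).
    rewrite -dvdpNr -e' dvdpZr // -mulr_natr -polyC_natr mulrAC dvdp_mull //.
  rewrite dvdpZr // -mulr_natr -polyC_natr mulrC mul_polyC dvdpZr ?natf_neq0_char0 //.
  by rewrite Gauss_dvdpl // coprimep_expr // coprimep_expl.
have := dvdp_leq (deriv_neq0 sQ) dv; have := lt_size_deriv (_ : Q != 0).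
rewrite -size_poly_eq0; case: (size Q) sQ => // q sQ /(_ isT) h1 h2.
apply: leq_ltn_trans h1; apply: leq_trans h2.
rewrite exprS; apply: leq_trans (dvdp_leq _ (dvdp_mulr _ (dvdpp P))) => //.
by rewrite mulf_neq0 // ?expf_neq0 // -size_poly_eq0; case: (size P) sP.
Qed.

Lemma sum_of_powers P Q a b c m n : a != 0 -> b != 0 -> c != 0 ->
    (1 < m)%N -> (1 < n)%N -> a *: P ^+ m + b *: Q ^+ n = c%:P ->
    (size P <= 1)%N /\ (size Q <= 1)%N.
Proof.
move=> a0 b0 c0 hm hn e.
have cst R S a' b' m' n' : b' != 0 -> (1 < n')%N ->
    a' *: R ^+ m' + b' *: S ^+ n' = c%:P -> (size R <= 1)%N -> (size S <= 1)%N.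
  move=> b'0 hn' e' /size1_polyC hR; apply: (@size_le1_of_exp _ n'); first exact: ltnW.
  rewrite -(size_scale _ b'0) (_ : b' *: _ = c%:P - a' *: R ^+ m'); last first.
    by rewrite -e' addrC addKr.
  by rewrite hR -polyC_exp -mul_polyC -polyCM -polyCB size_polyC leq_b1.
have /orP[sP|sP] : (size P <= 1)%N || (1 < size P)%N by case: leqP.
   by split=> //; apply: (cst _ _ _ _ _ _ b0 hn e sP).
have e2 : b *: Q ^+ n + a *: P ^+ m = c%:P by rewrite addrC.
have /orP[sQ|sQ] : (size Q <= 1)%N || (1 < size Q)%N by case: leqP.
   by split=> //; apply: (cst _ _ _ _ _ _ a0 hm e2 sQ).
have h1 := sum_of_powers_deriv a0 b0 c0 hm hn e sP sQ.
have h2 := sum_of_powers_deriv b0 a0 c0 hn hm e2 sQ sP.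
by have := ltn_trans h1 h2; rewrite ltnn.
Qed.

Lemma closed_root_exp c k : (0 < k)%N -> exists r : K, r ^+ k = c.
Proof.
move=> k0; have /closed_rootP[r] : size ('X^k - c%:P) != 1 by rewrite size_XnsubC // -lt0n.
by rewrite /root !hornerE subr_eq0 => /eqP; exists r.
Qed.

(** Induction on the degree of [F]: a root [r] of [F] is a root of [Q], so the [k]-th power of
    ['X - r%:P] divides [F * G], and even [F] because it is prime to [G]; cancel it on both
    sides. *)
Lemma coprime_power F G Q k : (0 < k)%N -> coprimep F G -> F * G = Q ^+ k ->
  exists u, F = u ^+ k.
Proof.
move=> k0; move: {2}(size F) (leqnn (size F)) => n.
elim: n F Q => [|n IH] F Q.
  rewrite size_poly_leq0 => /eqP -> _ _; exists 0; by rewrite expr0n eqn0Ngt k0.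
move=> sF cop e; have [s1|] := eqVneq (size F) 1.
  have /size1_polyC -> : (size F <= 1)%N by rewrite s1.
  have [r <-] := closed_root_exp F`_0 k0; exists r%:P; by rewrite polyC_exp.
move=> /closed_rootP[r /[dup] rF]; rewrite -dvdp_XsubCl => dF.
have rQ : root Q r.
  have : root (Q ^+ k) r by rewrite -e rootM rF.
  by rewrite /root horner_exp expf_eq0 k0.
move/factor_theorem: rQ => [Q1 hQ].
have copk : coprimep (('X - r%:P) ^+ k) G.
  by rewrite coprimep_expl //; apply: coprimep_dvdr cop.
have : ('X - r%:P) ^+ k %| F * G by rewrite e hQ exprMn dvdp_mull.
rewrite Gauss_dvdpl // => /dvdpP[F1 hF].
have X0 : ('X - r%:P) ^+ k != 0 by rewrite expf_neq0 // polyXsubC_eq0.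
have [F0|F0] := eqVneq F 0; first by exists 0; rewrite F0 expr0n eqn0Ngt k0.
have [|||u hu] := IH F1 Q1.
- rewrite -ltnS; apply: leq_trans sF; rewrite hF size_proper_mul.
    by rewrite size_exp_XsubC addnS /= -[X in (X < _)%N]addn0 ltn_add2l.
  by rewrite mulf_neq0 // lead_coef_eq0 //; apply: contraNneq F0 => F10; rewrite hF F10 mul0r.
- by apply: coprimep_dvdr cop; rewrite hF dvdp_mulr.
- apply: (mulIf X0); rewrite mulrAC -hF e hQ; by rewrite exprMn.
by exists (u * ('X - r%:P)); rewrite exprMn -hu.
Qed.

End PolyCurves.

Lemma big_I3 (R : Type) (idx : R) (op : Monoid.law idx) (F : 'I_3 -> R) :
  \big[op/idx]_i F i = op (op (F i0) (F i1)) (F i2).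
Proof.
rewrite !big_ord_recl big_ord0 Monoid.mulm1 Monoid.mulmA.
by congr (op (op (F _) (F _)) (F _)); apply: val_inj.
Qed.

Lemma wdegE (w : 'I_3 -> nat) (m : 'X_{1..3}) :
  wdeg w m = (m i0 * w i0 + m i1 * w i1 + m i2 * w i2)%N.
Proof. by rewrite /wdeg big_I3. Qed.

Lemma I3_ind (Pr : 'I_3 -> Prop) : Pr i0 -> Pr i1 -> Pr i2 -> forall i, Pr i.
Proof.
move=> h0 h1 h2 [[|[|[|//]]] hi]; [move: h0|move: h1|move: h2];
by congr Pr; apply: val_inj.
Qed.

(** * Binary forms in two elements of an algebra *)

Section InPencil.
Variables (K : closedFieldType) (A : comAlgType K) (P Q : A).
Implicit Types (u v : A) (n : nat).

Definition in_pencil n v := exists2 p : {poly K}, (size p <= n.+1)%N & v = pencil n p P Q.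

Lemma in_pencilD n u v : in_pencil n u -> in_pencil n v -> in_pencil n (u + v).
Proof.
move=> [p sp ->] [q sq ->]; exists (p + q).
  by rewrite (leq_trans (size_polyD _ _)) // geq_max sp.
by rewrite -big_split; apply: eq_bigr => j _; rewrite coefD scalerDl.
Qed.

Lemma in_pencilZ n c v : in_pencil n v -> in_pencil n (c *: v).
Proof.
move=> [p sp ->]; exists (c *: p); last by rewrite pencilZ.
exact: leq_trans (size_scale_leq _ _) sp.
Qed.

Lemma in_pencil0 n : in_pencil n 0.
Proof.
by exists 0; rewrite ?size_poly0 // /pencil big1 // => j _; rewrite coef0 scale0r.
Qed.

(** Both forms are split into linear factors, so that concatenating the lists of roots replaces a
    convolution of coefficients. *)
Lemma in_pencilM m n u v : in_pencil m u -> in_pencil n v -> in_pencil (m + n) (u * v).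
Proof.
move=> [p sp hu] [q sq hv].
have [p0|p0] := eqVneq p 0.
  have [q0 _ e] := in_pencil0 m; rewrite hu p0 /pencil big1 ?mul0r; last first.
    by move=> j _; rewrite coef0 scale0r.
  exact: in_pencil0.
have [q0|q0] := eqVneq q 0.
  rewrite hv q0 /pencil big1 ?mulr0; first exact: in_pencil0.
  by move=> j _; rewrite coef0 scale0r.
have [rs [srs ep {}hu']] := pencil_split P Q sp p0.
have [ss [sss eq {}hv']] := pencil_split P Q sq q0.
have hrs : (size rs <= m)%N by rewrite srs; case: (size p) sp.
have hss : (size ss <= n)%N by rewrite sss; case: (size q) sq.
exists ((lead_coef p * lead_coef q) *: \prod_(r <- rs ++ ss) ('X - r%:P)).
  apply: leq_trans (size_scale_leq _ _) _.
  by rewrite size_prod_XsubC size_cat ltnS leq_add.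
rewrite pencil_factor size_cat ?leq_add // hu hv hu' hv'.
rewrite -scalerAl -scalerAr scalerA big_cat /=.
rewrite (_ : m + n - _ = m - size rs + (n - size ss))%N; last by lia.
by rewrite exprD mulrACA.
Qed.

Lemma in_pencil1 : in_pencil 0 1.
Proof.
exists 1; rewrite ?size_poly1 // /pencil big_ord_recl big_ord0.
by rewrite coefC eqxx scale1r mulr1 addr0.
Qed.

Lemma in_pencilP : in_pencil 1 P.
Proof.
exists 1; rewrite ?size_poly1 // /pencil !big_ord_recl big_ord0 !coefC /=.
by rewrite scale1r scale0r !addr0 mulr1.
Qed.

Lemma in_pencilQ : in_pencil 1 Q.
Proof.
exists 'X; rewrite ?size_polyX // /pencil !big_ord_recl big_ord0 !coefX /=.
by rewrite scale1r scale0r add0r addr0 mul1r.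
Qed.

Lemma in_pencilXn m n v : in_pencil m v -> in_pencil (m * n) (v ^+ n).
Proof.
move=> hv; elim: n => [|n IH]; first by rewrite muln0; apply: in_pencil1.
by rewrite mulnS exprS; apply: in_pencilM.
Qed.

Lemma in_pencilPn n : in_pencil n (P ^+ n).
Proof. by rewrite -[n in in_pencil n _]mul1n; apply/in_pencilXn/in_pencilP. Qed.

Lemma in_pencilQn n : in_pencil n (Q ^+ n).
Proof. by rewrite -[n in in_pencil n _]mul1n; apply/in_pencilXn/in_pencilQ. Qed.

End InPencil.

(** * Polynomial curves along which a form is constant *)

Section ConstantForms.
Variable K : closedFieldType.
Hypothesis hchar : [pchar K] =i pred0.
Implicit Types (P Q u v : {poly K}) (X : 'I_3 -> {poly K}) (w : 'I_3 -> nat).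

(** Size 1 means a nonzero constant, so [h] takes one nonzero value along the curve [X]; [0 < k]
    rules out the trivial choice of a constant [h]. *)
Definition const_form w X := exists (k : nat) (h : {mpoly K[3]}),
  [/\ (0 < k)%N, whomog_of w k h & size (mmap (@polyC K) X h) == 1%N].

Lemma size_exp_eq1 P n : (0 < n)%N -> (size (P ^+ n) == 1%N) = (size P == 1%N).
Proof.
move=> n0; apply/idP/idP => [|/size_poly1P[c c0 ->]].
  by case: n n0 => // n _; rewrite exprS size_mul_eq1 => /andP[].
by rewrite -polyC_exp size_polyC expf_neq0.
Qed.

Lemma size_eq1_le P : size P == 1%N -> (size P <= 1)%N.
Proof. by move/eqP ->. Qed.

Lemma size_prod_eq1 (I : eqType) (s : seq I) (F : I -> {poly K}) :
  size (\prod_(i <- s) F i) == 1%N -> forall i, i \in s -> size (F i) == 1%N.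
Proof.
elim: s => // a s IH; rewrite big_cons size_mul_eq1 => /andP[ha hs] i.
by rewrite inE => /orP[/eqP->|] //; apply: IH.
Qed.

(** Along the curve, [h] becomes [g] times a single binary form of degree [n] in [P] and [Q],
    because [g] and [n] depend on the degree only. This form splits into factors [P] and
    [Q - r *: P], and all factors of a nonzero constant polynomial are constant. *)
Lemma pencil_const w X k (h : {mpoly K[3]}) P Q
    (g : nat -> nat -> nat -> {poly K}) (n : nat -> nat -> nat -> nat) :
  whomog_of w k h -> size (mmap (@polyC K) X h) == 1%N ->
  (forall i j l, exists2 v, in_pencil P Q (n i j l) v &
     X i0 ^+ i * X i1 ^+ j * X i2 ^+ l = g i j l * v) ->
  (forall i j l i' j' l',
    (i * w i0 + j * w i1 + l * w i2)%N = k -> (i' * w i0 + j' * w i1 + l' * w i2)%N = k ->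
    g i j l = g i' j' l' /\ n i j l = n i' j' l') ->
  exists i j l, [/\ (i * w i0 + j * w i1 + l * w i2)%N = k, size (g i j l) == 1%N &
    [\/ n i j l = 0%N, size P == 1%N | exists r, size (Q - r *: P) == 1%N]].
Proof.
move=> hh hc hg hu.
have h0 : h != 0.
  by apply/eqP => h0; rewrite h0 mmap0 size_poly0 in hc.
(* Any monomial of [h] fixes the common values of [g] and [n]. *)
have [m0] := mpoly_neq0P _ h0; rewrite -mcoeff_msupp => hm0.
have dm0 := hh _ hm0; rewrite wdegE in dm0.
exists (m0 i0), (m0 i1), (m0 i2); move: dm0; set G := g _ _ _; set N := n _ _ _ => dm0.
have [v [p sp hp] hv] : exists2 v, in_pencil P Q N v & mmap (@polyC K) X h = G * v.
  rewrite /mmap big_seq; apply: (big_ind (fun x => exists2 v, in_pencil P Q N v & x = G * v)).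
  - by exists 0; [apply: in_pencil0|rewrite mulr0].
  - move=> _ _ [v1 h1 ->] [v2 h2 ->]; exists (v1 + v2); first exact: in_pencilD.
    by rewrite mulrDr.
  move=> m hm; have dm := hh _ hm; rewrite wdegE in dm.
  have [v hv e] := hg (m i0) (m i1) (m i2).
  have [eg en] := hu _ _ _ _ _ _ dm0 dm.
  exists (h@_m *: v); first by rewrite /N en; apply: in_pencilZ.
  by rewrite /mmap1 big_I3 /= e mul_polyC /G eg scalerAr.
have p0 : p != 0.
  apply: contraTneq hc => p0; rewrite hv hp p0 /pencil big1 ?mulr0 ?size_poly0 // => j _.
  by rewrite coef0 scale0r.
have [rs [srs _ hs]] := pencil_split P Q sp p0.
move: hc; rewrite hv size_mul_eq1 hp hs size_scale ?lead_coef_eq0 //.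
rewrite size_mul_eq1 => /andP[hG /andP[h1 h2]]; split=> //.
case: rs srs h1 h2 {hs} => [|r rs] srs h1 h2; last first.
  by apply: Or33; exists r; apply: size_prod_eq1 h2 _ _; rewrite mem_head.
move: h1; rewrite subn0; case: (N) => [_|N'].
  exact: Or31.
by rewrite size_exp_eq1 // => h1; apply: Or32.
Qed.

(** A form of positive degree vanishes at the origin, so the curve cannot pass through it. All
    coprimality statements about factors along the curve come from here. *)
Lemma const_form_root w X : const_form w X ->
  forall r, ~ [/\ root (X i0) r, root (X i1) r & root (X i2) r].
Proof.
move=> [k [h [k0 hh hc]]] r [r0 r1 r2].
have : root (mmap (@polyC K) X h) r.
  rewrite /mmap big_seq /root horner_sum big1 // => m hm.
  have := hh m hm; rewrite wdegE /mmap1 big_I3 /= => dm.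
  have hr n p : root p r -> (0 < n)%N -> (p ^+ n).[r] = 0.
    by move=> /rootP e n0; rewrite horner_exp e expr0n eqn0Ngt n0.
  rewrite !hornerM; have [m00|m00] := posnP (m i0); last by rewrite hr // !mul0r mulr0.
  have [m10|m10] := posnP (m i1); last by rewrite [_.[r] * _.[r]]mulrC hr // !(mulr0, mul0r).
  have [m20|m20] := posnP (m i2); last by rewrite [X in _ * (_ * X)]hr // !(mulr0, mul0r).
  by move: k0; rewrite -dm m00 m10 m20.
by move/size_poly1P: hc => [c c0 ->]; rewrite rootC (negPf c0).
Qed.

Lemma sum_of_powers1 P Q a b m n : a != 0 -> b != 0 ->
    (1 < m)%N -> (1 < n)%N -> size (a *: P ^+ m + b *: Q ^+ n) == 1%N ->
    (size P <= 1)%N /\ (size Q <= 1)%N.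
Proof.
by move=> a0 b0 hm hn /size_poly1P[c c0]; apply: sum_of_powers a0 b0 c0 hm hn.
Qed.

Lemma sub_of_powers1 P Q b m n : b != 0 -> size (P ^+ m - b *: Q ^+ n) == 1%N ->
    (1 < m)%N -> (1 < n)%N -> (size P <= 1)%N /\ (size Q <= 1)%N.
Proof.
move=> b0 s hm hn; apply: (@sum_of_powers1 _ _ 1 (- b) m n); rewrite ?oner_eq0 ?oppr_eq0 //.
by rewrite scale1r scaleNr.
Qed.

Lemma size_addle1 P Q : (size P <= 1)%N -> (size Q <= 1)%N -> (size (P + Q)%R <= 1)%N.
Proof. by move=> hP hQ; rewrite (leq_trans (size_polyD _ _)) // geq_max hP. Qed.

Lemma size_scalele1 c P : (size P <= 1)%N -> (size (c *: P) <= 1)%N.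
Proof. by apply: leq_trans; apply: size_scale_leq. Qed.

Lemma size_mulle1 P Q : (size P <= 1)%N -> (size Q <= 1)%N -> (size (P * Q)%R <= 1)%N.
Proof.
move=> /size1_polyC -> /size1_polyC ->; by rewrite -polyCM size_polyC leq_b1.
Qed.

Lemma size_exp_le1 P n : (size P <= 1)%N -> (size (P ^+ n)%R <= 1)%N.
Proof. by move=> /size1_polyC ->; rewrite -polyC_exp size_polyC leq_b1. Qed.

End ConstantForms.

(** * Rigidity of the singularities of type D and E *)

Section Rigid.
Variable K : closedFieldType.
Hypothesis hchar : [pchar K] =i pred0.
Implicit Types (P Q u v : {poly K}) (a b : K).
Variables (w : 'I_3 -> nat) (X : 'I_3 -> {poly K}).
Hypothesis hX : const_form w X.
Local Notation U := (X i0).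
Local Notation V := (X i1).
Local Notation Y := (X i2).

Let all_const := forall i, (size (X i) <= 1)%N.

Lemma all_constI : (size U <= 1)%N -> (size V <= 1)%N -> (size Y <= 1)%N -> all_const.
Proof. by move=> h0 h1 h2; apply: I3_ind. Qed.

Lemma coprime_powers F G Q k : (0 < k)%N ->
  (forall r, root F r -> root G r -> False) -> F * G = Q ^+ k ->
  (exists u, F = u ^+ k) /\ (exists v, G = v ^+ k).
Proof.
move=> k0 h e; have cop : coprimep F G.
  by apply: Pdiv.ClosedField.root_coprimep => r hF; apply/negP => hG; apply: (h r).
split; first exact: coprime_power k0 cop e.
by apply: (@coprime_power _ G F Q); rewrite // 1?coprimep_sym // mulrC.
Qed.

Lemma no_common_root r : root U r -> root V r -> root Y r -> False.
Proof. by move=> h0 h1 h2; apply: (const_form_root hX (r := r)). Qed.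

Lemma sqr_const P : (size (P ^+ 2)%R <= 1)%N -> (size P <= 1)%N.
Proof. exact: size_le1_of_exp. Qed.

Lemma root_exp P r n : (0 < n)%N -> root (P ^+ n) r = root P r.
Proof. by move=> n0; rewrite /root horner_exp expf_eq0 n0. Qed.

Lemma exp_size1 P n : size (P ^+ n) == 1%N -> n = 0%N \/ size P == 1%N.
Proof. by case: n => [|n]; [left|rewrite size_exp_eq1 //; right]. Qed.

Lemma trivial_exponents k i j l : (0 < k)%N ->
  (i * w i0 + j * w i1 + l * w i2)%N = k -> (i + j + l = 0)%N -> all_const.
Proof.
move=> k0 hk s; exfalso; have [i_0 j_0 l_0] : [/\ i = 0, j = 0 & l = 0]%N by split; lia.
by move: hk k0; rewrite i_0 j_0 l_0 => <-.
Qed.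

Lemma cancel_weight t p q r i j l i' j' l' k : (0 < t)%N ->
  w i0 = (p * t)%N -> w i1 = (q * t)%N -> w i2 = (r * t)%N ->
  (i * w i0 + j * w i1 + l * w i2)%N = k -> (i' * w i0 + j' * w i1 + l' * w i2)%N = k ->
  (p * i + q * j + r * l = p * i' + q * j' + r * l')%N.
Proof.
move=> t0 -> -> -> <- e; apply/eqP; rewrite -(eqn_pmul2r t0); apply/eqP.
have f x y z : ((p * x + q * y + r * z) * t = x * (p * t) + y * (q * t) + z * (r * t))%N by ring.
by rewrite !f e.
Qed.

Lemma cancel_half_weight p q r i j l i' j' l' k : (0 < w i0)%N ->
  (2 = p)%N -> (2 * w i1 = q * w i0)%N -> (2 * w i2 = r * w i0)%N ->
  (i * w i0 + j * w i1 + l * w i2)%N = k -> (i' * w i0 + j' * w i1 + l' * w i2)%N = k ->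
  (p * i + q * j + r * l = p * i' + q * j' + r * l')%N.
Proof.
move=> t0 <- h1 h2 <- e; apply/eqP; rewrite -(eqn_pmul2r t0); apply/eqP.
have f x y z : ((2 * x + q * y + r * z) * w i0 = 2 * (x * w i0 + y * w i1 + z * w i2))%N.
  by rewrite !mulnDr !mulnDl !(mulnCA 2) h1 h2; ring.
by rewrite !f e.
Qed.

(** The pattern of all the rigidity lemmas: the degree of a monomial determines its exponents modulo
    suitable integers, so [pencil_const] applies. Each alternative makes a coordinate or a binomial
    constant; combined with the equation of the surface, this is a relation between two powers, and
    everything is constant. Here the forms are in [U ^+ 5] and [V ^+ 3], and [Y ^+ 2] is a linear
    one. *)
Lemma rigid_E8 a b : a != 0 -> b != 0 ->
  (0 < w i0)%N -> (5 * w i0 = 3 * w i1)%N -> (5 * w i0 = 2 * w i2)%N ->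
  Y ^+ 2 = a *: U ^+ 5 + b *: V ^+ 3 -> all_const.
Proof.
move=> a0 b0 w0 w1 w2 e; have [k [h [k0 hh hc]]] := hX.
have constU : size U == 1%N -> all_const.
  move=> hU; have s : size (Y ^+ 2 - b *: V ^+ 3) == 1%N by rewrite e addrK size_scale // size_exp_eq1.
  have [hY hV] := sub_of_powers1 hchar b0 s isT isT.
  exact: all_constI (size_eq1_le hU) hV hY.
have constV : size V == 1%N -> all_const.
  move=> hV; have s : size (Y ^+ 2 - a *: U ^+ 5) == 1%N.
    by rewrite e addrAC subrr add0r size_scale // size_exp_eq1.
  have [hY hU] := sub_of_powers1 hchar a0 s isT isT.
  exact: all_constI hU (size_eq1_le hV) hY.
have [||i [j [l [hk hG hcase]]]] := pencil_const (P := U ^+ 5) (Q := V ^+ 3)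
  (g := fun i j l => U ^+ (i %% 5) * V ^+ (j %% 3) * Y ^+ (l %% 2))
  (n := fun i j l => (i %/ 5 + j %/ 3 + l %/ 2)%N) hh hc.
- move=> i j l; exists ((U ^+ 5) ^+ (i %/ 5) * (V ^+ 3) ^+ (j %/ 3) * (Y ^+ 2) ^+ (l %/ 2)).
    apply: in_pencilM; first apply: in_pencilM.
    + exact: in_pencilPn.
    + exact: in_pencilQn.
    rewrite -[X in in_pencil _ _ X _]mul1n; apply: in_pencilXn; rewrite e.
    apply: in_pencilD; apply: in_pencilZ; [exact: in_pencilP|exact: in_pencilQ].
  rewrite {1}(divn_eq i 5) {1}(divn_eq j 3) {1}(divn_eq l 2) !exprD.
  by rewrite !(mulnC _ 5%N) !(mulnC _ 3%N) !(mulnC _ 2%N) !exprM; ring.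
- move=> i j l i' j' l' e1 e2.
  (* The weights are [6 t], [10 t], [15 t] with [t = w i0 + w i1 - w i2]. Reducing modulo 5, 3 and 2
     isolates one exponent each time. *)
  have E : (6 * i + 10 * j + 15 * l = 6 * i' + 10 * j' + 15 * l')%N by apply: (@cancel_weight (w i0 + w i1 - w i2) _ _ _ _ _ _ _ _ _ k) => //; lia.
  have -> : (i %% 5 = i' %% 5)%N by lia.
  have -> : (j %% 3 = j' %% 3)%N by lia.
  have -> : (l %% 2 = l' %% 2)%N by lia.
  by split=> //; lia.
move: hG; rewrite !size_mul_eq1 => /andP[/andP[hU hV] hY].
have [hU0|/constU //] := exp_size1 hU.
have [hV0|/constV //] := exp_size1 hV.
have constUV : size (a *: U ^+ 5 + b *: V ^+ 3) == 1%N -> all_const.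
  move=> s; have [||hU' hV'] // := sum_of_powers1 hchar a0 b0 _ _ s; apply: all_constI => //.
  by apply: sqr_const; rewrite e size_eq1_le.
have [hY0|hY0] := exp_size1 hY.
- case: hcase => [n0|s|[r s]]; first by apply: (trivial_exponents k0 hk); lia.
    by apply: constU; rewrite size_exp_eq1 in s.
  have [r0|r0] := eqVneq r 0.
    by apply: constV; rewrite r0 scale0r subr0 size_exp_eq1 in s.
  have [hV' hU'] := sub_of_powers1 hchar r0 s isT isT.
  apply: all_constI => //; apply: sqr_const; rewrite e.
  by apply: size_addle1; apply: size_scalele1; apply: size_exp_le1.
by apply: constUV; rewrite -e size_exp_eq1.
Qed.


(** The two factors on the right are coprime along the curve, hence squares [v ^+ 2] and [d ^+ 2]. A
    constant [U] then gives [d ^+ 2 - a *: v ^+ 4] constant, and a constant [V] gives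
    [d ^+ 2 - b *: U ^+ 3] constant. *)
Lemma rigid_E7 a b : a != 0 -> b != 0 ->
  (0 < w i0)%N -> (3 * w i0 = 2 * w i1)%N -> (3 * w i1 = 2 * w i2)%N ->
  Y ^+ 2 = V * (a *: V ^+ 2 + b *: U ^+ 3) -> all_const.
Proof.
move=> a0 b0 w0 w1 w2 e; have [k [h [k0 hh hc]]] := hX.
have [|||[v hv] [d hd]] := @coprime_powers V (a *: V ^+ 2 + b *: U ^+ 3) Y 2 => //.
  move=> r rV; rewrite /root hornerD !hornerZ !horner_exp (rootP rV) expr0n mulr0 add0r.
  rewrite mulf_eq0 (negPf b0) expf_eq0 /= => rU; apply: (no_common_root rU rV).
  by rewrite -(@root_exp _ _ 2) // e rootM rV.
have finish : (size U <= 1)%N -> (size V <= 1)%N -> all_const.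
  move=> hU hV; apply: all_constI => //; apply: sqr_const; rewrite e.
  by apply/size_mulle1/size_addle1/size_scalele1/size_exp_le1 => //; apply/size_scalele1/size_exp_le1.
have constU : size U == 1%N -> all_const.
  move=> hU; have s : size (d ^+ 2 - a *: v ^+ 4) == 1%N.
    by rewrite (exprM v 2 2) -hd -hv addrAC subrr add0r size_scale // size_exp_eq1.
  have [_ hv'] := sub_of_powers1 hchar a0 s isT isT.
  by apply: (finish (size_eq1_le hU)); rewrite hv size_exp_le1.
have constV : size V == 1%N -> all_const.
  move=> hV; have s : size (d ^+ 2 - b *: U ^+ 3) == 1%N.
    by rewrite -hd addrK size_scale // size_exp_eq1.
  have [_ hU] := sub_of_powers1 hchar b0 s isT isT.
  exact: (finish hU (size_eq1_le hV)).
have [||i [j [l [hk hG hcase]]]] := pencil_const (P := U ^+ 3) (Q := V ^+ 2)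
  (g := fun i j l => U ^+ (i %% 3) * V ^+ ((j + l %/ 2) %% 2) * Y ^+ (l %% 2))
  (n := fun i j l => (i %/ 3 + (j + l %/ 2) %/ 2 + l %/ 2)%N) hh hc.
- move=> i j l; exists ((U ^+ 3) ^+ (i %/ 3) * (V ^+ 2) ^+ ((j + l %/ 2) %/ 2) *
    (a *: V ^+ 2 + b *: U ^+ 3) ^+ (l %/ 2)).
    apply: in_pencilM; first apply: in_pencilM.
    + exact: in_pencilPn.
    + exact: in_pencilQn.
    rewrite -[X in in_pencil _ _ X _]mul1n; apply: in_pencilXn.
    by apply: in_pencilD; apply: in_pencilZ; [exact: in_pencilQ|exact: in_pencilP].
  have -> : X i0 ^+ i * X i1 ^+ j * X i2 ^+ l = U ^+ i * V ^+ (j + l %/ 2) *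
     Y ^+ (l %% 2) * (a *: V ^+ 2 + b *: U ^+ 3) ^+ (l %/ 2).
    rewrite {1}(divn_eq l 2) !exprD (mulnC _ 2%N) !exprM e exprMn; ring.
  rewrite {1}(divn_eq i 3) {1}(divn_eq (j + l %/ 2) 2) !(exprD U) !(exprD V).
  by rewrite !(mulnC _ 3%N) !(mulnC _ 2%N) !exprM; ring.
- move=> i j l i' j' l' e1 e2.
  (* The weights are [4 t], [6 t], [9 t] with [t = w i2 + w i0 - 2 * w i1]. *)
  have E : (4 * i + 6 * j + 9 * l = 4 * i' + 6 * j' + 9 * l')%N by apply: (@cancel_weight (w i2 + w i0 - 2 * w i1) _ _ _ _ _ _ _ _ _ k) => //; lia.
  have -> : (i %% 3 = i' %% 3)%N by lia.
  have El : (l %% 2 = l' %% 2)%N by lia.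
  have -> : ((j + l %/ 2) %% 2 = (j' + l' %/ 2) %% 2)%N by lia.
  by rewrite El; split=> //; lia.
move: hG; rewrite !size_mul_eq1 => /andP[/andP[hU hV] hY].
have [hU0|/constU //] := exp_size1 hU.
have [hV0|/constV //] := exp_size1 hV.
have [hY0|hY0] := exp_size1 hY; last first.
  apply: constV; have : size (Y ^+ 2) == 1%N by rewrite size_exp_eq1.
  by rewrite e size_mul_eq1 => /andP[].
case: hcase => [n0|s|[r s]]; first by apply: (trivial_exponents k0 hk); lia.
  by apply: constU; rewrite size_exp_eq1 in s.
have [r0|r0] := eqVneq r 0.
  by apply: constV; rewrite r0 scale0r subr0 size_exp_eq1 in s.
by have [hV' hU'] := sub_of_powers1 hchar r0 s isT isT; apply: finish.
Qed.

(** With [t ^+ 2 = b], the coprime factors [Y - t *: U ^+ 2] and [Y + t *: U ^+ 2] have a cube as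
    product, so they are cubes [u ^+ 3] and [v ^+ 3]. A constant [Y - r *: U ^+ 2] is linear in [Y];
    rewritten as [u ^+ 3 - (r - t) *: U ^+ 2], or for [r = t] as [v ^+ 3 - (t + t) *: U ^+ 2], it is
    a relation between powers. *)
Lemma rigid_E6 a b : a != 0 -> b != 0 ->
  (0 < w i0)%N -> (4 * w i0 = 3 * w i1)%N -> (2 * w i0 = w i2)%N ->
  Y ^+ 2 = a *: V ^+ 3 + b *: U ^+ 4 -> all_const.
Proof.
move=> a0 b0 w0 w1 w2 e; have [k [h [k0 hh hc]]] := hX.
have [t ht] := @closed_root_exp K b 2 isT.
have t0 : t != 0 by apply: contraNneq b0 => t0; rewrite -ht t0 expr0n.
have eV : (Y - t *: U ^+ 2) * (Y + t *: U ^+ 2) = a *: V ^+ 3.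
  rewrite -subr_sqr e exprZn ht -exprM addrK //.
have [al hal] := @closed_root_exp K a 3 isT.
have eV' : (Y - t *: U ^+ 2) * (Y + t *: U ^+ 2) = (al *: V) ^+ 3.
  by rewrite exprZn hal.
have al0 : al != 0 by apply: contraNneq a0 => al0; rewrite -hal al0 expr0n.
have two0 : (2%:R : K) != 0 by rewrite natf_neq0_char0.
have [|[u hu] [v hv]] := @coprime_powers _ _ (al *: V) 3 isT _ eV'.
  move=> r /rootP; rewrite hornerD hornerN hornerZ horner_exp => r1 /rootP.
  rewrite hornerD hornerZ horner_exp => r2.
  have rY : root Y r.
    apply/rootP; apply/(mulfI two0); rewrite mulr0 mulr_natl mulr2n.
    by rewrite -{1}[Y.[r]](subrK (t * U.[r] ^+ 2)) r1 add0r addrC r2.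
  have rU : root U r.
    move: r2; rewrite (rootP rY) add0r => /eqP; rewrite mulf_eq0 (negPf t0) /=.
    by rewrite expf_eq0.
  apply: (fun h => no_common_root rU h rY); rewrite -(@root_exp _ _ 3) //.
  have : root (a *: V ^+ 3) r.
    by rewrite -eV rootM /root hornerD hornerN hornerZ horner_exp (rootP rY) (rootP rU)
      expr0n mulr0 subr0 eqxx.
  by rewrite rootZ.
have finish : (size U <= 1)%N -> (size Y <= 1)%N -> all_const.
  move=> hU hY; apply: all_constI => //; apply: (@size_le1_of_exp _ _ 3) => //.
  rewrite -(size_scale _ a0) (_ : a *: _ = Y ^+ 2 - b *: U ^+ 4); last by rewrite e addrK.
  rewrite -scaleNr; apply: size_addle1; first exact: size_exp_le1.
  exact/size_scalele1/size_exp_le1.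
have constU : size U == 1%N -> all_const.
  move=> hU; have s : size (Y ^+ 2 - a *: V ^+ 3) == 1%N.
    by rewrite e addrAC subrr add0r size_scale // size_exp_eq1.
  have [hY _] := sub_of_powers1 hchar a0 s isT isT.
  exact: finish (size_eq1_le hU) hY.
have constV : size V == 1%N -> all_const.
  move=> hV; have s : size (Y ^+ 2 - b *: U ^+ 4) == 1%N.
    by rewrite e addrK size_scale // size_exp_eq1.
  have [hY hU] := sub_of_powers1 hchar b0 s isT isT.
  exact: finish hU hY.
have [||i [j [l [hk hG hcase]]]] := pencil_const (P := U ^+ 2) (Q := Y)
  (g := fun i j l => U ^+ (i %% 2) * V ^+ (j %% 3))
  (n := fun i j l => (i %/ 2 + 2 * (j %/ 3) + l)%N) hh hc.
- move=> i j l; exists ((U ^+ 2) ^+ (i %/ 2) * (V ^+ 3) ^+ (j %/ 3) * Y ^+ l).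
    apply: in_pencilM; first apply: in_pencilM.
    + exact: in_pencilPn.
    + apply: in_pencilXn.
      have -> : V ^+ 3 = a^-1 *: (Y ^+ 2 + (- b) *: (U ^+ 2) ^+ 2).
        by rewrite -exprM e scaleNr addrK scalerA mulVf // scale1r.
      apply/in_pencilZ/in_pencilD; first exact: in_pencilQn.
      exact/in_pencilZ/in_pencilPn.
    exact: in_pencilQn.
  rewrite {1}(divn_eq i 2) {1}(divn_eq j 3) !(exprD U) !(exprD V).
  by rewrite !(mulnC _ 3%N) !(mulnC _ 2%N) !exprM; ring.
- move=> i j l i' j' l' e1 e2.
  have E : (3 * i + 4 * j + 6 * l = 3 * i' + 4 * j' + 6 * l')%N by apply: (@cancel_weight (w i1 - w i0) _ _ _ _ _ _ _ _ _ k) => //; lia.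
  have -> : (i %% 2 = i' %% 2)%N by lia.
  have -> : (j %% 3 = j' %% 3)%N by lia.
  by split=> //; lia.
move: hG; rewrite !size_mul_eq1 => /andP[hU hV].
have [hU0|/constU //] := exp_size1 hU.
have [hV0|/constV //] := exp_size1 hV.
case: hcase => [n0|s|[r s]]; first by apply: (trivial_exponents k0 hk); lia.
  by apply: constU; rewrite size_exp_eq1 in s.
have : (size U <= 1)%N.
  have [rt|rt] := eqVneq r t; last first.
    have s' : size (u ^+ 3 - (r - t) *: U ^+ 2) == 1%N.
      by rewrite -hu scalerBl opprB addrA subrK.
    by rewrite -subr_eq0 in rt; have [] := sub_of_powers1 hchar rt s' isT isT.
  have s' : size (v ^+ 3 - (t + t) *: U ^+ 2) == 1%N.
    by rewrite -hv scalerDl opprD addrA addrK -rt.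
  have t2 : t + t != 0 by rewrite -mulr2n -mulr_natl mulf_neq0.
  by have [] := sub_of_powers1 hchar t2 s' isT isT.
move=> hU'; apply: finish => //; rewrite -(subrK (r *: U ^+ 2) Y).
by apply: size_addle1; [apply: size_eq1_le|apply/size_scalele1/size_exp_le1].
Qed.

(** The three linear factors are pairwise coprime along the curve, so each is a square. A constant
    [V - t *: U] is a combination of two of them whose roots differ from [t], and among three roots
    such a pair always exists. *)
Lemma rigid_D4 (c r1 r2 r3 : K) : c != 0 -> r1 != r2 -> r1 != r3 -> r2 != r3 ->
  (0 < w i0)%N -> w i0 = w i1 -> (3 * w i0 = 2 * w i2)%N ->
  Y ^+ 2 = c *: ((V - r1 *: U) * (V - r2 *: U) * (V - r3 *: U)) -> all_const.
Proof.
move=> c0 r12 r13 r23 w0 w1 w2; have [k [h [k0 hh hc]]] := hX.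
pose L r := V - r *: U; rewrite -/(L r1) -/(L r2) -/(L r3) => e.
have LU r s : L r - L s = (s - r) *: U by rewrite /L scalerBl; ring.
have rootL r s x : r != s -> root (L r) x -> root (L s) x -> False.
  move=> rs hr hs; have hU : root U x.
    have sr : s - r != 0 by rewrite subr_eq0 eq_sym.
    have := LU r s; move/(congr1 (fun p => p.[x])).
    rewrite hornerD hornerN hornerZ (rootP hr) (rootP hs) subr0 => /esym/eqP.
    by rewrite mulf_eq0 (negPf sr).
  have hV : root V x.
    by move: hr; rewrite /root /L hornerD hornerN hornerZ (rootP hU) mulr0 subr0.
  apply: (no_common_root hU hV); rewrite -(@root_exp _ _ 2) // e rootZ // !rootM.
  by rewrite /root /L !(hornerD, hornerN, hornerZ) (rootP hU) (rootP hV) !mulr0 subr0 eqxx.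
have sq r s t : r != s -> r != t -> L r * (c *: (L s * L t)) = Y ^+ 2 -> exists u, L r = u ^+ 2.
  move=> rs rt e'; have [|[u ->] _] := @coprime_powers _ _ _ 2 isT _ e'; last by exists u.
  by move=> x hr; rewrite rootZ // rootM => /orP[]; apply: rootL hr.
have [u1 h1] : exists u, L r1 = u ^+ 2.
  by apply: (sq r1 r2 r3) => //; rewrite e -scalerAr mulrA.
have [u2 h2] : exists u, L r2 = u ^+ 2.
  by apply: (sq r2 r1 r3) => //; rewrite 1?eq_sym // e -scalerAr; congr (_ *: _); ring.
have [u3 h3] : exists u, L r3 = u ^+ 2.
  by apply: (sq r3 r1 r2); rewrite 1?eq_sym // e -scalerAr; congr (_ *: _); ring.
have finish r s : r != s -> (size (L r) <= 1)%N -> (size (L s) <= 1)%N -> all_const.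
  move=> rs hr hs; have hU : (size U <= 1)%N.
    have sr : s - r != 0 by rewrite subr_eq0 eq_sym.
    rewrite -(size_scale _ sr) -LU -scaleN1r; apply: size_addle1 => //.
    exact: size_scalele1.
  have hL t : (size (L t) <= 1)%N.
    rewrite -(subrK (L r) (L t)) LU; apply: size_addle1 => //; exact: size_scalele1.
  apply: all_constI => //; first by have := hL 0; rewrite /L scale0r subr0.
  apply: sqr_const; rewrite e; apply: size_scalele1.
  by apply: size_mulle1 => //; apply: size_mulle1.
have pair r s u v al be : r != s -> L r = u ^+ 2 -> L s = v ^+ 2 -> al != 0 -> be != 0 ->
    size (al *: L r + be *: L s) == 1%N -> all_const.
  move=> rs hr hs al0 be0; rewrite hr hs => hab.
  have [||hu hv] // := sum_of_powers1 hchar al0 be0 _ _ hab.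
  by apply: (finish r s rs); rewrite ?hr ?hs size_exp_le1.
have pairV r s u v t : r != s -> t != r -> t != s -> L r = u ^+ 2 -> L s = v ^+ 2 ->
    size (V - t *: U) == 1%N -> all_const.
  move=> rs tr ts hr hs ht; have rs0 : r - s != 0 by rewrite subr_eq0.
  (* Interpolation coefficients: they express [V - t *: U] through [L r] and [L s]. *)
  apply: (pair r s u v ((t - s) / (r - s)) ((r - t) / (r - s))) => //.
    by rewrite mulf_neq0 ?invr_eq0 // subr_eq0.
    by rewrite mulf_neq0 ?invr_eq0 // subr_eq0 eq_sym.
  rewrite (_ : _ + _ = V - t *: U) // /L !scalerBr !scalerA addrACA -!scalerDl -opprD -scalerDl.
  by congr (_ - _); [rewrite -[RHS]scale1r|]; congr (_ *: _); field.
have constU : size U == 1%N -> all_const.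
  move=> hU; apply: (pair r1 r2 u1 u2 1 (-1)); rewrite ?oppr_eq0 ?oner_eq0 //.
  by rewrite scale1r scaleN1r LU size_scale // subr_eq0 eq_sym.
have [||i [j [l [hk hG hcase]]]] := pencil_const (P := U) (Q := V)
  (g := fun i j l => Y ^+ (l %% 2))
  (n := fun i j l => (i + j + 3 * (l %/ 2))%N) hh hc.
- move=> i j l; exists (U ^+ i * V ^+ j * (Y ^+ 2) ^+ (l %/ 2)).
    apply: in_pencilM; first apply: in_pencilM.
    + exact: in_pencilPn.
    + exact: in_pencilQn.
    apply: in_pencilXn; rewrite e; apply: in_pencilZ.
    have hL t : in_pencil U V 1 (L t).
      by rewrite /L -scaleNr; apply: in_pencilD; [exact: in_pencilQ|apply/in_pencilZ/in_pencilP].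
    by apply: (in_pencilM (m := 2)) => //; apply: (in_pencilM (m := 1)).
  by rewrite {1}(divn_eq l 2) !(exprD Y) !(mulnC _ 2%N) !exprM; ring.
- move=> i j l i' j' l' e1 e2.
  have E : (2 * i + 2 * j + 3 * l = 2 * i' + 2 * j' + 3 * l')%N by apply: (@cancel_weight (w i2 - w i0) _ _ _ _ _ _ _ _ _ k) => //; lia.
  have -> : (l %% 2 = l' %% 2)%N by lia.
  by split=> //; lia.
have [hY0|hY0] := exp_size1 hG; last first.
  have : size (Y ^+ 2) == 1%N by rewrite size_exp_eq1.
  rewrite e size_scale // !size_mul_eq1 => /andP[/andP[s1 s2] _].
  by apply: (finish r1 r2 r12); apply: size_eq1_le.
case: hcase => [n0|s|[t s]]; [by apply: (trivial_exponents k0 hk); lia|exact: constU|].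
have [tr1|tr1] := eqVneq t r1; first by apply: (pairV r2 r3 u2 u3 t) => //; rewrite tr1.
have [tr2|tr2] := eqVneq t r2; first by apply: (pairV r1 r3 u1 u3 t) => //; rewrite tr2.
exact: (pairV r1 r2 u1 u2 t).
Qed.

(** As for three linear forms, [U], [L r1] and [L r2] are squares. If [t] is one of the two roots,
    only one other factor is left, and the square of [u ^+ e] takes the place of the missing one. *)
Lemma rigid_D_even (c r1 r2 : K) e : c != 0 -> r1 != r2 -> (0 < e)%N ->
  (0 < w i0)%N -> w i1 = (e * w i0)%N -> (2 * w i2 = (2 * e + 1) * w i0)%N ->
  Y ^+ 2 = c *: (U * (V - r1 *: U ^+ e) * (V - r2 *: U ^+ e)) -> all_const.
Proof.
move=> c0 r12 e0 w0 w1 w2; have [k [h [k0 hh hc]]] := hX.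
pose L r := V - r *: U ^+ e; rewrite -/(L r1) -/(L r2) => eY.
have LU r s : L r - L s = (s - r) *: U ^+ e by rewrite /L scalerBl; ring.
have rootUL r x : root U x -> root (L r) x -> False.
  move=> hU hr; have hV : root V x.
    move: hr; rewrite /root /L hornerD hornerN hornerZ horner_exp (rootP hU).
    by rewrite expr0n eqn0Ngt e0 mulr0 subr0.
  apply: (no_common_root hU hV); rewrite -(@root_exp _ _ 2) // eY rootZ // !rootM.
  by rewrite hU.
have rootL x : root (L r1) x -> root (L r2) x -> False.
  move=> hr hs; apply: (rootUL r1 x) => //; rewrite -(@root_exp _ _ e) //.
  have sr : r2 - r1 != 0 by rewrite subr_eq0 eq_sym.
  have := LU r1 r2; move/(congr1 (fun p => p.[x])).
  rewrite hornerD hornerN hornerZ (rootP hr) (rootP hs) subr0 => /esym/eqP.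
  by rewrite mulf_eq0 (negPf sr).
have [||[u hu] _] := @coprime_powers U (c *: (L r1 * L r2)) Y 2 isT.
- by move=> x hU; rewrite rootZ // rootM => /orP[]; apply: rootUL.
- by rewrite eY -scalerAr mulrA.
have [||[v1 h1] _] := @coprime_powers (L r1) (c *: (U * L r2)) Y 2 isT.
- move=> x hr; rewrite rootZ // rootM => /orP[hU|]; last exact: rootL.
  exact: (rootUL r1 x).
- by rewrite eY -scalerAr; congr (_ *: _); ring.
have [||[v2 h2] _] := @coprime_powers (L r2) (c *: (U * L r1)) Y 2 isT.
- move=> x hr; rewrite rootZ // rootM => /orP[hU|hr1]; last exact: (rootL x).
  exact: (rootUL r2 x).
- by rewrite eY -scalerAr; congr (_ *: _); ring.
have finish : (size U <= 1)%N -> (size V <= 1)%N -> all_const.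
  move=> hU hV; apply: all_constI => //; apply: sqr_const; rewrite eY; apply: size_scalele1.
  have hL r : (size (L r) <= 1)%N.
    rewrite /L -scaleNr; apply: size_addle1 => //; exact/size_scalele1/size_exp_le1.
  by apply: size_mulle1 => //; apply: size_mulle1.
have finishP r : (size (U ^+ e) <= 1)%N -> (size (L r) <= 1)%N -> all_const.
  move=> hP hL; apply: finish; first exact: size_le1_of_exp hP.
  rewrite -(subrK (r *: U ^+ e) V); apply: size_addle1 => //; exact: size_scalele1.
have constU : size U == 1%N -> all_const.
  move=> hU; have s : size (v1 ^+ 2 - 1 *: v2 ^+ 2) == 1%N.
    by rewrite scale1r -h1 -h2 LU size_scale ?size_exp_eq1 // subr_eq0 eq_sym.
  have [hv _] := sub_of_powers1 hchar (oner_neq0 _) s isT isT.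
  by apply: (finishP r1); rewrite ?h1 size_exp_le1 // size_eq1_le.
have constL r s v : r != s -> L s = v ^+ 2 -> size (L r) == 1%N -> all_const.
  move=> rs hv hr; have sr : s - r != 0 by rewrite subr_eq0 eq_sym.
  have s' : size (v ^+ 2 - (r - s) *: u ^+ (2 * e)) == 1%N.
    rewrite exprM -hu -hv -LU; suff -> : L s - (L s - L r) = L r by [].
    by ring.
  have rs0 : r - s != 0 by rewrite subr_eq0.
  have [||_ hu'] // := sub_of_powers1 hchar rs0 s'; first by lia.
  by apply: (finishP r); rewrite ?hu ?size_exp_le1 // size_eq1_le.
have [||i [j [l [hk hG hcase]]]] := pencil_const (P := U ^+ e) (Q := V)
  (g := fun i j l => U ^+ ((i + l %/ 2) %% e) * Y ^+ (l %% 2))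
  (n := fun i j l => ((i + l %/ 2) %/ e + j + 2 * (l %/ 2))%N) hh hc.
- move=> i j l; exists ((U ^+ e) ^+ ((i + l %/ 2) %/ e) * V ^+ j * (c *: (L r1 * L r2)) ^+ (l %/ 2)).
    apply: in_pencilM; first apply: in_pencilM.
    + exact: in_pencilPn.
    + exact: in_pencilQn.
    have hL t : in_pencil (U ^+ e) V 1 (L t).
      by rewrite /L -scaleNr; apply: in_pencilD; [exact: in_pencilQ|apply/in_pencilZ/in_pencilP].
    by apply/in_pencilXn/in_pencilZ/(in_pencilM (m := 1)).
  have -> : X i0 ^+ i * X i1 ^+ j * X i2 ^+ l = U ^+ (i + l %/ 2) * V ^+ j *
     Y ^+ (l %% 2) * (c *: (L r1 * L r2)) ^+ (l %/ 2).
    have eY' : Y ^+ 2 = U * (c *: (L r1 * L r2)) by rewrite eY -scalerAr mulrA.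
    by rewrite {1}(divn_eq l 2) !(exprD U) (exprD Y) (mulnC _ 2%N) exprM eY' exprMn; ring.
  by rewrite {1}(divn_eq (i + l %/ 2) e) (exprD U) (mulnC _ e) exprM; ring.
- move=> i j l i' j' l' e1 e2.
  (* In units of half of [w i0] the weights are [2], [2 * e] and [2 * e + 1]: parity gives [l]
     modulo 2, and Euclidean division by [e] gives the rest. *)
  have E : (2 * i + 2 * (e * j) + (2 * e + 1) * l = 2 * i' + 2 * (e * j') + (2 * e + 1) * l')%N.
    by rewrite !mulnA; apply: (cancel_half_weight w0 _ _ _ e1 e2) => //; rewrite w1 mulnA.
  have El : (l %% 2 = l' %% 2)%N by lia.
  have El' : (l %/ 2 * 2 + l %% 2 = l /\ l' %/ 2 * 2 + l' %% 2 = l')%N by rewrite -!divn_eq.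
  have E' : ((j + 2 * (l %/ 2)) * e + (i + l %/ 2) = (j' + 2 * (l' %/ 2)) * e + (i' + l' %/ 2))%N.
    move: El' E; rewrite El; move: (l %/ 2)%N (l' %/ 2)%N (l' %% 2)%N => x y z [<- <-] E.
    by apply/eqP; rewrite -(eqn_pmul2l (isT : 0 < 2)%N); apply/eqP; lia.
  have Em : ((i + l %/ 2) %% e = (i' + l' %/ 2) %% e)%N.
    by have := congr1 (modn^~ e) E'; rewrite /= !modnMDl.
  rewrite El Em; split=> //.
  have := congr1 (divn^~ e) E'; rewrite /= !divnMDl //; lia.
move: hG; rewrite !size_mul_eq1 => /andP[hU hY].
have [hU0|/constU //] := exp_size1 hU.
have [hY0|hY0] := exp_size1 hY; last first.
  have : size (Y ^+ 2) == 1%N by rewrite size_exp_eq1.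
  by rewrite eY size_scale // !size_mul_eq1 => /andP[/andP[/constU]].
case: hcase => [n0|s|[t s]].
- apply: (trivial_exponents k0 hk); have := divn_eq (i + l %/ 2) e; rewrite hU0.
  have -> : ((i + l %/ 2) %/ e = 0)%N by lia.
  by rewrite mul0n; lia.
- by apply: constU; rewrite size_exp_eq1 in s.
have [tr1|tr1] := eqVneq t r1; first by apply: (constL r1 r2 v2) => //; rewrite /L -tr1.
have [tr2|tr2] := eqVneq t r2; first by apply: (constL r2 r1 v1) => //; [rewrite eq_sym|rewrite /L -tr2].
have rs0 : r1 - r2 != 0 by rewrite subr_eq0.
have al0 : (t - r2) / (r1 - r2) != 0 by rewrite mulf_neq0 ?invr_eq0 // subr_eq0.
have be0 : (r1 - t) / (r1 - r2) != 0 by rewrite mulf_neq0 ?invr_eq0 // subr_eq0 eq_sym.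
have [|hv1 hv2] := sum_of_powers1 (P := v1) (Q := v2) hchar al0 be0 (isT : 1 < 2)%N (isT : 1 < 2)%N.
  rewrite -h1 -h2 (_ : _ + _ = V - t *: U ^+ e) // /L !scalerBr !scalerA addrACA -!scalerDl -opprD -scalerDl.
  by congr (_ - _); [rewrite -[RHS]scale1r|]; congr (_ *: _); field.
apply: (finishP r1); last by rewrite h1 size_exp_le1.
have sr : r2 - r1 != 0 by rewrite subr_eq0 eq_sym.
rewrite -(size_scale _ sr) -LU -scaleN1r h1 h2; apply: size_addle1; rewrite ?size_scalele1 //;
  exact: size_exp_le1.
Qed.

(** Writing [U = p ^+ 2] and the other factor as [q ^+ 2] turns the surface into
    [a *: V ^+ 2 = q ^+ 2 - b *: p ^+ (2 * m)]. Its right side splits into two coprime factors, both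
    squares, and a constant [q - r *: p ^+ m] is treated as in [rigid_E6]. *)
Lemma rigid_D_odd a b m : a != 0 -> b != 0 -> odd m -> (2 < m)%N ->
  (0 < w i0)%N -> (2 * w i1 = m * w i0)%N -> (2 * w i2 = (m + 1) * w i0)%N ->
  Y ^+ 2 = U * (a *: V ^+ 2 + b *: U ^+ m) -> all_const.
Proof.
move=> a0 b0 om m2 w0 w1 w2 eY; have [k [h [k0 hh hc]]] := hX.
have m0 : (0 < m)%N by lia.
have [||[p hp] [q0 hq0]] := @coprime_powers U (a *: V ^+ 2 + b *: U ^+ m) Y 2 isT => //.
  move=> r hU; rewrite /root hornerD !hornerZ !horner_exp (rootP hU).
  rewrite expr0n eqn0Ngt m0 mulr0 addr0 mulf_eq0 (negPf a0) expf_eq0 /= => hV.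
  by apply: (no_common_root hU hV); rewrite -(@root_exp _ _ 2) // eY rootM hU.
(* The sign of the square root is chosen so that [Y = p * q]. *)
have [q hq hY] : exists2 q, a *: V ^+ 2 + b *: U ^+ m = q ^+ 2 & Y = p * q.
  have : (Y - p * q0) * (Y + p * q0) = 0.
    by rewrite -subr_sqr exprMn eY hq0 {1}hp subrr.
  move/eqP; rewrite mulf_eq0 subr_eq0 addr_eq0 => /orP[] /eqP hY; first by exists q0.
  by exists (- q0); rewrite ?sqrrN // mulrN.
have eV : a *: V ^+ 2 = q ^+ 2 - b *: p ^+ (2 * m) by rewrite exprM -hp -hq addrK.
have finish : (size p <= 1)%N -> (size q <= 1)%N -> all_const.
  move=> hp1 hq1; apply: all_constI.
  - by rewrite hp size_exp_le1.
  - apply: sqr_const; rewrite -(size_scale _ a0) eV -scaleNr; apply: size_addle1.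
      exact: size_exp_le1.
    exact/size_scalele1/size_exp_le1.
  by rewrite hY; apply: size_mulle1.
have constp : size p == 1%N -> all_const.
  move=> hp1; have s : size (q ^+ 2 - a *: V ^+ 2) == 1%N.
    by rewrite eV opprB addrC subrK size_scale // size_exp_eq1 // muln_gt0.
  have [hq1 _] := sub_of_powers1 hchar a0 s isT isT.
  exact: finish (size_eq1_le hp1) hq1.
have constV : size V == 1%N -> all_const.
  move=> hV; have s : size (q ^+ 2 - b *: p ^+ (2 * m)) == 1%N.
    by rewrite -eV size_scale // size_exp_eq1.
  have [||hq1 hp1] // := sub_of_powers1 hchar b0 s; first by lia.
  exact: finish.
have [t ht] := @closed_root_exp K b 2 isT.
have t0 : t != 0 by apply: contraNneq b0 => t0; rewrite -ht t0 expr0n.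
have [al hal] := @closed_root_exp K a 2 isT.
have al0 : al != 0 by apply: contraNneq a0 => al0; rewrite -hal al0 expr0n.
have eV' : (q - t *: p ^+ m) * (q + t *: p ^+ m) = (al *: V) ^+ 2.
  by rewrite -subr_sqr !exprZn ht hal eV -exprM mulnC.
have two0 : (2%:R : K) != 0 by rewrite natf_neq0_char0.
have [|[u hu] [v hv]] := @coprime_powers _ _ (al *: V) 2 isT _ eV'.
  move=> r /rootP; rewrite hornerD hornerN hornerZ horner_exp => r1 /rootP.
  rewrite hornerD hornerZ horner_exp => r2.
  have rq : root q r.
    apply/rootP; apply/(mulfI two0); rewrite mulr0 mulr_natl mulr2n.
    by rewrite -{1}[q.[r]](subrK (t * p.[r] ^+ m)) r1 add0r addrC r2.
  have rp : root p r.
    move: r2; rewrite (rootP rq) add0r => /eqP; rewrite mulf_eq0 (negPf t0) /=.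
    by rewrite expf_eq0 m0.
  apply: (@no_common_root r).
  - by rewrite hp root_exp.
  - rewrite -(@root_exp _ _ 2) // -(rootZ _ _ a0) // eV /root hornerD hornerN hornerZ.
    rewrite !horner_exp (rootP rp) (rootP rq) !expr0n muln_eq0 /= [m == _]eqn0Ngt m0.
    by rewrite mulr0 subr0.
  by rewrite hY rootM rp.
have [||i [j [l [hk hG hcase]]]] := pencil_const (P := p ^+ m) (Q := q)
  (g := fun i j l => p ^+ ((2 * i + l) %% m) * V ^+ (j %% 2))
  (n := fun i j l => ((2 * i + l) %/ m + l + 2 * (j %/ 2))%N) hh hc.
- move=> i j l; exists ((p ^+ m) ^+ ((2 * i + l) %/ m) * q ^+ l * (V ^+ 2) ^+ (j %/ 2)).
    apply: in_pencilM; first apply: in_pencilM.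
    + exact: in_pencilPn.
    + exact: in_pencilQn.
    apply: in_pencilXn.
    have -> : V ^+ 2 = a^-1 *: (q ^+ 2 + (- b) *: (p ^+ m) ^+ 2).
      by rewrite scaleNr -exprM mulnC -eV scalerA mulVf // scale1r.
    apply/in_pencilZ/in_pencilD; first exact: in_pencilQn.
    exact/in_pencilZ/in_pencilPn.
  have -> : X i0 ^+ i * X i1 ^+ j * X i2 ^+ l = p ^+ (2 * i + l) * q ^+ l * V ^+ j.
    by rewrite hY {1}hp -exprM exprMn exprD; ring.
  rewrite {1}(divn_eq (2 * i + l) m) {1}(divn_eq j 2) !(exprD p) !(exprD V).
  by rewrite !(mulnC _ m) !(mulnC _ 2%N) !(exprM p) !(exprM V); ring.
- move=> i j l i' j' l' e1 e2.
  have E : (2 * i + m * j + (m + 1) * l = 2 * i' + m * j' + (m + 1) * l')%N.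
    by apply: (cancel_half_weight w0 _ _ _ e1 e2).
  have Ej : (j %% 2 = j' %% 2)%N.
    rewrite !modn2; move/(congr1 odd): E; rewrite !(oddD, oddM) om /=.
    by case: (odd j); case: (odd j').
  have E' : ((j + l) * m + (2 * i + l) = (j' + l') * m + (2 * i' + l'))%N by lia.
  have Em : ((2 * i + l) %% m = (2 * i' + l') %% m)%N.
    by have := congr1 (modn^~ m) E'; rewrite /= !modnMDl.
  rewrite Ej Em; split=> //.
  have := congr1 (divn^~ m) E'; rewrite /= !divnMDl //; lia.
move: hG; rewrite !size_mul_eq1 => /andP[hp1 hV].
have [hp0|/constp //] := exp_size1 hp1.
have [hV0|/constV //] := exp_size1 hV.
case: hcase => [n0|s|[r s]].
- apply: (trivial_exponents k0 hk); have := divn_eq (2 * i + l) m; rewrite hp0.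
  have -> : ((2 * i + l) %/ m = 0)%N by lia.
  by rewrite mul0n; lia.
- by apply: constp; rewrite size_exp_eq1 in s.
have : (size p <= 1)%N.
  have [rt|rt] := eqVneq r t; last first.
    have s' : size (u ^+ 2 - (r - t) *: p ^+ m) == 1%N.
      by rewrite -hu scalerBl opprB addrA subrK.
    rewrite -subr_eq0 in rt.
    by have [||] // := sub_of_powers1 hchar rt s'; lia.
  have s' : size (v ^+ 2 - (t + t) *: p ^+ m) == 1%N.
    by rewrite -hv scalerDl opprD addrA addrK -rt.
  have t2 : t + t != 0 by rewrite -mulr2n -mulr_natl mulf_neq0.
  by have [||] // := sub_of_powers1 hchar t2 s'; lia.
move=> hp'; apply: finish => //; rewrite -(subrK (r *: p ^+ m) q).
by apply: size_addle1; [apply: size_eq1_le|apply/size_scalele1/size_exp_le1].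
Qed.

End Rigid.

(** * Substitutions and derivations *)

Section MpolyFacts.
Variable K : fieldType.
Implicit Types (p q : {mpoly K[3]}) (f g : 3.-tuple {mpoly K[3]}).

Lemma mpoly_alg_ind (Pr : {mpoly K[3]} -> Prop) :
  (forall c, Pr c%:MP) -> (forall i, Pr 'X_i) ->
  (forall p q, Pr p -> Pr q -> Pr (p + q)) ->
  (forall p q, Pr p -> Pr q -> Pr (p * q)) -> forall p, Pr p.
Proof.
move=> hC hX hD hM p; rewrite (mpolyE p).
apply: (big_ind Pr); [by rewrite -mpolyC0|by []|].
move=> m _; rewrite -mul_mpolyC; apply: (hM) => //; rewrite mpolyXE_id.
apply: (big_ind Pr); [by rewrite -mpolyC1|by []|].
move=> i _; elim: (m i) => [|n IH]; first by rewrite expr0 -mpolyC1.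
by rewrite exprS; apply: (hM).
Qed.

Lemma comp_mpolyXi f i : 'X_i \mPo f = tnth f i.
Proof. by rewrite comp_mpolyXU -tnth_nth. Qed.

Lemma comp_mpolyA f g p :
  (p \mPo f) \mPo g = p \mPo [tuple (tnth f i) \mPo g | i < 3].
Proof.
elim/mpoly_alg_ind: p => [c|i|p q hp hq|p q hp hq].
- by rewrite !comp_mpolyC.
- by rewrite !comp_mpolyXi tnth_mktuple.
- by rewrite !comp_mpolyD hp hq.
by rewrite !rmorphM /= hp hq.
Qed.

Lemma comp_mpolyK f g p : (forall i, tnth f i \mPo g = 'X_i) -> (p \mPo f) \mPo g = p.
Proof.
move=> h; rewrite comp_mpolyA -[RHS]comp_mpoly_id; congr (_ \mPo _).
by apply: eq_from_tnth => i; rewrite !tnth_mktuple.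
Qed.

Lemma mderivXU i j : ('X_j : {mpoly K[3]})^`M(i) = (i == j)%:R.
Proof.
rewrite mderivX mnm1E eq_sym; case: eqP => [->|_]; last by rewrite scale0r.
rewrite scale1r (_ : (_ - _)%MM = 0%MM) ?mpolyX0 //.
by apply/mnmP => l; rewrite mnmBE mnm0E subnn.
Qed.

Lemma mderiv_comp f p l :
  (p \mPo f)^`M(l) = \sum_i (p^`M(i) \mPo f) * (tnth f i)^`M(l).
Proof.
elim/mpoly_alg_ind: p => [c|j|p q hp hq|p q hp hq].
- rewrite comp_mpolyC mderivC big1 // => i _.
  by rewrite mderivC comp_mpoly0 mul0r.
- rewrite comp_mpolyXi (bigD1 j) //= mderivXU eqxx comp_mpoly1 mul1r big1 ?addr0 // => i ij.
  by rewrite mderivXU (negPf ij) comp_mpoly0 mul0r.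
- rewrite comp_mpolyD mderivD hp hq -big_split; apply: eq_bigr => i _.
  by rewrite mderivD comp_mpolyD mulrDl.
rewrite rmorphM /= mderivM hp hq mulr_suml mulr_sumr -big_split; apply: eq_bigr => i _.
by rewrite mderivM comp_mpolyD !rmorphM /=; ring.
Qed.

Lemma mderiv_exp p n i : (p ^+ n.+1)^`M(i) = n.+1%:R * p^`M(i) * p ^+ n.
Proof.
elim: n => [|n IH]; first by rewrite mul1r mulr1.
by rewrite exprS mderivM IH -natr1 !exprS; ring.
Qed.

Lemma wpart_comp_whom (w v : 'I_3 -> nat) f (k : int) p : (forall i, whom v (w i) (tnth f i)) ->
  wpart v k (p \mPo f) = (wpart w k p) \mPo f.
Proof.
move=> h; rewrite comp_mpolyEX wpart_sum [in RHS]/wpart raddf_sum.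
rewrite [RHS]big_mkcond; apply: eq_bigr => m _; rewrite wpartZ.
have hX : whom v (wdeg w m) ('X_[m] \mPo f).
  apply: whom_comp h _ => m'; rewrite mcoeffX; case: (m =P m') => [-> //|_].
  by rewrite eqxx.
case: eqP => [mk|/eqP mk]; first by rewrite -mk wpart_id // [RHS]comp_mpolyZ.
by rewrite (wpart_whom hX) ?scaler0 // eq_sym.
Qed.

Lemma whom0_const (w : 'I_3 -> nat) (P : {mpoly K[3]}) : (forall i, 0 < w i)%N -> whom w 0 P ->
  exists c, P = c%:MP.
Proof.
move=> w0 hP; exists P@_0; apply/mpolyP => m; rewrite mcoeffC.
case: (eqVneq m 0%MM) => [->|m0]; first by rewrite mulr1.
rewrite mulr0; apply/eqP; apply: contraNT m0 => /hP [].
rewrite wdegE => hm; apply/eqP/mnmP; apply: I3_ind; rewrite mnm0E.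
- by have := w0 i0; move: hm; case: (m i0) => //; nia.
- by have := w0 i1; move: hm; case: (m i1) => //; nia.
- by have := w0 i2; move: hm; case: (m i2) => //; nia.
Qed.

End MpolyFacts.

(* Kronecker's substitution [x_i := t ^ (B ^ i)] is injective on monomials of degree below [B]. *)
Lemma nonroot_mpoly (K : closedFieldType) (p : {mpoly K[3]}) :
  p != 0 -> exists v, p.@[v] != 0.
Proof.
move=> /mpoly_neq0P[m0 hm0]; pose B := msize p.
pose e (m : 'X_{1..3}) := (m i0 + m i1 * B + m i2 * B ^ 2)%N.
pose X (i : 'I_3) : {poly K} := 'X ^+ (B ^ i)%N.
have eX m : mmap1 X m = 'X^(e m).
  by rewrite /mmap1 big_I3 /X /= -!exprM -!exprD; congr ('X^_); rewrite /e expn0 expn1; ring.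
have lt_deg m i : m \in msupp p -> (m i < B)%N.
  by move=> /msize_mdeg_lt; apply: leq_ltn_trans; rewrite mdegE (bigD1 i) //= leq_addr.
have inj m m' : m \in msupp p -> m' \in msupp p -> e m = e m' -> m = m'.
  move=> hm hm'; have [[a0 a1] a2] := (lt_deg _ i0 hm, lt_deg _ i1 hm, lt_deg _ i2 hm).
  have [[b0 b1] b2] := (lt_deg _ i0 hm', lt_deg _ i1 hm', lt_deg _ i2 hm').
  have B0 : (0 < B)%N by apply: leq_ltn_trans a0.
  have e' x : e x = ((x i2 * B + x i1) * B + x i0)%N by rewrite /e; ring.
  rewrite !e' => E; have E0 := congr1 (modn^~ B) E; rewrite /= !modnMDl !modn_small // in E0.
  have E1 := congr1 (divn^~ B) E; rewrite /= !divnMDl // !divn_small // !addn0 in E1.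
  have E2 := congr1 (modn^~ B) E1; rewrite /= !modnMDl !modn_small // in E2.
  have E3 := congr1 (divn^~ B) E1; rewrite /= !divnMDl // !divn_small // !addn0 in E3.
  by apply/mnmP; apply: I3_ind.
have : mmap (@polyC K) X p != 0.
  apply/eqP => /polyP/(_ (e m0)); rewrite coef0 /mmap coef_sum.
  rewrite (bigD1_seq m0) ?msupp_uniq //= ?mcoeff_msupp // eX coefCM coefXn eqxx mulr1.
  rewrite big1_seq ?addr0 => [/eqP|m /andP[mm0 hm]]; first by rewrite (negPf hm0).
  rewrite eX coefCM coefXn; case: eqP => [/esym/inj eq|]; last by rewrite mulr0.
  by move: mm0; rewrite eq ?eqxx // mcoeff_msupp.
move=> /closed_nonrootP[r hr]; exists (fun i => r ^+ (B ^ i)%N).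
apply: contra hr => /eqP h; rewrite /root -h mevalE /mmap horner_sum; apply/eqP.
apply: eq_bigr => m _; rewrite hornerM hornerC; congr (_ * _).
by rewrite /mmap1 horner_prod; apply: eq_bigr => i _; rewrite horner_exp hornerXn.
Qed.

Lemma mpoly_unit_const (K : fieldType) (p q : {mpoly K[3]}) :
  p * q = 1 -> exists2 c, c != 0 & p = c%:MP.
Proof.
move=> e; have [p0 q0] : p != 0 /\ q != 0 by apply/andP; rewrite -negb_or -mulf_eq0 e oner_eq0.
apply/msize_poly1P; have := msizeM p0 q0; rewrite e msize1.
rewrite -!msize_poly_eq0 in p0 q0; move: p0 q0.
by case: (mmeasure _ p) => [|[|m]] //; case: (mmeasure _ q) => [|[|n]] //; rewrite addSn addnS.
Qed.

Lemma det_mx22 (A : comNzRingType) (B : 'M[A]_2) :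
  \det B = B 0 0 * B 1 1 - B 0 1 * B 1 0.
Proof.
rewrite (expand_det_row _ 0) !big_ord_recl big_ord0 /cofactor !det_mx11 !mxE /=.
have l10 : lift 1 0 = 0 :> 'I_2 by apply: val_inj.
have -> : lift ord0 (ord0 : 'I_1) = 1 :> 'I_2 by apply: val_inj.
by rewrite (_ : (0 + bump 0 0)%N = 1%N) // !addr0 expr0 expr1 mul1r mulN1r mulrN l10.
Qed.

Lemma sum_lift (F : 'I_3 -> nat) i :
  (F i + F (lift i (0%R : 'I_2)) + F (lift i (1%R : 'I_2)) = F i0 + F i1 + F i2)%N.
Proof.
elim/I3_ind: i.
- have -> : lift i0 (0 : 'I_2) = i1 by apply: val_inj.
  by have -> : lift i0 (1 : 'I_2) = i2 by apply: val_inj.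
- have -> : lift i1 (0 : 'I_2) = i0 by apply: val_inj.
  have -> : lift i1 (1 : 'I_2) = i2 by apply: val_inj.
  by rewrite [(F i1 + _)%N]addnC.
have -> : lift i2 (0 : 'I_2) = i0 by apply: val_inj.
have -> : lift i2 (1 : 'I_2) = i1 by apply: val_inj.
by rewrite -addnA addnC.
Qed.

(** * Locally nilpotent derivations and their exponential *)

Section Derivation.
Variable K : fieldType.
Hypothesis hchar : [pchar K] =i pred0.
Variable a : 'I_3 -> {mpoly K[3]}.
Implicit Types P Q : {mpoly K[3]}.

Definition der P : {mpoly K[3]} := \sum_i a i * P^`M(i).

Lemma derD P Q : der (P + Q) = der P + der Q.
Proof. by rewrite -big_split; apply: eq_bigr => i _; rewrite mderivD mulrDr. Qed.

Lemma der0 : der 0 = 0.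
Proof. by rewrite /der big1 // => i _; rewrite mderiv0 mulr0. Qed.

Lemma derC c : der c%:MP = 0.
Proof. by rewrite /der big1 // => i _; rewrite mderivC mulr0. Qed.

Lemma derZ c P : der (c *: P) = c *: der P.
Proof. by rewrite scaler_sumr; apply: eq_bigr => i _; rewrite mderivZ scalerAr. Qed.

Lemma derM P Q : der (P * Q) = der P * Q + P * der Q.
Proof.
rewrite mulr_suml mulr_sumr -big_split; apply: eq_bigr => i _.
by rewrite mderivM /=; ring.
Qed.

Lemma derX i : der 'X_i = a i.
Proof.
rewrite /der (bigD1 i) //= mderivXU eqxx mulr1 big1 ?addr0 // => j ji.
by rewrite mderivXU (negPf ji) mulr0.
Qed.

Lemma der_sum (I : Type) (r : seq I) (F : I -> {mpoly K[3]}) :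
  der (\sum_(i <- r) F i) = \sum_(i <- r) der (F i).
Proof. exact: (big_morph _ derD der0). Qed.

Lemma iter_derD n P Q : iter n der (P + Q) = iter n der P + iter n der Q.
Proof. by elim: n => //= n ->; rewrite derD. Qed.

Lemma iter_der0 n : iter n der 0 = 0.
Proof. by elim: n => //= n ->; rewrite der0. Qed.

Lemma iter_derZ n c P : iter n der (c *: P) = c *: iter n der P.
Proof. by elim: n => //= n ->; rewrite derZ. Qed.

Lemma leibniz n P Q : iter n der (P * Q) =
  \sum_(i < n.+1) (iter i der P * iter (n - i) der Q) *+ 'C(n, i).
Proof.
elim: n => [|n IH]; first by rewrite big_ord_recl big_ord0 /= mulr1n addr0.
rewrite iterS IH der_sum.
rewrite (eq_bigr (fun i : 'I_n.+1 => (iter i.+1 der P * iter (n - i) der Q) *+ 'C(n, i)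
   + (iter i der P * iter (n.+1 - i) der Q) *+ 'C(n, i))); last first.
  by move=> i _; rewrite subSn -1?ltnS // -mulrnDl -derM -!scaler_nat derZ.
rewrite big_split /= addrC big_ord_recl [X in _ = X]big_ord_recl /= !bin0 -addrA.
congr (_ + _).
rewrite (eq_bigr (fun i : 'I_n => (iter i.+1 der P * iter (n - i) der Q) *+ 'C(n, i.+1)));
  last by move=> i _; rewrite /bump add1n subSS.
rewrite [in RHS](eq_bigr (fun i : 'I_n.+1 => (iter i.+1 der P * iter (n - i) der Q) *+ 'C(n, i.+1)
   + (iter i.+1 der P * iter (n - i) der Q) *+ 'C(n, i))); last first.
  by move=> i _; rewrite /bump add1n subSS binS mulrnDr.
rewrite [in RHS]big_split /=; congr (_ + _).
by rewrite [in RHS]big_ord_recr /= bin_small // mulr0n addr0.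
Qed.

Section Exponential.
Variables (A : idomainType) (ev : {rmorphism {mpoly K[3]} -> A}).

(** [q] is the image under [ev] of the exponential of the derivation, times a parameter, applied to
    [P]. The factorial stands on the left so that nothing is divided in [A]. *)
Definition exp_rel P (q : {poly A}) := forall n, q`_n *+ n`! = ev (iter n der P).

Lemma exp_relD P Q p q : exp_rel P p -> exp_rel Q q -> exp_rel (P + Q) (p + q).
Proof. by move=> hp hq n; rewrite coefD mulrnDl hp hq iter_derD rmorphD. Qed.

Lemma exp_relM P Q p q : exp_rel P p -> exp_rel Q q -> exp_rel (P * Q) (p * q).
Proof.
move=> hp hq n; rewrite coefM leibniz rmorph_sum -sumrMnl; apply: eq_bigr => i _.
rewrite rmorphMn rmorphM /= -hp -hq -(@bin_fact n i) -1?ltnS //.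
by rewrite mulrnAl mulrnAr -!mulrnA; congr (_ *+ _); ring.
Qed.

Lemma exp_relC c : exp_rel c%:MP (ev c%:MP)%:P.
Proof.
case=> [|n]; first by rewrite coefC /= mulr1n.
by rewrite coefC mul0rn iterSr derC iter_der0 rmorph0.
Qed.

Hypothesis nilp : forall i, exists n, iter n der 'X_i = 0.

(** By the Leibniz formula the exponential is a ring morphism, so it is substitution of its values
    on the variables; these are polynomials in the parameter by nilpotency on the variables. *)
Lemma exp_exists : exists q : 'I_3 -> {poly A},
  forall P, exp_rel P (mmap (polyC \o (ev \o @mpolyC 3 K)) q P).
Proof.
have fact_neq0 n : (n`!%:R : K) != 0.
  by rewrite ((pcharf0P K).1 hchar) -lt0n fact_gt0.
have hq i : exists q, exp_rel 'X_i q.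
  have [N hN] := nilp i.
  exists (\poly_(n < N) ev ((n`!%:R^-1 : K) *: iter n der 'X_i)) => n.
  rewrite coef_poly; case: ltnP => hn.
    by rewrite -rmorphMn /= -scaler_nat scalerA mulfV // scale1r.
  by rewrite mul0rn -(subnK hn) iterD hN iter_der0 rmorph0.
have [q hq'] := fin_all_exists hq; exists q.
elim/mpoly_alg_ind => [c|i|P Q hP hQ|P Q hP hQ].
- by rewrite mmapC; apply: exp_relC.
- by rewrite mmapX mmap1U.
- by rewrite mmapD; apply: exp_relD.
by rewrite rmorphM; apply: exp_relM.
Qed.

End Exponential.

Hypothesis nilp : forall i, exists n, iter n der 'X_i = 0.

Lemma nilpotent P : exists n, iter n der P = 0.
Proof.
have [q hq] := exp_exists (A := {mpoly K[3]}) idfun nilp.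
move: (mmap _ q P) (hq P) => E hE; exists (size E).
by have := hE (size E); rewrite nth_default // mul0rn /= => <-.
Qed.

(** The kernel is factorially closed: the exponential of [P * Q] has degree 0 in the parameter,
    degrees add over a domain, so that of [P] has degree 0 too. *)
Lemma der_mul_eq0 P Q : P != 0 -> Q != 0 -> der (P * Q) = 0 -> der P = 0.
Proof.
move=> P0 Q0 e; have [q hq] := exp_exists (A := {mpoly K[3]}) idfun nilp.
have hPQ := hq (P * Q); rewrite rmorphM /= in hPQ.
move: (mmap _ q P) (mmap _ q Q) (hq P) (hq Q) hPQ => EP EQ hP hQ hPQ.
have nz (T : {mpoly K[3]}) E : exp_rel idfun T E -> T != 0 -> E != 0.
  by move=> h; apply: contraNneq => E0; have := h 0%N; rewrite E0 coef0 mul0rn /= => <-.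
have EP0 := nz _ _ hP P0; have EQ0 := nz _ _ hQ Q0.
have sE : (size (EP * EQ)%R <= 1)%N.
  apply/leq_sizeP => -[|n] // _; have := hPQ n.+1.
  rewrite iterSr e iter_der0 rmorph0 => /eqP.
  rewrite -scaler_nat scaler_eq0 => /orP[|/eqP //].
  by rewrite ((pcharf0P K).1 hchar) -leqn0 leqNgt fact_gt0.
have sP : (size EP <= 1)%N.
  move: sE EP0 EQ0; rewrite -!size_poly_gt0 => sE h1 h2.
  move: sE; rewrite size_mul -?size_poly_gt0 //; move: h1 h2.
  by case: (size EP) => [|[|m]] //; case: (size EQ) => [|n] //; rewrite !addSn addnS.
by have := hP 1%N; rewrite (leq_sizeP _ _ sP) // mul0rn /= => <-.
Qed.

End Derivation.

(** * The relation between the leading parts of an automorphism *)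

Section Automorphism.
Variable K : closedFieldType.
Hypothesis hchar : [pchar K] =i pred0.
Variables (f g : 3.-tuple {mpoly K[3]}).
Hypothesis gf : forall i, tnth g i \mPo f = 'X_i.
Hypothesis fg : forall i, tnth f i \mPo g = 'X_i.
Variable R : {mpoly K[3]}.
Let fb := [tuple top_comp (tnth f i) | i < 3].
Hypothesis hR : forall P : {mpoly K[3]},
  P \mPo fb = 0 <-> exists Q : {mpoly K[3]}, P = R * Q.
Let w (i : 'I_3) := deg1 (tnth f i).
Let one (i : 'I_3) := 1%N.
Let van (P : {mpoly K[3]}) := P \mPo fb == 0.
Let sig : int := (w i0 + w i1 + w i2)%N.
Implicit Types P Q : {mpoly K[3]}.

Lemma wle_f i : wle one (w i) (tnth f i).
Proof.
move=> m; rewrite -mcoeff_msupp => /msize_mdeg_lt h.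
by rewrite wdeg_mdeg lez_nat /w /deg1; case: (msize _) h.
Qed.

Lemma fbE : fb = [tuple wpart one (w i) (tnth f i) | i < 3].
Proof.
apply: eq_from_tnth => i; rewrite !tnth_mktuple /top_comp /wpart.
by apply: eq_bigl => m; rewrite wdeg_mdeg.
Qed.

Lemma f_nonconst i c : tnth f i <> c%:MP.
Proof.
move=> h; have := fg i; rewrite h comp_mpolyC => /mpolyP/(_ U_(i)%MM).
by rewrite mcoeffC mcoeffXU eqxx mnm1_eq0 mulr0 => /eqP; rewrite eq_sym oner_eq0.
Qed.

Lemma w_gt0 i : (0 < w i)%N.
Proof.
rewrite lt0n; apply/eqP => h; apply: (@f_nonconst i (tnth f i)@_0).
apply: msize1_polyC; move: h; rewrite /w /deg1; by case: (msize _) => [|[]].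
Qed.

Lemma vanM P Q : van (P * Q) = van P || van Q.
Proof. by rewrite /van rmorphM mulf_eq0. Qed.

Lemma vanP P : van P <-> exists Q, P = R * Q.
Proof. by rewrite -hR /van; split=> /eqP. Qed.

Lemma vanR : van R.
Proof. by apply/vanP; exists 1; rewrite mulr1. Qed.

Lemma vanMl P : van (R * P).
Proof. by rewrite vanM vanR. Qed.

Lemma van_comp_top P k : wle w k P -> wpart one k (P \mPo f) = wpart w k P \mPo fb.
Proof. by move=> h; rewrite fbE; apply: wpart_comp h => i; apply: wle_f. Qed.

Lemma top_f_neq0 i : ~~ van 'X_i.
Proof.
rewrite /van comp_mpolyXi fbE tnth_mktuple; apply/eqP => h.
have := wle_pred (@wle_f i) h => h'.
have [m hm] : exists m, mdeg m = w i /\ (tnth f i)@_m != 0.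
  have f0 : tnth f i != 0 by apply/eqP => h0; apply: (@f_nonconst i 0); rewrite h0 mpolyC0.
  exists (mlead (tnth f i)); split; last by rewrite -mcoeff_msupp mlead_supp.
  by rewrite /w /deg1 -mlead_deg.
case: hm => [mw /h']; rewrite wdeg_mdeg mw; lia.
Qed.

Hypothesis R0 : R != 0.

(** Substituting the homogeneous leading parts respects the grading, so the ideal is homogeneous. *)
Lemma van_wpart P k : van P -> van (wpart w k P).
Proof.
move=> /eqP h; rewrite /van -(@wpart_comp_whom _ w one) ?h ?wpart0 // => i.
by rewrite fbE tnth_mktuple; apply: whom_wpart.
Qed.

(** Each nonzero component of [R] lies in the ideal, hence is a multiple of [R] and has degree at
    least the top degree of [R]: there is only one. *)
Lemma R_homog : exists N : nat, whom w N R /\ (0 < N)%N.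
Proof.
have [N [hle hN]] := wtop_exists w R0.
have lowdeg k : wpart w k R != 0 -> N%:Z <= k.
  move=> hk; have /vanP[Q hQ] := van_wpart k vanR.
  have Q0 : Q != 0 by apply: contraNneq hk => Q0; rewrite hQ Q0 mulr0.
  have [n [nle hn]] := wtop_exists w Q0.
  have : wpart w (N%:Z + n%:Z) (R * Q) != 0 by rewrite wpartM // mulf_neq0.
  rewrite -hQ => h; suff -> : k = N%:Z + n%:Z by rewrite lerDl.
  by apply/eqP; apply: contraNT h; rewrite eq_sym => /(wpart_whom (@whom_wpart _ w k R)) ->.
have hN' : whom w N R.
  move=> m hm; apply/eqP; rewrite eq_le hle //=; apply: lowdeg.
  by apply/wpart_neq0P; exists m.
exists N; split=> //; rewrite lt0n; apply/eqP => N0.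
have [c hC] : exists c, R = c%:MP by rewrite N0 in hN'; apply: whom0_const w_gt0 hN'.
have := vanR; rewrite hC /van comp_mpolyC => /eqP h.
by move: R0; rewrite hC h eqxx.
Qed.

(** * Degree estimates from the inverse jacobian matrix *)

Section Degree.
Variable N : nat.
Hypotheses (hN : whom w N R) (N0 : (0 < N)%N).

Lemma van_whom_le P k : van P -> whom w k P -> P != 0 -> N%:Z <= k.
Proof.
move=> /vanP[Q hQ] hP P0; have Q0 : Q != 0 by apply: contraNneq P0 => Q0; rewrite hQ Q0 mulr0.
rewrite hQ in hP; have := whom_ge0 (whom_divl R0 hN hP) Q0.
by rewrite subr_ge0.
Qed.

Lemma R_power P k : whom w k P -> P != 0 ->
  exists (s : nat) Q, P = R ^+ s * Q /\ ~~ van Q.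
Proof.
move=> hP P0; have [n hn] : exists n : nat, k <= n by exists `|k|%N; lia.
elim: n k P hn hP P0 => [|n IH] k P hn hP P0.
all: have [vP|nvP] := boolP (van P); last by exists 0%N, P; rewrite mul1r.
  by have := van_whom_le vP hP P0; lia.
have /vanP[Q hQ] := vP; have Q0 : Q != 0 by apply: contraNneq P0 => Q0; rewrite hQ Q0 mulr0.
rewrite hQ in hP; have hQ' := whom_divl R0 hN hP.
have [|s [Q' [e v']]] := IH _ _ _ hQ' Q0; first by lia.
by exists s.+1, Q'; rewrite hQ e exprS mulrA.
Qed.

(** Some partial derivative is nonzero in characteristic zero, and its degree is below [N], too
    small for a multiple of [R]. *)
Lemma mderiv_R : exists i, ~~ van R^`M(i).
Proof.
have [m hm] := mpoly_neq0P _ R0; have := hN hm => -[wm].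
have [i mi] : exists i, m i != 0%N.
  apply/existsP; apply: contraTT N0; rewrite negb_exists => /forallP h.
  rewrite -wm wdegE; have h' i : m i = 0%N by apply/eqP/negPn/h.
  by rewrite !h'.
exists i; have R'0 : R^`M(i) != 0.
  apply/mpoly_neq0P; exists (m - U_(i))%MM; rewrite mcoeff_deriv submK; last first.
    by apply/mnm_lepP => j; rewrite mnm1E; case: eqP => [<-|//]; rewrite lt0n.
  by rewrite -mulr_natr mulf_neq0 // natf_neq0_char0.
apply/negP => v; have := van_whom_le v (whom_mderiv hN) R'0.
by have := w_gt0 i; lia.
Qed.

Let J : 'M[{mpoly K[3]}]_3 := \matrix_(l, i) (tnth f i)^`M(l).
Let M : 'M[{mpoly K[3]}]_3 := \matrix_(i, l) ((tnth g l)^`M(i) \mPo f).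

Lemma mulJM : J *m M = 1%:M.
Proof.
apply/matrixP => a l; rewrite !mxE.
have := mderiv_comp f (tnth g l) a; rewrite gf mderivXU => ->.
by apply: eq_bigr => i _; rewrite !mxE mulrC.
Qed.

(** The determinant of [J] is a unit, so a constant, and [M] is the adjugate up to a scalar. The
    cofactor at stake omits the column of [f_i]; the entries of another column [b] have degree at
    most [w b - 1]. *)
Lemma inverse_jacobian_degree i l : wle one (sig - (w i)%:Z - 2) (M i l).
Proof.
have dJM : \det J * \det M = 1 by rewrite -det_mulmx mulJM det1.
have [c c0 hc] : exists2 c : K, c != 0 & \det J = c%:MP := mpoly_unit_const dJM.
have hadj : \adj J = \det J *: M.
  by rewrite -[LHS]mulmx1 -mulJM mulmxA mul_adj_mx mul_scalar_mx.
have -> : M i l = c^-1 *: (\adj J) i l.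
  by rewrite hadj hc [X in _ = _ *: X]mxE mul_mpolyC scalerA mulVf // scale1r.
apply: wleZ; rewrite mxE /cofactor det_mx22.
have hJ a b : wle one ((w b)%:Z - 1) (J a b).
  by rewrite mxE; apply: wle_mderiv (@wle_f b).
have sg : sig - (w i)%:Z - 2 =
    ((w (lift i (0 : 'I_2)))%:Z - 1) + ((w (lift i (1 : 'I_2)))%:Z - 1).
  have -> : sig = (w i)%:Z + (w (lift i (0 : 'I_2)))%:Z + (w (lift i (1 : 'I_2)))%:Z.
    by rewrite -!PoszD sum_lift.
  by ring.
have sg' : sig - (w i)%:Z - 2 =
    ((w (lift i (1 : 'I_2)))%:Z - 1) + ((w (lift i (0 : 'I_2)))%:Z - 1) by rewrite sg addrC.
rewrite -[sig - _ - _]add0r; apply: wleM.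
  apply/whom_wle; rewrite -[0]/(0 * (l + i)%N%:Z); apply: whomXn.
  by rewrite -mpolyC1 -mpolyCN; apply: whomC.
apply: wleD; first by rewrite sg; apply: wleM; rewrite 2!mxE; apply: hJ.
rewrite -scaleN1r; apply: wleZ.
by rewrite sg'; apply: wleM; rewrite 2!mxE; apply: hJ.
Qed.

Lemma mderiv_degree P i (e : int) : wle one e (P \mPo f) ->
  wle one (e + sig - 3 - (w i)%:Z) (P^`M(i) \mPo f).
Proof.
move=> he; have -> : P^`M(i) \mPo f = \sum_l (P \mPo f)^`M(l) * M i l.
  have := mderiv_comp g (P \mPo f) i; rewrite (comp_mpolyK _ fg) => ->.
  rewrite raddf_sum; apply: eq_bigr => l _; rewrite /= rmorphM /=.
  by rewrite (comp_mpolyK _ gf) !mxE.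
apply: wle_sum => l _.
rewrite (_ : e + sig - 3 - _ = (e - (one l)%:Z) + (sig - (w i)%:Z - 2)); last by rewrite /one; ring.
by apply: wleM; [apply: wle_mderiv|apply: inverse_jacobian_degree].
Qed.

(* Differentiating in a direction where [R] has a nonzero derivative lowers the order
   of vanishing of the leading part along [R = 0] by exactly one. *)
Lemma parachute s P Q (k e : int) : wle w k P -> wpart w k P = R ^+ s * Q -> ~~ van Q ->
  wle one e (P \mPo f) -> k <= e + s%:Z * (sig - 3).
Proof.
elim: s P Q k e => [|s IH] P Q k e hP hQ nv he.
  have := van_comp_top hP; rewrite hQ mul1r => hk.
  rewrite mul0r addr0 leNgt; apply: contra nv => ek.
  by rewrite /van -hk (wpart_wle he).
have [i hi] := mderiv_R.
have := IH P^`M(i) (s.+1%:R * R^`M(i) * Q + R * Q^`M(i)) _ _ (wle_mderiv hP) _ _ (mderiv_degree he).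
rewrite wpart_mderiv hQ mderivM mderiv_exp => IH'.
suff : k - (w i)%:Z <= e + sig - 3 - (w i)%:Z + s%:Z * (sig - 3).
  by rewrite intS mulrDl mul1r; lia.
apply: IH'; first by rewrite exprS; ring.
rewrite /van comp_mpolyD [(R * _) \mPo _]rmorphM /= (eqP vanR) mul0r addr0 !rmorphM /=.
apply: mulf_neq0 nv; apply: mulf_neq0 hi.
by rewrite rmorph_nat -mpolyC_nat mpolyC_eq0 natf_neq0_char0.
Qed.

(** If no leading part of a [g_j] vanished on the leading parts of [f], then [g_j(f) = x_j] would
    bound the weighted degree of every [g_j] by 1. As the leading part of [R(f)] does vanish, [R(f)]
    has degree at most [N - 1]; substituting [g] would then bound the degree of [R] by [N - 1]. *)
Lemma top_g_van : exists j (k : nat) (s : nat) Q,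
  [/\ wle w k (tnth g j), wpart w k (tnth g j) = R ^+ s * Q, (0 < s)%N & ~~ van Q].
Proof.
have hk j : exists k : nat, wle w k (tnth g j) /\ wpart w k (tnth g j) != 0.
  apply: wtop_exists; apply/eqP => h; have := gf j; rewrite h comp_mpoly0.
  by move/mpolyP/(_ U_(j)%MM)/eqP; rewrite mcoeff0 mcoeffXU eqxx eq_sym oner_eq0.
have [k hk'] := fin_all_exists hk.
have [/existsP[j hj]|] := boolP [exists j, van (wpart w (k j) (tnth g j))].
  have [hle h0] := hk' j; exists j, (k j).
  have [s [Q [e nv]]] := R_power (@whom_wpart _ w (k j) (tnth g j)) h0.
  exists s, Q; split=> //; rewrite lt0n; apply/eqP => s0.
  by move: hj; rewrite e s0 mul1r (negPf nv).
rewrite negb_exists => /forallP hnv; exfalso.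
have hg j : wle w (one j) (tnth g j).
  have [hle _] := hk' j; apply: wle_trans (hle); rewrite leNgt; apply: contra (hnv j) => h.
  rewrite /van -(van_comp_top hle) gf (wpart_whom (@whomU _ one j)) // neq_lt h orbT //.
have hRf : wle one (N%:Z - 1) (R \mPo f).
  apply: wle_pred; first by apply: wle_comp (whom_wle hN); apply: wle_f.
  by rewrite (van_comp_top (whom_wle hN)) (wpart_id hN); apply/eqP/vanR.
have := wle_comp hg hRf; rewrite (comp_mpolyK _ fg) => hRle.
by have := whom_wle_le hN hRle R0; lia.
Qed.

(** Here [e = 1], since [g_j(f) = x_j]. The factor [R ^+ s] gives [s * N <= k], so
    [s * N <= 1 + s * (sig - 3)], and [s >= 1] leaves [N <= sig - 2]. *)
Lemma degree_bound : N%:Z + 2 <= sig.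
Proof.
have [j [k [s [Q [hle hQ s0 nv]]]]] := top_g_van.
have := parachute hle hQ nv (e := 1); rewrite gf => /(_ (whom_wle (@whomU _ one j))) hk.
have Q0 : Q != 0 by apply: contraNneq nv => ->; rewrite /van comp_mpoly0.
have hw : whom w k (R ^+ s * Q) by rewrite -hQ; apply: whom_wpart.
have RX : R ^+ s != 0 by rewrite expf_neq0.
have := whom_ge0 (whom_divl RX (whomXn (n := s) hN) hw) Q0.
move=> hs; rewrite leNgt; apply/negP => lt.
have : s%:Z * (sig - 1) <= s%:Z * N%:Z by apply: ler_wpM2l => //; move: lt; lia.
by move: hk hs s0; lia.
Qed.


(** * The leading part of a partial derivative and its flow *)

Section Flow.
Variables (l j : 'I_3).
Hypothesis jl : j != l.
Hypothesis top_gj : exists (k : nat) (s : nat) Q,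
  [/\ wle w k (tnth g j), wpart w k (tnth g j) = R ^+ s * Q, (0 < s)%N & ~~ van Q].

Let a i := (tnth f i)^`M(l) \mPo g.

Lemma der_a P : der a P = (P \mPo f)^`M(l) \mPo g.
Proof.
rewrite mderiv_comp raddf_sum; apply: eq_bigr => i _.
by rewrite /= rmorphM /= (comp_mpolyK _ fg) mulrC.
Qed.

Lemma iter_der_a n P : iter n (der a) P = iter n (mderiv l) (P \mPo f) \mPo g.
Proof.
elim: n => [|n IH]; first by rewrite /= (comp_mpolyK _ fg).
by rewrite !iterS IH der_a (comp_mpolyK _ gf).
Qed.

Lemma iter_mderiv_eq0 P : exists n, iter n (mderiv l) P = 0.
Proof.
have [k hk] := wle_exists one P; exists k.+1.
have h n : wle one (k%:Z - n%:Z) (iter n (mderiv l) P).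
  elim: n => [|n IH]; first by rewrite subr0.
  rewrite iterS (_ : k%:Z - _ = k%:Z - n%:Z - (one l)%:Z); last by rewrite /one; lia.
  exact: wle_mderiv.
apply/eqP; apply: contraT => /mpoly_neq0P[m /h]; lia.
Qed.

Lemma der_gj : der a (tnth g j) = 0.
Proof. by rewrite der_a gf mderivXU eq_sym (negPf jl) comp_mpoly0. Qed.

Lemma a_neq0 : exists i, a i != 0.
Proof.
apply/existsP; apply: contraT; rewrite negb_exists => /forallP h.
have : der a (tnth g l) = 0.
  by rewrite /der big1 // => i _; have /negPn/eqP -> := h i; rewrite mul0r.
by move/eqP; rewrite der_a gf mderivXU eqxx comp_mpoly1 oner_eq0.
Qed.

Let S : int := sig.

Lemma w_le_S i : (w i)%:Z <= S.
Proof. by rewrite /S /sig lez_nat; elim/I3_ind: i; lia. Qed.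

Lemma top_degree_a : exists kap : int,
  (forall i, wle w ((w i)%:Z + kap) (a i)) /\ exists i, wpart w ((w i)%:Z + kap) (a i) != 0.
Proof.
(* The shift by [S + 1] makes every bound negative at [n = 0], where all [a i] would vanish; the
   descent on [n] must stop before. *)
have [n hn] : exists n : nat, forall i, wle w ((w i)%:Z + (n%:Z - S - 1)) (a i).
  have [d hd] := fin_all_exists (fun i => wle_exists w (a i)).
  exists (d i0 + d i1 + d i2 + `|S|.+1)%N => i; apply: wle_trans (hd i).
  by have := w_gt0 i; elim/I3_ind: i; lia.
elim: n hn => [|n IH] hn.
  have [i ai] := a_neq0; have [m hm] := mpoly_neq0P _ ai.
  by have := hn i m hm; have := w_le_S i; lia.
have [/existsP[i hi]|] := boolP [exists i, wpart w ((w i)%:Z + (n.+1%:Z - S - 1)) (a i) != 0].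
  by exists (n.+1%:Z - S - 1); split=> //; exists i.
rewrite negb_exists => /forallP h0; apply: IH => i.
rewrite (_ : _ + _ = (w i)%:Z + (n.+1%:Z - S - 1) - 1); last by lia.
by apply: wle_pred (hn i) _; apply/eqP/negPn.
Qed.

Lemma split_power_R kap (c : 'I_3 -> {mpoly K[3]}) :
  (forall i, whom w ((w i)%:Z + kap) (c i)) -> (exists i, c i != 0) ->
  exists (s : nat) (b : 'I_3 -> {mpoly K[3]}),
    [/\ forall i, c i = R ^+ s * b i, forall i, whom w ((w i)%:Z + (kap - N%:Z * s%:Z)) (b i) &
        exists i, ~~ van (b i)].
Proof.
have [n hn] : exists n : nat, kap + S + 1 <= n by exists `|(kap + S + 1)%R|%N; lia.
elim: n kap c hn => [|n IH] kap c hn hc [i ci].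
all: have [/existsP[i' hi']|] := boolP [exists i, ~~ van (c i)].
all: try by exists 0%N, c; split=> [i''|i''|]; rewrite ?mul1r ?mulr0 ?subr0 //; exists i'.
  by have := whom_ge0 (hc i) ci; have := w_le_S i; lia.
rewrite negb_exists => /forallP hv.
have hq i' : exists Q, c i' = R * Q by apply/vanP/negPn/hv.
have [q hq'] := fin_all_exists hq.
have [|i'||s [b [hb hb' hb'']]] := IH (kap - N%:Z) q.
- by move: hn N0; lia.
- have [->|_] := eqVneq (q i') 0; first exact: whom0.
  by have := hc i'; rewrite hq' => /(whom_divl R0 hN); rewrite -addrA.
- by exists i; apply: contraNneq ci => q0; rewrite hq' q0 mulr0.
exists s.+1, b; split=> // i'; first by rewrite hq' hb exprS mulrA.
by rewrite (_ : _ - _ = kap - N%:Z - N%:Z * s%:Z) // intS; lia.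
Qed.

(* The leading part of the derivation [d/dx_l], written in the coordinates [f] and divided by
   the largest possible power of [R]. *)
Lemma reduced_derivation : exists (kap : int) (b : 'I_3 -> {mpoly K[3]}),
  [/\ forall i, whom w ((w i)%:Z + kap) (b i), exists i, ~~ van (b i),
      forall i, exists n, iter n (der b) 'X_i = 0 & der b R = 0].
Proof.
have [kap [ha [ia hia]]] := top_degree_a.
pose ah i := wpart w ((w i)%:Z + kap) (a i).
have hah i : whom w ((w i)%:Z + kap) (ah i) by apply: whom_wpart.
have step k P : wle w k P -> wle w (k + kap) (der a P) /\
    wpart w (k + kap) (der a P) = der ah (wpart w k P).
  move=> hP; have e i : k + kap = ((w i)%:Z + kap) + (k - (w i)%:Z) by ring.
  split; first by apply: wle_sum => i _; rewrite (e i); apply: wleM => //; apply: wle_mderiv.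
  rewrite wpart_sum; apply: eq_bigr => i _.
  by rewrite (e i) wpartM ?wpart_mderiv //; apply: wle_mderiv.
have iter_step n k P : wle w k P -> wle w (k + kap * n%:Z) (iter n (der a) P) /\
    wpart w (k + kap * n%:Z) (iter n (der a) P) = iter n (der ah) (wpart w k P).
  move=> hP; elim: n => [|n [IH1 IH2]]; first by rewrite mulr0 addr0.
  rewrite (_ : k + _ = k + kap * n%:Z + kap); last by rewrite intS; ring.
  by rewrite !iterS -IH2; apply: step.
(* An iterate of the leading derivation on a variable is a component of the same iterate of [der a],
   so it vanishes together with it. *)
have nilp_ah i : exists n, iter n (der ah) 'X_i = 0.
  have [n hn] := iter_mderiv_eq0 ('X_i \mPo f); exists n.
  have [_] := iter_step n _ _ (whom_wle (@whomU _ w i)).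
  by rewrite iter_der_a hn comp_mpoly0 wpart0 (wpart_id (@whomU _ w i)) => <-.
(* [der a] kills [g_j], so [ah] kills its leading part [R ^+ s * Q]; factorial closedness isolates
   [R]. *)
have ahR : der ah R = 0.
  have [k [s [Q [hle hQ s0 nv]]]] := top_gj.
  have Q0 : Q != 0 by apply: contraNneq nv => ->; rewrite /van comp_mpoly0.
  have e : der ah (R ^+ s * Q) = 0.
    by rewrite -hQ; have [_ <-] := step _ _ hle; rewrite der_gj wpart0.
  case: s s0 {hQ} e => // s _; rewrite exprS -mulrA; apply: der_mul_eq0 => //.
  by rewrite mulf_neq0 // expf_neq0.
have [|s [b [hb hb' hb'']]] := split_power_R hah; first by exists ia.
have der_ah P : der ah P = R ^+ s * der b P.
  by rewrite mulr_sumr; apply: eq_bigr => i _; rewrite hb mulrA.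
have RX n : R ^+ n != 0 by rewrite expf_neq0.
have bR : der b R = 0.
  by apply/eqP; have := ahR; rewrite der_ah => /eqP; rewrite mulf_eq0 (negPf (RX _)).
have bRX n P : der b (R ^+ n * P) = R ^+ n * der b P.
  elim: n P => [|n IH] P; first by rewrite !mul1r.
  by rewrite exprSr -!mulrA IH derM bR mul0r add0r.
exists (kap - N%:Z * s%:Z), b; split=> // i.
have [n hn] := nilp_ah i; exists n.
(* Since [der b] kills [R], the powers of [R] pass through its iterates and can be cancelled. *)
have : iter n (der ah) 'X_i = R ^+ (s * n) * iter n (der b) 'X_i.
  elim: n {hn} => [|n IH]; first by rewrite muln0 mul1r.
  by rewrite !iterS IH der_ah bRX mulrA -exprD mulnS.
by rewrite hn => /esym/eqP; rewrite mulf_eq0 (negPf (RX _)) => /eqP.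
Qed.


(** The curve is the orbit, under the flow of the reduced derivation, of a point of [R = 0]. A form
    whose derivative lies in the ideal is constant along it. *)
Lemma leading_curve : (forall c, ~~ van ('X_i1 ^+ w i0 - c *: 'X_i0 ^+ w i1)) ->
  exists X, [/\ const_form w X, mmap (@polyC K) X R = 0 & exists i, (1 < size (X i))%N].
Proof.
move=> hx; have [kap [b [hb [ib hib] hnil bR]]] := reduced_derivation.
have derb k P : whom w k P -> whom w (k + kap) (der b P).
  move=> hP; apply: whom_sum => i _.
  rewrite (_ : k + kap = ((w i)%:Z + kap) + (k - (w i)%:Z)); last by ring.
  by apply: whomM => //; apply: whom_mderiv.
have iter_derb n k P : whom w k P -> whom w (k + kap * n%:Z) (iter n (der b) P).
  move=> hP; elim: n => [|n IH]; first by rewrite mulr0 addr0.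
  by rewrite iterS (_ : k + _ = k + kap * n%:Z + kap); [apply: derb|rewrite intS; ring].
have van_der P : van P -> van (der b P).
  by move=> /vanP[Q ->]; rewrite derM bR mul0r add0r vanMl.
have van_iter n P : van P -> van (iter n (der b) P).
    by move=> hP; elim: n => [//|n IH]; rewrite iterS; apply: van_der.
have van_iter_lt m n P : (m <= n)%N -> van (iter m (der b) P) -> van (iter n (der b) P).
  by move=> mn hv; rewrite -(subnK mn) iterD; apply: van_iter.
have last_iter P : ~~ van P -> exists n, ~~ van (iter n (der b) P) /\ van (iter n.+1 (der b) P).
  move=> nv; have [n hn] := nilpotent hchar hnil P.
  have ex : exists n, van (iter n (der b) P) by exists n; rewrite hn /van comp_mpoly0.
  case: (ex_minnP ex) => -[|m] hm hmin; first by rewrite hm in nv.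
  by exists m; split; [apply/negP => /hmin; rewrite ltnn|exact: hm].
have [h [k [k0 hk nvh vdh]]] : exists h (k : int),
    [/\ 0 < k, whom w k h, ~~ van h & van (der b h)].
  pose d := (w i0 * w i1)%N.
  have hd0 : whom w d ('X_i0 ^+ w i1 : {mpoly K[3]}).
    by rewrite /d PoszM; apply/whomXn/whomU.
  have hd1 : whom w d ('X_i1 ^+ w i0 : {mpoly K[3]}).
    by rewrite /d mulnC PoszM; apply/whomXn/whomU.
  have d0 : (0 < d)%N by rewrite muln_gt0 !w_gt0.
  have nv0 : ~~ van ('X_i0 ^+ w i1).
    by rewrite /van rmorphXn /= expf_eq0 negb_and top_f_neq0 orbT.
  (* The last iterate of this power outside the ideal is the wanted form, unless its degree is 0. *)
  have [n [hn1 hn2]] := last_iter _ nv0.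
  have hwn := iter_derb n _ _ hd0; set h0 := iter n _ _ in hn1 hn2 hwn.
  have h00 : h0 != 0 by apply: contraNneq hn1 => ->; rewrite /van comp_mpoly0.
  have := whom_ge0 hwn h00; rewrite le_eqVlt => /orP[/eqP e|gt]; last first.
    by exists h0, (d%:Z + kap * n%:Z).
  (* In degree 0 the iterate is a constant [c0], and the same iterate of the other power, of equal
     degree [d], is a constant [c1]. Their combination [P] is killed at step [n], and [hx] keeps [P]
     outside the ideal, so its last iterate outside occurs at some [n' < n]. As [kap < 0], that
     iterate has positive degree. *)
  rewrite -e in hwn; have [c0 hc0] := whom0_const w_gt0 hwn.
  have c00 : c0 != 0 by apply: contraNneq h00 => c00; rewrite hc0 c00 mpolyC0.
  have hwn1 := iter_derb n _ _ hd1; rewrite -e in hwn1; have [c1 hc1] := whom0_const w_gt0 hwn1.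
  have := hx (c1 / c0); set P := 'X_i1 ^+ _ - _ => nvP.
  have hP : whom w d P by apply: whomB => //; apply: whomZ.
  have Pn : iter n (der b) P = 0.
    rewrite /P -scaleNr iter_derD iter_derZ hc1 -/h0 hc0 -mul_mpolyC -mpolyCM mulNr.
    by rewrite divfK // mpolyCN subrr.
  have [n' [h1 h2]] := last_iter _ nvP.
  have n'n : (n' < n)%N.
    rewrite ltnNge; apply: contra h1 => nn'; apply: (van_iter_lt _ _ _ nn').
    by rewrite Pn /van comp_mpoly0.
  exists (iter n' (der b) P), (d%:Z + kap * n'%:Z); split=> //; last exact: iter_derb.
  have kapn : kap * n%:Z < 0.
    have -> : kap * n%:Z = - d%:Z by apply/eqP; rewrite -addr_eq0 addrC -e.
    by rewrite oppr_lt0 ltz_nat.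
  have kap0 : kap < 0.
    by rewrite -(@pmulr_llt0 _ n%:Z) // ltz_nat (leq_ltn_trans _ n'n).
  by rewrite e ltrD2l ltr_nM2l // ltz_nat.
(* [ev] evaluates at the image, under the leading parts of [f], of a point [q0] chosen so that
   neither [h] nor [b ib] vanishes there. Such an image lies on [R = 0]. *)
have : ~~ van (h * b ib) by rewrite vanM negb_or nvh.
move=> /nonroot_mpoly[q0]; pose ev : {rmorphism {mpoly K[3]} -> K} :=
  GRing.RMorphism.clone _ _ (meval q0 \o comp_mpoly fb) _.
rewrite -[X in X != 0]/(ev (h * b ib)) rmorphM mulf_eq0 negb_or => /andP[evh evb].
have evC c : ev c%:MP = c by rewrite /ev /= comp_mpolyC mevalC.
have evv P : van P -> ev P = 0 by rewrite /ev /= => /eqP ->; rewrite meval0.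
have [X hX] := exp_exists hchar ev hnil.
have {}hX P : exp_rel b ev P (mmap (@polyC K) X P).
  have -> : mmap (@polyC K) X P = mmap (polyC \o (ev \o @mpolyC 3 K)) X P.
    by apply: eq_bigr => m _; congr (_ * _); rewrite -[in LHS](evC P@_m).
  exact: hX.
have fact_neq0 n : (n`!%:R : K) != 0.
  by rewrite ((pcharf0P K).1 hchar) -lt0n fact_gt0.
have coefE P n : (mmap (@polyC K) X P)`_n = n`!%:R^-1 * ev (iter n (der b) P).
  by rewrite -hX -[X in _ = _ * X]mulr_natl mulKf.
exists X; split.
- exists `|k|%N, h; split; first by lia.
    by apply/whomE; rewrite gez0_abs // ltW.
  apply/size_poly1P; exists (ev h); first exact: evh.
  apply/polyP => -[|n].
    by rewrite coefE coefC eqxx fact0 invr1 mul1r.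
  by rewrite coefE coefC evv ?mulr0 // iterSr; apply: van_iter.
- apply/polyP => n; rewrite coefE coef0 evv ?mulr0 //; apply: van_iter; exact: vanR.
(* The coefficient of degree 1 of this coordinate is [ev (b ib)], which is nonzero. *)
exists ib; rewrite ltnNge; apply: contra evb => /leq_sizeP/(_ 1%N isT).
have := coefE 'X_ib 1%N; rewrite mmapX mmap1U => -> /eqP.
by rewrite /= derX invr1 mul1r.
Qed.

End Flow.

End Degree.

Theorem leading_relation : exists N : nat,
  [/\ whom w N R, (0 < N)%N, (N + 2 <= w i0 + w i1 + w i2)%N &
  (forall c, ~~ van ('X_i1 ^+ w i0 - c *: 'X_i0 ^+ w i1)) ->
  exists X, [/\ const_form w X, mmap (@polyC K) X R = 0 & exists i, (1 < size (X i))%N]].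
Proof.
have [N [hN N0]] := R_homog; exists N; split=> //.
  by have := degree_bound hN N0; rewrite /sig -PoszD lez_nat.
have [j top] := top_g_van hN N0.
have [l jl] : exists l, j != l by case: (eqVneq j i0) => [->|]; [exists i1|exists i0].
exact: leading_curve hN N0 _ _ jl top.
Qed.

End Automorphism.

(** * Polynomials in the first two variables *)

Section InX1X2.
Variable K : closedFieldType.
Implicit Types (P Q : {mpoly K[3]}) (X : 'I_3 -> {poly K}).

Lemma mpolyX_I3 (m : 'X_{1..3}) :
  'X_[m] = 'X_i0 ^+ m i0 * 'X_i1 ^+ m i1 * 'X_i2 ^+ m i2 :> {mpoly K[3]}.
Proof. by rewrite mpolyXE_id big_I3. Qed.

(** Absence of [x3] is degree 0 for the weights [(0, 0, 1)], so the closure properties below are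
    those of [whom]. *)
Lemma in_x1x2E P : in_x1x2 P <-> whom (fun i => if i == i2 then 1%N else 0%N) 0 P.
Proof.
have e (m : 'X_{1..3}) : wdeg (fun i => if i == i2 then 1%N else 0%N) m = m i2.
  by rewrite wdegE /= !muln0 muln1.
split=> h m; first by rewrite -mcoeff_msupp => /h; rewrite e => ->.
by rewrite mcoeff_msupp => /h; rewrite e => -[].
Qed.

Lemma in_x1x2D P Q : in_x1x2 P -> in_x1x2 Q -> in_x1x2 (P + Q).
Proof. by move=> /in_x1x2E h1 /in_x1x2E h2; apply/in_x1x2E/whomD. Qed.

Lemma in_x1x2Z c P : in_x1x2 P -> in_x1x2 (c *: P).
Proof. by move=> /in_x1x2E h1; apply/in_x1x2E/whomZ. Qed.

Lemma in_x1x2B P Q : in_x1x2 P -> in_x1x2 Q -> in_x1x2 (P - Q).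
Proof. by move=> /in_x1x2E h1 /in_x1x2E h2; apply/in_x1x2E/whomB. Qed.

Lemma in_x1x2M P Q : in_x1x2 P -> in_x1x2 Q -> in_x1x2 (P * Q).
Proof.
by move=> /in_x1x2E h1 /in_x1x2E h2; apply/in_x1x2E; rewrite -[0]addr0; apply: whomM.
Qed.

Lemma in_x1x2Xn P n : in_x1x2 P -> in_x1x2 (P ^+ n).
Proof.
by move=> /in_x1x2E h; apply/in_x1x2E; have := whomXn (n := n) h; rewrite mul0r.
Qed.

Lemma in_x1x2_0 : in_x1x2 (0 : {mpoly K[3]}).
Proof. exact/in_x1x2E/whom0. Qed.

Lemma in_x1x2_X0 : in_x1x2 ('X_i0 : {mpoly K[3]}).
Proof. by apply/in_x1x2E; apply: (@whomU _ _ i0). Qed.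

Lemma in_x1x2_X1 : in_x1x2 ('X_i1 : {mpoly K[3]}).
Proof. by apply/in_x1x2E; apply: (@whomU _ _ i1). Qed.

Lemma mmap_comp X (t : 3.-tuple {mpoly K[3]}) P :
  mmap (@polyC K) X (P \mPo t) = mmap (@polyC K) (fun i => mmap (@polyC K) X (tnth t i)) P.
Proof.
elim/mpoly_alg_ind: P => [c|i|P Q hP hQ|P Q hP hQ].
- by rewrite comp_mpolyC !mmapC.
- by rewrite comp_mpolyXi !mmapX !mmap1U.
- by rewrite comp_mpolyD !mmapD hP hQ.
by rewrite !rmorphM /= hP hQ.
Qed.

Lemma mmap_in_x1x2 X Y P : in_x1x2 P -> X i0 = Y i0 -> X i1 = Y i1 ->
  mmap (@polyC K) X P = mmap (@polyC K) Y P.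
Proof.
move=> h e0 e1; rewrite /mmap; apply: eq_big_seq => m /h m2.
by rewrite /mmap1 !big_I3 /= e0 e1 m2 !expr0.
Qed.

Lemma size_mmap_in_x1x2 X P : in_x1x2 P -> (size (X i0) <= 1)%N -> (size (X i1) <= 1)%N ->
  (size (mmap (@polyC K) X P) <= 1)%N.
Proof.
move=> h h0 h1; rewrite /mmap big_seq; apply: (big_ind (fun Q : {poly K} => (size Q <= 1)%N)).
- by rewrite size_poly0.
- exact: size_addle1.
move=> m /h m2; rewrite /mmap1 big_I3 /= m2 expr0 mulr1.
apply: size_mulle1; first by rewrite size_polyC leq_b1.
by apply: size_mulle1; apply: size_exp_le1.
Qed.

(** Below degree [4 * w i1] the exponent of [x2] is at most 3, and the degree fixes that of [x1].
    The exponents carry information only where the coefficient is nonzero. *)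
Lemma low_degree_form (w : 'I_3 -> nat) (u : nat) P : (0 < w i0)%N ->
  in_x1x2 P -> whom w u P -> (4 * w i1 > u)%N ->
  exists (c3 c2 c1 c0 : K) (k3 k2 k1 k0 : nat),
  [/\ P = c3 *: ('X_i0 ^+ k3 * 'X_i1 ^+ 3) + c2 *: ('X_i0 ^+ k2 * 'X_i1 ^+ 2)
        + c1 *: ('X_i0 ^+ k1 * 'X_i1) + c0 *: 'X_i0 ^+ k0,
      c3 != 0 -> (k3 * w i0 + 3 * w i1 = u)%N, c2 != 0 -> (k2 * w i0 + 2 * w i1 = u)%N,
      c1 != 0 -> (k1 * w i0 + w i1 = u)%N & c0 != 0 -> (k0 * w i0 = u)%N].
Proof.
move=> w0 hP hu h4.
pose k j := ((u - j * w i1) %/ w i0)%N.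
pose form (c : nat -> K) := c 3%N *: ('X_i0 ^+ k 3%N * 'X_i1 ^+ 3) + c 2%N *: ('X_i0 ^+ k 2%N * 'X_i1 ^+ 2)
  + c 1%N *: ('X_i0 ^+ k 1%N * 'X_i1) + c 0%N *: 'X_i0 ^+ k 0%N.
pose good (c : nat -> K) := forall j, (j < 4)%N -> c j != 0 -> (k j * w i0 + j * w i1 = u)%N.
suff [c gc ->] : exists2 c, good c & P = form c.
  exists (c 3%N), (c 2%N), (c 1%N), (c 0%N), (k 3%N), (k 2%N), (k 1%N), (k 0%N).
  split=> // [/(gc 3%N isT)|/(gc 2%N isT)|/(gc 1%N isT)|/(gc 0%N isT)] //.
    by rewrite mul1n.
  by rewrite mul0n addn0.
rewrite (mpolyE P) big_seq.
apply: (big_ind (fun Q => exists2 c, good c & Q = form c)).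
- exists (fun=> 0) => [j _|]; first by rewrite eqxx.
  by rewrite /form !scale0r !addr0.
- move=> _ _ [c gc ->] [d gd ->]; exists (fun j => c j + d j) => [j j4|].
    by have [->|/(gc j j4) //] := eqVneq (c j) 0; rewrite add0r; apply: gd.
  by rewrite /form !scalerDl; ring.
move=> m hm; have m2 := hP m hm; have := hu m; rewrite -mcoeff_msupp => /(_ hm) [].
rewrite wdegE m2 mul0n addn0 => e; rewrite mpolyX_I3 m2 expr0 mulr1.
have m1 : (m i1 < 4)%N by rewrite -(@ltn_pmul2r (w i1)); lia.
have km : k (m i1) = m i0 by rewrite /k -e addnK mulnK.
exists (fun j => if j == m i1 then P@_m else 0) => [j _|].
  by case: (j =P m i1) => [->|_]; rewrite ?eqxx // km.
move: km m1; rewrite /form; case: (m i1) => [|[|[|[|//]]]] <- _ /=;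
by rewrite !scale0r ?addr0 ?add0r ?mulr1.
Qed.

Lemma split_quadratic (A : comAlgType K) (c2 c1 c0 : K) (a b : A) : c2 != 0 ->
  exists r1 r2, c2 *: b ^+ 2 + c1 *: (a * b) + c0 *: a ^+ 2 = c2 *: ((b - r1 *: a) * (b - r2 *: a)).
Proof.
move=> c20; pose p := Poly [:: c0; c1; c2].
have ep : p = [:: c0; c1; c2] :> seq K by rewrite (PolyK (c := 0)).
have p0 : p != 0 by rewrite -size_poly_eq0 ep.
have [|rs [srs _ e]] := @pencil_split _ _ 2 p a b _ p0; first by rewrite ep.
move: srs e; rewrite lead_coefE ep /=; case: rs => [|r1 [|r2 [|]]] // _.
rewrite subnn expr0 mul1r !big_cons big_nil mulr1 => e; exists r1, r2.
rewrite -e /pencil !big_ord_recl big_ord0 /= ep /= !mulr1 mul1r addr0.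
by rewrite addrC; congr (_ + _); rewrite addrC.
Qed.

Lemma split_cubic (A : comAlgType K) (c3 c2 c1 c0 : K) (a b : A) : c3 != 0 ->
  exists r1 r2 r3, c3 *: b ^+ 3 + c2 *: (a * b ^+ 2) + c1 *: (a ^+ 2 * b) + c0 *: a ^+ 3
    = c3 *: ((b - r1 *: a) * (b - r2 *: a) * (b - r3 *: a)).
Proof.
move=> c30; pose p := Poly [:: c0; c1; c2; c3].
have ep : p = [:: c0; c1; c2; c3] :> seq K by rewrite (PolyK (c := 0)).
have p0 : p != 0 by rewrite -size_poly_eq0 ep.
have [|rs [srs _ e]] := @pencil_split _ _ 3 p a b _ p0; first by rewrite ep.
move: srs e; rewrite lead_coefE ep /=; case: rs => [|r1 [|r2 [|r3 [|]]]] // _.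
rewrite subnn expr0 mul1r !big_cons big_nil mulr1 => e; exists r1, r2, r3.
rewrite -mulrA -e /pencil !big_ord_recl big_ord0 /= ep /= !mulr1 mul1r addr0.
by rewrite addrC; congr (_ + _); rewrite addrC; congr (_ + _); rewrite addrC.
Qed.

(** Adjusts an exponent that is known only when its coefficient is nonzero. *)
Lemma scale_exp_eq (A : comAlgType K) c (k k' : nat) (a b : A) :
  (c != 0 -> k = k') -> c *: (a ^+ k * b) = c *: (a ^+ k' * b).
Proof. by have [->|c0 ->] := eqVneq c 0; rewrite ?scale0r. Qed.

End InX1X2.

(** * Classification of the relation *)

Lemma no_E7_term (u v t k : nat) : (k * u = 2 * t)%N -> (3 * u + v = 2 * t)%N ->
  (3 * v = 2 * t)%N -> (0 < u)%N -> False.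
Proof.
move=> h1 h2 h3 u0; have : (2 * k * u = 9 * u)%N by rewrite -mulnA h1; lia.
by move/eqP; rewrite eqn_pmul2r // => /eqP; lia.
Qed.

Lemma eqn_mod_cancel a b i i' : coprime b a -> i * a = i' * a %[mod b] -> i = i' %[mod b].
Proof.
wlog le : i i' / (i' <= i)%N => [H|] cop e.
  by case/orP: (leq_total i' i) => le; [apply: H|apply/esym/H].
apply/eqP; rewrite eqn_mod_dvd // -(Gauss_dvdl _ cop) mulnBl -eqn_mod_dvd ?leq_mul2r ?le ?orbT //.
exact/eqP.
Qed.

(** Monomials of equal degree for coprime weights [a], [b] differ by trading [x1 ^+ b] for
    [x2 ^+ a]. Hence a weighted form in [x1], [x2] is a fixed monomial times an ordinary binary form
    in these two powers. *)
Lemma coprime_exponents a b i j i' j' : coprime a b -> (0 < a)%N -> (0 < b)%N ->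
  (i * a + j * b = i' * a + j' * b)%N ->
  [/\ i = i' %[mod b], j = j' %[mod a] & (i %/ b + j %/ a = i' %/ b + j' %/ a)%N].
Proof.
move=> cop a0 b0 e.
have E0 : i = i' %[mod b].
  apply: (@eqn_mod_cancel a); first by rewrite coprime_sym.
  by have := congr1 (modn^~ b) e; rewrite /= ![(_ * a + _)%N]addnC !modnMDl.
have E1 : j = j' %[mod a].
  by apply: (@eqn_mod_cancel b) => //; have := congr1 (modn^~ a) e; rewrite /= !modnMDl.
split=> //; apply/eqP; rewrite -(@eqn_pmul2r (a * b)) ?muln_gt0 ?a0 //; apply/eqP.
move: e; rewrite {1}(divn_eq i b) {1}(divn_eq j a) {1}(divn_eq i' b) {1}(divn_eq j' a) E0 E1.
move: (i %/ b)%N (j %/ a)%N (i' %/ b)%N (j' %/ a)%N (i' %% b)%N (j' %% a)%N => q s q' s' r t e.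
by lia.
Qed.

Lemma odd_ge3I k : odd k -> (1 < k)%N -> odd_ge3 k.
Proof. by exists (k - 3)./2; lia. Qed.

Section Classification.
Variable K : closedFieldType.
Hypothesis hchar : [pchar K] =i pred0.
Variables (w : 'I_3 -> nat) (R : {mpoly K[3]}) (N : nat) (van : pred {mpoly K[3]}).
Hypotheses (w_gt0 : forall i, (0 < w i)%N) (w01 : (w i0 <= w i1)%N) (w12 : (w i1 <= w i2)%N).
Hypotheses (R0 : R != 0) (hN : whom w N R) (Nlt : (N + 2 <= w i0 + w i1 + w i2)%N).
Hypothesis vanP : forall P, van P <-> exists Q, P = R * Q.
Hypothesis vanM : forall P Q, van (P * Q) = van P || van Q.
Hypothesis nvX : forall i, ~~ van 'X_i.
Hypothesis curve : (forall c, ~~ van ('X_i1 ^+ w i0 - c *: 'X_i0 ^+ w i1)) ->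
  exists X, [/\ const_form w X, mmap (@polyC K) X R = 0 & exists i, (1 < size (X i))%N].
Local Notation x := ('X_i0 : {mpoly K[3]}).
Local Notation y := ('X_i1 : {mpoly K[3]}).
Local Notation z := ('X_i2 : {mpoly K[3]}).
Implicit Types P Q : {mpoly K[3]}.

Lemma van_le P (k : int) : van P -> P != 0 -> whom w k P -> N%:Z <= k.
Proof.
move=> /vanP[Q hQ] P0 hP; have Q0 : Q != 0 by apply: contraNneq P0 => Q0; rewrite hQ Q0 mulr0.
rewrite hQ in hP; have := whom_ge0 (whom_divl R0 hN hP) Q0.
by rewrite subr_ge0.
Qed.

Lemma van_relation : van R.
Proof. by apply/vanP; exists 1; rewrite mulr1. Qed.

Lemma van1 : ~~ van 1.
Proof. by apply: contra (nvX i0) => h; rewrite -[x]mulr1 vanM h orbT. Qed.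

Lemma vanXn P n : van (P ^+ n) -> van P.
Proof.
elim: n => [|n IH]; first by rewrite expr0 (negPf van1).
by rewrite exprS vanM => /orP[].
Qed.

(** * Relations that are quadratic in the third variable *)

Section Quadratic.
Variables (al : K) (h C : {mpoly K[3]}).
Hypotheses (al0 : al != 0) (hh : in_x1x2 h) (hw : whom w (w i2) h).
Hypotheses (hC : in_x1x2 C) (Cw : whom w (2 * w i2)%N C).
Let Y := z + h.
Hypothesis RE : R = al *: (Y ^+ 2 + C).

Lemma Y_whom : whom w (w i2) Y.
Proof. by apply: whomD => //; apply: whomU. Qed.

Lemma N_quadratic : N = (2 * w i2)%N.
Proof.
have h1 : whom w (2 * w i2)%N R.
  rewrite RE; apply/whomZ/whomD => //; rewrite mulnC PoszM; exact/whomXn/Y_whom.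
by have [] := whom_uniq hN h1 R0.
Qed.

(** Otherwise [R] is a product of two forms of degree [w i2]; the ideal is prime, so one of them is
    a multiple of [R], whose degree is twice as large. *)
Lemma C_not_square E : whom w (w i2) E -> C <> - E ^+ 2.
Proof.
move=> hE e; have : van ((Y - E) * (Y + E)).
  by apply/vanP; exists (al^-1)%:MP; rewrite RE e -subr_sqr [RHS]mulrC mul_mpolyC scalerA mulVf // scale1r.
have fact0 : (Y - E) * (Y + E) != 0.
  by apply: contraNneq R0; rewrite RE e -subr_sqr => ->; rewrite scaler0.
move: fact0; rewrite mulf_eq0 negb_or => /andP[h1 h2]; rewrite vanM.
have := N_quadratic; have := w_gt0 i2 => w2 n2 /orP[/van_le|/van_le] hv.
  by have := hv (w i2) h1 (whomB Y_whom hE); rewrite lez_nat; lia.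
by have := hv (w i2) h2 (whomD Y_whom hE); rewrite lez_nat; lia.
Qed.

(** [R] has leading term [al *: z ^+ 2] in [z], so its nonzero multiples involve [z]. The degree in
    [z] is the one for the weights [w' = (0, 0, 1)]. *)
Lemma not_van_x1x2 P : in_x1x2 P -> P != 0 -> ~~ van P.
Proof.
move=> hP P0; apply/negP => /vanP[Q e].
have Q0 : Q != 0 by apply: contraNneq P0 => Q0; rewrite e Q0 mulr0.
pose w' i := if i == i2 then 1%N else 0%N.
have [n [nle ntop]] := wtop_exists w' Q0.
have wz : whom w' 1 z by apply: (@whomU _ w' i2).
have wz2 : whom w' 2 (z ^+ 2) by apply: (whomXn (n := 2) wz).
have h0 : whom w' 0 h by apply/in_x1x2E.
have C0 : whom w' 0 C by apply/in_x1x2E.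
have Rle : wle w' 2 R.
  rewrite RE; apply/wleZ/wleD; last exact/(wle_trans _ (whom_wle C0)).
  apply: (@wleXn _ w' 1 Y 2); apply: wleD; first exact: whom_wle.
  exact/(wle_trans _ (whom_wle h0)).
have Rtop : wpart w' 2 R = al *: z ^+ 2.
  have -> : R = al *: z ^+ 2 + al *: ((z * h) *+ 2 + h ^+ 2 + C).
    by rewrite RE /Y -scalerDr; congr (_ *: _); ring.
  rewrite wpartD !wpartZ (wpart_id wz2) wpartD (wpart_whom C0) // addr0.
  have h20 : whom w' 0 (h ^+ 2) by have := whomXn (n := 2) h0; rewrite mul0r.
  rewrite wpartD (wpart_whom h20) // addr0.
  rewrite (wpart_whom (k := 1)) ?scaler0 ?addr0 // mulr2n.
  by apply: whomD; rewrite -[1]addr0; apply: whomM.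
have : wpart w' (2 + n%:Z) (R * Q) != 0.
  rewrite wpartM // Rtop mulf_neq0 // scaler_eq0 negb_or al0 expf_neq0 //.
  by apply/eqP => z0; have := nvX i2; rewrite z0; have -> : van 0 by apply/vanP; exists 0; rewrite mulr0.
move/in_x1x2E: hP; rewrite e => hP; by rewrite (wpart_whom hP) ?eqxx.
Qed.

(** A rigidity statement contradicts [curve], whose hypothesis holds by [not_van_x1x2]. Adding [h]
    to the third coordinate moves the curve onto the surface of equation [Y ^+ 2 + C]; the constant
    form is transported by the inverse change [z - h], which is homogeneous because [h] has degree
    [w i2]. *)
Lemma curve_exists : ~ (forall X, const_form w X ->
  X i2 ^+ 2 = - mmap (@polyC K) X C -> forall i, (size (X i) <= 1)%N).
Proof.
move=> H; have [|X [[k [hf [k0 hk hc]]] XR [i hi]]] := curve.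
  move=> c; apply: not_van_x1x2.
    apply: in_x1x2B; first exact/in_x1x2Xn/in_x1x2_X1.
    exact/in_x1x2Z/in_x1x2Xn/in_x1x2_X0.
  apply/mpoly_neq0P; exists (U_(i1) *+ w i0)%MM.
  rewrite mcoeffB mcoeffZ !mcoeffXn eqxx.
  have -> : ((U_(i0) *+ w i1)%MM == (U_(i1) *+ w i0)%MM :> 'X_{1..3}) = false.
    apply/eqP => /mnmP/(_ i0); rewrite !mulmnE !mnm1E /= mul1n mul0n => e.
    by have := w_gt0 i1; rewrite e.
  by rewrite mulr0 subr0 oner_neq0.
pose X' i := if i == i2 then X i2 + mmap (@polyC K) X h else X i.
have e0 : X i0 = X' i0 by []. have e1 : X i1 = X' i1 by [].
have X'R : X' i2 ^+ 2 = - mmap (@polyC K) X' C.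
  apply/eqP; rewrite -addr_eq0 -(mmap_in_x1x2 hC e0 e1); apply/eqP.
  move: XR; rewrite RE mmapZ mmapD rmorphXn /= mmapD mmapX mmap1U => /eqP.
  by rewrite mulf_eq0 polyC_eq0 (negPf al0) => /eqP.
have cf : const_form w X'.
  pose t := [tuple (if i == i2 then z - h else 'X_i) | i < 3].
  have ht : forall i, whom w (w i) (tnth t i).
    by apply: I3_ind; rewrite tnth_mktuple /=; [exact: whomU|exact: whomU|apply: whomB => //; apply: whomU].
  exists k, (hf \mPo t); split=> //; first by apply/whomE; apply: (whom_comp ht); apply/whomE.
  rewrite mmap_comp (_ : mmap _ _ hf = mmap (@polyC K) X hf) //.
  apply: eq_bigr => m _; congr (_ * _); rewrite /mmap1 !big_I3; congr (_ ^+ _ * _ ^+ _ * _ ^+ _).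
  - by rewrite tnth_mktuple /= mmapX mmap1U.
  - by rewrite tnth_mktuple /= mmapX mmap1U.
  by rewrite tnth_mktuple /= mmapB mmapX mmap1U -(mmap_in_x1x2 hh e0 e1) /X' /= addrK.
have hs := H X' cf X'R.
have h0 : (size (X i0) <= 1)%N := hs i0. have h1 : (size (X i1) <= 1)%N := hs i1.
suff: (size (X i) <= 1)%N by rewrite leqNgt hi.
elim/I3_ind: i {hi} => //; rewrite -(addrK (mmap (@polyC K) X h) (X i2)) -scaleN1r.
apply: size_addle1; first exact: (hs i2).
exact/size_scalele1/size_mmap_in_x1x2.
Qed.


Let bound : (w i2 + 2 <= w i0 + w i1)%N.
Proof. by move: Nlt; rewrite N_quadratic; lia. Qed.

Local Notation NF := (normal_form w Y (Y ^+ 2 + C)).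

Lemma mmap_sub_scale (X : 'I_3 -> {poly K}) (r : K) i j (n : nat) :
  mmap (@polyC K) X ('X_i - r *: 'X_j ^+ n) = X i - r *: X j ^+ n.
Proof. by rewrite mmapB mmapZ rmorphXn /= !mmapX !mmap1U mul_polyC. Qed.

Local Ltac eval_mmap :=
  rewrite ?mmapD ?mmapZ ?rmorphM ?rmorphXn /= ?mmapX ?mmap1U ?mul_polyC.

(** Three distinct roots give the type D4, excluded by rigidity; a repeated root gives (13). *)
Lemma normal_form_cubic (c3 c2 c1 c0 : K) : c3 != 0 -> w i0 = w i1 ->
  C = c3 *: y ^+ 3 + c2 *: (x * y ^+ 2) + c1 *: (x ^+ 2 * y) + c0 *: x ^+ 3 ->
  (2 * w i2 = 3 * w i1)%N -> NF.
Proof.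
move=> c30 e01 eC ew; have [r1 [r2 [r3 e]]] := split_cubic c2 c1 c0 x y c30.
have {e eC} eC : C = c3 *: ((y - r1 *: x) * (y - r2 *: x) * (y - r3 *: x)) by rewrite eC.
have nf13 s t : C = c3 *: ((y - s *: x) * (y - t *: x) ^+ 2) -> NF.
  move=> eC'; do 12! right; left; exists (- c3 * s), c3, (- t), 1.
  split; first by rewrite xpair_eqE negb_and c30 orbT.
  split; first by rewrite xpair_eqE negb_and oner_neq0 orbT.
  congr (_ + _); rewrite eC' scalerAl; congr (_ * _ ^+ 2).
    by rewrite scalerBr scalerA mulNr scaleNr addrC.
  by rewrite scaleNr scale1r addrC.
have [r12|r12] := eqVneq r1 r2.
  by apply: (nf13 r3 r1); rewrite eC -r12; congr (_ *: _); ring.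
have [r13|r13] := eqVneq r1 r3.
  by apply: (nf13 r2 r1); rewrite eC -r13; congr (_ *: _); ring.
have [r23|r23] := eqVneq r2 r3.
  by apply: (nf13 r1 r2); rewrite eC -r23; congr (_ *: _); ring.
exfalso; apply: curve_exists => X hX eX.
have nc30 : - c3 != 0 by rewrite oppr_eq0.
apply: (rigid_D4 hchar hX nc30 r12 r13 r23) => //; first by lia.
rewrite eX eC mmapZ !rmorphM /=.
by rewrite !(mmap_sub_scale _ _ _ _ 1) mul_polyC scaleNr.
Qed.


(** Distinct roots are excluded by rigidity. A double root gives (7) if it is 0, (13) if [e = 1],
    and otherwise (14) after absorbing a square root of [c]. *)
Lemma normal_form_D_even (c r1 r2 : K) e : c != 0 -> (0 < e)%N ->
  w i1 = (e * w i0)%N -> (2 * w i2 = (2 * e + 1) * w i0)%N ->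
  C = c *: (x * (y - r1 *: x ^+ e) * (y - r2 *: x ^+ e)) -> NF.
Proof.
move=> c0 e0 e1 e2 eC; have [r12|r12] := eqVneq r1 r2; last first.
  exfalso; apply: curve_exists => X hX eX.
  have nc0 : - c != 0 by rewrite oppr_eq0.
  apply: (rigid_D_even hchar hX nc0 r12 e0) => //.
  by rewrite eX eC mmapZ !rmorphM /= !mmap_sub_scale mmapX mmap1U mul_polyC scaleNr.
have {}eC : C = (c *: x) * (y - r1 *: x ^+ e) ^+ 2.
  by rewrite eC -r12 -scalerAl expr2 mulrA.
have [r0|r0] := eqVneq r1 0.
  do 6! right; left; exists c; split=> //; congr (_ + _).
  by rewrite eC r0 scale0r subr0 scalerAl.
have [e_1|e_1] := eqVneq e 1%N.
  do 12! right; left; exists c, 0, (- r1), 1.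
  split; first by rewrite xpair_eqE negb_and c0.
  split; first by rewrite xpair_eqE negb_and oner_neq0 orbT.
  by congr (_ + _); rewrite eC e_1 expr1 scale0r addr0 scale1r scaleNr addrC [- _ + _]addrC addrC.
have [t ht] := @closed_root_exp K c 2 isT.
have t0 : t != 0 by apply: contraNneq c0 => t0; rewrite -ht t0 expr0n.
do 13! right; exists (- r1 * t), t, e.
split; first by rewrite !mulf_neq0 // oppr_eq0.
split; first by lia.
congr (_ + _); rewrite eC -ht mulrC -scalerAr scalerAl -exprZn; congr (_ ^+ 2 * _).
by rewrite scalerBr scalerA mulNr scaleNr addrC mulrC.
Qed.

(** For odd [m] the form [C] is squarefree whatever the coefficients, so this case is always
    contradictory. *)
Lemma normal_form_D_odd (c2 c0 : K) m : c2 != 0 -> c0 != 0 -> odd m ->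
  (2 * w i1 = m * w i0)%N -> (2 * w i2 = (m + 1) * w i0)%N ->
  C = c2 *: (x * y ^+ 2) + c0 *: x ^+ m.+1 -> NF.
Proof.
move=> c20 c00 om e1 e2 eC; exfalso; apply: curve_exists => X hX eX.
have m2 : (2 < m)%N.
  have : (1 < m)%N by rewrite -(ltn_pmul2r (w_gt0 i0)); have := w_gt0 i0; lia.
  by case: m om {e1 e2 eC} => [|[|[|]]].
apply: (@rigid_D_odd _ hchar w X hX (- c2) (- c0) m); rewrite ?oppr_eq0 //.
rewrite eX eC; eval_mmap.
by rewrite !scaleNr mulrDr !mulrN opprD -!scalerAr exprS.
Qed.

(** A double root makes [- C] a square, against [C_not_square]; distinct roots give (12). *)
Lemma normal_form_A (c r1 r2 : K) e : c != 0 -> (0 < e)%N -> w i1 = w i2 ->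
  w i1 = (e * w i0)%N -> C = c *: ((y - r1 *: x ^+ e) * (y - r2 *: x ^+ e)) -> NF.
Proof.
move=> c0 e0 e12 e1 eC; have [r12|r12] := eqVneq r1 r2.
  have [t ht] := @closed_root_exp K (- c) 2 isT.
  case: (@C_not_square (t *: (y - r1 *: x ^+ e))).
    apply/whomZ/whomB; first by rewrite -e12; apply: whomU.
    by apply: whomZ; rewrite -e12 e1 mulnC PoszM; apply/whomXn/whomU.
  by rewrite eC -r12 exprZn ht scaleNr opprK expr2.
do 11! right; left; exists (- (c * r1)), c, (- r2), 1, e.
split.
  have -> : - (c * r1) * 1 - c * (- r2) = c * (r2 - r1) by ring.
  by rewrite mulf_neq0 // subr_eq0 eq_sym.
split=> //; congr (_ + _); rewrite eC scalerAl; congr (_ * _).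
  by rewrite scalerBr scalerA scaleNr addrC.
by rewrite scaleNr scale1r addrC.
Qed.

Theorem quadratic_normal_form : NF.
Proof.
(* From [w i2 + 2 <= w i0 + w i1 <= 2 * w i1]. *)
have b4 : (4 * w i1 > 2 * w i2)%N by move: bound w01; lia.
have [c3 [c2 [c1 [c0 [k3 [k2 [k1 [k0 [eC h3 h2 h1 h0]]]]]]]]] := low_degree_form (w_gt0 i0) hC Cw b4.
have w0p := w_gt0 i0.
have even_e n u : (n * w i0 = 2 * u)%N -> ~~ odd n -> u = (n./2 * w i0)%N.
  by move=> e ho; have := odd_double_half n; rewrite (negPf ho) => en; move: e; rewrite -{1}en; lia.
have [c30|c30] := eqVneq c3 0; last first.
  (* A factor [x1] would push the degree to [w i0 + 3 * w i1], while
     [2 * w i2 <= 2 * w i0 + 2 * w i1 - 4]. *)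
  have k30 : k3 = 0%N.
    have := h3 c30; move: bound; case: k3 {h3 eC} => // k; rewrite mulSn; lia.
  have e3 := h3 c30; rewrite k30 mul0n add0n in e3.
  rewrite k30 expr0 mul1r in eC.
  have [e01|e01] := eqVneq (w i0) (w i1).
    have cancel a b : (a * w i0 = b * w i0)%N -> a = b.
      by move/eqP; rewrite eqn_pmul2r // => /eqP.
    apply: (@normal_form_cubic c3 c2 c1 c0) => //.
    have E2 : c2 != 0 -> k2 = 1%N by move=> /h2 e; apply: cancel; lia.
    have E1 : c1 != 0 -> k1 = 2%N by move=> /h1 e; apply: cancel; lia.
    have E0 : c0 != 0 -> k0 = 3%N by move=> /h0 e; apply: cancel; lia.
    rewrite eC (scale_exp_eq _ _ E2) (scale_exp_eq _ _ E1) expr1.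
    by have := scale_exp_eq x 1 E0; rewrite !mulr1 => ->.
  have lt01 : (w i0 < w i1)%N by rewrite ltn_neqAle e01.
  have c20 : c2 = 0.
    apply/eqP; apply: contraT => /h2; case: (k2) => [|[|k]]; rewrite ?mul0n ?mul1n ?mulSn; lia.
  rewrite c20 scale0r addr0 in eC.
  have [c10|c10] := eqVneq c1 0.
    rewrite c10 scale0r addr0 in eC.
    have [c00|c00] := eqVneq c0 0.
      by do 5! right; left; exists c3; split=> //; rewrite eC c00 scale0r addr0.
    have e0 := h0 c00; exfalso; apply: curve_exists => X hX eX.
    have {}eX : X i2 ^+ 2 = - c0 *: X i0 ^+ k0 + - c3 *: X i1 ^+ 3.
      by rewrite eX eC; eval_mmap; rewrite opprD addrC !scaleNr.
    have nc3 : - c3 != 0 by rewrite oppr_eq0.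
    have nc0 : - c0 != 0 by rewrite oppr_eq0.
    (* [bound] and [2 * w i2 = 3 * w i1] give [w i1 < 2 * w i0], so [k0 * w i0 = 3 * w i1] puts [k0]
       strictly between 3 and 6: types E6 and E8. *)
    have : k0 = 4%N \/ k0 = 5%N.
      move: e0 bound e3 lt01; clear; case: k0 => [|[|[|[|[|[|k]]]]]]; rewrite ?mulSn; lia.
    case=> k0E; rewrite k0E in e0 eX.
      by apply: (rigid_E6 hchar hX nc3 nc0) => //; [clear - e0 e3; lia|clear - e0; lia|rewrite addrC].
    by apply: (rigid_E8 hchar hX nc0 nc3) => //; clear - e0 e3; lia.
  (* Likewise [k1 * w i0 = 2 * w i1] puts [k1] strictly between 2 and 4: type E7. *)
  have e1 := h1 c10; have k13 : k1 = 3%N.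
    by move: e1 bound e3 lt01; clear; case: k1 => [|[|[|[|k]]]]; rewrite ?mulSn; lia.
  rewrite k13 in e1 eC.
  have c00 : c0 = 0 by apply/eqP; apply: contraT => /h0 e0; exfalso; exact: (no_E7_term e0 e1 e3 w0p).
  rewrite c00 scale0r addr0 in eC.
  exfalso; apply: curve_exists => X hX eX.
  have nc3 : - c3 != 0 by rewrite oppr_eq0.
  have nc1 : - c1 != 0 by rewrite oppr_eq0.
  apply: (rigid_E7 hchar hX nc3 nc1) => //; first by clear - e1 e3; lia.
  rewrite eX eC; eval_mmap; rewrite opprD mulrDr !scaleNr !mulrN -!scalerAr -exprS.
  by rewrite [X in - (c1 *: X)]mulrC.
rewrite c30 scale0r add0r in eC.
have [c20|c20] := eqVneq c2 0; last first.
  have e2 := h2 c20; have : k2 = 0%N \/ k2 = 1%N.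
    by move: e2 bound; case: (k2) => [|[|k]]; [left|right|rewrite !mulSn; lia].
  case=> k2E; rewrite k2E in e2 eC.
    rewrite expr0 mul1r in eC; have e12 : w i1 = w i2 by lia.
    (* Once [w i1] is a multiple [e * w i0], the form [C] is a quadratic form in [x ^+ e] and [y],
       which splits. *)
    have build e : (0 < e)%N -> w i1 = (e * w i0)%N -> NF.
      move=> ep ew.
      have cancel a b : (a * w i0 = b * w i0)%N -> a = b.
        by move/eqP; rewrite eqn_pmul2r // => /eqP.
      have E1 : c1 != 0 -> k1 = e by move=> /h1 e'; apply: cancel; lia.
      have E0 : c0 != 0 -> k0 = (e * 2)%N by move=> /h0 e'; apply: cancel; lia.
      have [r1 [r2 er]] := split_quadratic c1 c0 (x ^+ e) y c20.
      apply: (@normal_form_A c2 r1 r2 e) => //; rewrite -er eC (scale_exp_eq _ _ E1).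
      by have := scale_exp_eq x 1 E0; rewrite !mulr1 exprM => ->.
    have [c10|c10] := eqVneq c1 0; last first.
      have e1 := h1 c10; have ew : w i1 = (k1 * w i0)%N by lia.
      by apply: (build k1) => //; rewrite lt0n; apply: contraTneq (w_gt0 i1); rewrite ew => ->.
    rewrite c10 scale0r addr0 in eC.
    have [c00|c00] := eqVneq c0 0.
      have [t ht] := @closed_root_exp K (- c2) 2 isT.
      case: (@C_not_square (t *: y)); first by rewrite -e12; apply/whomZ/whomU.
      by rewrite exprZn ht scaleNr opprK eC c00 scale0r addr0.
    have e0 := h0 c00; have [ok|ok] := boolP (odd k0); last first.
      have ew := even_e k0 (w i1) _ ok; apply: (build k0./2); last by apply: ew; lia.
      rewrite lt0n; apply: contraTneq (w_gt0 i1) => z0; rewrite ew ?z0 ?mul0n //; lia.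
    do 9! right; left; exists c0, c2, k0; split; first by rewrite mulf_neq0.
    split; last by rewrite eC -addrA [c0 *: _ + _]addrC.
    apply: odd_ge3I => //; move: e0 (w_gt0 i1) w01 e12; clear.
    by case: k0 => [|[|k]] //; rewrite ?mul1n; lia.
  have build e : (0 < e)%N -> w i1 = (e * w i0)%N -> NF.
    move=> ep ew.
    have cancel a b : (a * w i0 = b * w i0)%N -> a = b.
      by move/eqP; rewrite eqn_pmul2r // => /eqP.
    have E1 : c1 != 0 -> k1 = (1 + e)%N by move=> /h1 e'; apply: cancel; lia.
    have E0 : c0 != 0 -> k0 = (1 + e * 2)%N by move=> /h0 e'; apply: cancel; lia.
    have [r1 [r2 er]] := split_quadratic c1 c0 (x ^+ e) y c20.
    apply: (@normal_form_D_even c2 r1 r2 e) => //; first by lia.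
    rewrite -mulrA scalerAr -er eC expr1 (scale_exp_eq _ _ E1).
    have := scale_exp_eq x 1 E0; rewrite !mulr1 => ->.
    by rewrite !mulrDr -!scalerAr !exprD !expr1 exprM !mulrA.
  have [c10|c10] := eqVneq c1 0; last first.
    have e1 := h1 c10; have k1p : (1 < k1)%N.
      by move: e1; have := w_gt0 i1; case: (k1) => [|[|k]] //; rewrite ?mul1n; lia.
    apply: (build k1.-1); first by lia.
    by move: e1 k1p; case: (k1) => // k; rewrite mulSn; lia.
  rewrite c10 scale0r addr0 in eC.
  have [c00|c00] := eqVneq c0 0.
    by do 6! right; left; exists c2; split=> //; rewrite eC c00 scale0r addr0.
  have e0 := h0 c00; case: (k0) e0 eC => [|m] e0 eC; first by have := w_gt0 i1; lia.
  rewrite mulSn in e0; have em : (m * w i0 = 2 * w i1)%N by lia.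
  have [om|om] := boolP (odd m).
    by apply: (normal_form_D_odd c20 c00 om) => //; rewrite ?mulnDl; lia.
  have ew := even_e m (w i1) em om; apply: (build m./2) => //.
  by rewrite lt0n; apply: contraTneq (w_gt0 i1) => z0; rewrite ew z0.
rewrite c20 scale0r add0r in eC.
have [c10|c10] := eqVneq c1 0; last first.
  have e1 := h1 c10; have [c00|c00] := eqVneq c0 0.
    do 8! right; left; exists c1, k1; split=> //; split; last by rewrite eC c00 scale0r addr0.
    by rewrite lt0n; apply/eqP => k10; move: e1; rewrite k10 => e1; have := w_gt0 i1; lia.
  have e0 := h0 c00; do 10! right; left; exists c0, c1, (k0 - k1)%N, k1.
  have k01 : (k1 < k0)%N by rewrite -(ltn_pmul2r w0p); have := w_gt0 i1; lia.
  split; first by rewrite mulf_neq0.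
  split; first by lia.
  congr (_ + _); rewrite eC mulrDl -!scalerAl -exprD subnK 1?ltnW // addrC.
  by rewrite [x ^+ k1 * y]mulrC.
rewrite c10 scale0r add0r in eC.
have [c00|c00] := eqVneq c0 0.
  case: (@C_not_square 0); first exact: whom0.
  by rewrite eC c00 scale0r expr0n oppr0.
have e0 := h0 c00; have [ok|ok] := boolP (odd k0); last first.
  have [t ht] := @closed_root_exp K (- c0) 2 isT.
  have ew := even_e k0 (w i2) e0 ok.
  case: (@C_not_square (t *: x ^+ k0./2)).
    by apply: whomZ; rewrite ew mulnC PoszM; apply/whomXn/whomU.
  rewrite exprZn ht scaleNr opprK eC -exprM muln2; congr (_ *: x ^+ _).
  by have := odd_double_half k0; rewrite (negPf ok).
do 7! right; left; exists c0, k0; split=> //; split; last by rewrite eC.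
apply: odd_ge3I => //; move: e0 (w_gt0 i1) w01 w12; clear.
by case: k0 => [|[|k]] //; rewrite ?mul1n; lia.
Qed.

End Quadratic.

(** By [Nlt], the degree of [R] is below [w i0 + w i1 + w i2]. This rules out every monomial
    divisible by [z ^+ 3], [x * z ^+ 2], [y * z ^+ 2], [y ^+ 2 * z] or [x * y * z]. *)
Lemma relation_shape : exists (al be ga : K) (k : nat) (C : {mpoly K[3]}),
  [/\ in_x1x2 C, whom w N C,
      R = al *: z ^+ 2 + (be *: x ^+ k + ga *: y) * z + C,
      al != 0 -> N = (2 * w i2)%N & (be != 0 -> (k * w i0 + w i2 = N)%N) /\ (ga != 0 -> (w i1 + w i2 = N)%N)].
Proof.
pose k := ((N - w i2) %/ w i0)%N.
pose shape Q := exists (al be ga : K) (C : {mpoly K[3]}),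
  [/\ in_x1x2 C, whom w N C,
      Q = al *: z ^+ 2 + (be *: x ^+ k + ga *: y) * z + C,
      al != 0 -> N = (2 * w i2)%N & (be != 0 -> (k * w i0 + w i2 = N)%N) /\ (ga != 0 -> (w i1 + w i2 = N)%N)].
suff [al [be [ga [C hC]]]] : shape R by exists al, be, ga, k, C.
rewrite (mpolyE R) big_seq; apply: (big_ind shape).
- exists 0, 0, 0, 0; split; rewrite ?eqxx //; [exact: in_x1x2_0|exact: whom0|].
  by rewrite !scale0r !add0r mul0r addr0.
- move=> _ _ [al [be [ga [C [h1 h2 -> h3 [h4 h5]]]]]] [al' [be' [ga' [C' [h1' h2' -> h3' [h4' h5']]]]]].
  have D (c c' : K) (T : Prop) : (c != 0 -> T) -> (c' != 0 -> T) -> c + c' != 0 -> T.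
    by have [-> _|c0 hT _ _] := eqVneq c 0; [rewrite add0r|apply: hT].
  exists (al + al'), (be + be'), (ga + ga'), (C + C'); split.
  + exact: in_x1x2D.
  + exact: whomD.
  + by rewrite !scalerDl; ring.
  + exact: D.
  by split; apply: D.
move=> m hm; have := hN (m := m); rewrite -mcoeff_msupp => /(_ hm) [] mN.
have X0 : in_x1x2 x by apply: in_x1x2_X0.
have X1 : in_x1x2 y by apply: in_x1x2_X1.
rewrite wdegE in mN; rewrite mpolyX_I3; move: (R@_m) (m i0) (m i1) (m i2) mN => c a b l mN.
have W (j : nat) : l = j -> (j * w i2 + (a * w i0 + b * w i1) = N)%N.
  by move=> <-; rewrite addnC -mN.
case: l mN W => [|[|[|l]]] mN W.
- exists 0, 0, 0, (c *: (x ^+ a * y ^+ b * z ^+ 0)).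
  rewrite expr0 mulr1; split; rewrite ?eqxx //.
  + by apply/in_x1x2Z/in_x1x2M; apply: in_x1x2Xn.
  + apply: whomZ; rewrite -mN mul0n addn0 !PoszD !PoszM !(mulrC _%:Z (w _)%:Z).
    by apply: whomM; apply/whomXn/whomU.
  by rewrite !scale0r !add0r mul0r add0r.
- have := W 1%N erefl; rewrite mul1n => W1.
  case: b mN W W1 => [|[|b]] mN W W1.
  + have ka : k = a by rewrite /k -W1 mul0n addn0 addKn mulnK.
    exists 0, c, 0, 0; split; rewrite ?eqxx //; [exact: in_x1x2_0|exact: whom0| |].
      by rewrite !scale0r addr0 add0r addr0 expr0 mulr1 expr1 ka scalerAl.
    by split; rewrite ?eqxx // ka; lia.
  + have a0 : a = 0%N.
      by case: a mN W W1 => // a _ _; move: Nlt; clear; rewrite mulSn mul1n; lia.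
    exists 0, 0, c, 0; split; rewrite ?eqxx //; [exact: in_x1x2_0|exact: whom0| |].
      by rewrite !scale0r !add0r addr0 a0 expr0 mul1r !expr1 scalerAl.
    by split; rewrite ?eqxx // => _; move: W1; rewrite a0; clear; lia.
  by exfalso; move: W1 Nlt w01; clear; rewrite !mulSn; lia.
- have := W 2%N erefl => W1.
  have a0 : a = 0%N.
    by case: a mN W W1 => // a _ _; move: Nlt w12; clear; rewrite !mulSn; lia.
  have b0 : b = 0%N.
    by case: b mN W W1 => // b _ _; move: Nlt w01 w12; clear; rewrite !mulSn; lia.
  exists c, 0, 0, 0; split; rewrite ?eqxx //; [exact: in_x1x2_0|exact: whom0| |].
    by rewrite !scale0r !addr0 mul0r addr0 a0 b0 !expr0 !mul1r.
  by rewrite -W1 a0 b0; clear; lia.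
by exfalso; move: mN Nlt w01 w12; clear; rewrite !mulSn; lia.
Qed.

(** [R] is a monomial times a form in [x ^+ b] and [y ^+ a], which splits. The ideal is prime and
    contains no variable, so it contains a factor [y ^+ a - r *: x ^+ b]; this factor divides [R]
    and is divisible by it. *)
Lemma curve_relation : in_x1x2 R -> exists (lam c : K) (e1 e2 : nat),
  [/\ lam != 0, c != 0, gcdn e1 e2 = 1%N & R = lam *: (x ^+ e1 + c *: y ^+ e2)].
Proof.
move=> hRxy; pose g := gcdn (w i0) (w i1); pose a := (w i0 %/ g)%N; pose b := (w i1 %/ g)%N.
have g0 : (0 < g)%N by rewrite gcdn_gt0 w_gt0.
have ea : w i0 = (a * g)%N by rewrite divnK // dvdn_gcdl.
have eb : w i1 = (b * g)%N by rewrite divnK // dvdn_gcdr.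
have a0 : (0 < a)%N by have := w_gt0 i0; rewrite ea muln_gt0 => /andP[].
have b0 : (0 < b)%N by have := w_gt0 i1; rewrite eb muln_gt0 => /andP[].
have cop : coprime a b.
  by rewrite /coprime -(eqn_pmul2r g0) mul1n muln_gcdl -ea -eb.
have [m0 hm0] := mpoly_neq0P _ R0.
have mP m : R@_m != 0 -> m i2 = 0%N /\ (m i0 * a + m i1 * b = m0 i0 * a + m0 i1 * b)%N.
  move=> hm; have h2 : m i2 = 0%N by apply: hRxy; rewrite mcoeff_msupp.
  have h20 : m0 i2 = 0%N by apply: hRxy; rewrite mcoeff_msupp.
  split=> //; have := hN hm; have := hN hm0 => -[] + [].
  rewrite !wdegE h2 h20 !mul0n !addn0 ea eb !mulnA -!mulnDl => <- /eqP.
  by rewrite eqn_pmul2r // => /eqP.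
pose G : {mpoly K[3]} := x ^+ (m0 i0 %% b) * y ^+ (m0 i1 %% a).
pose n := (m0 i0 %/ b + m0 i1 %/ a)%N.
have [v [p sp hp] hv] : exists2 v, in_pencil (x ^+ b) (y ^+ a) n v & R = G * v.
  rewrite (mpolyE R) big_seq.
  apply: (big_ind (fun Q => exists2 v, in_pencil (x ^+ b) (y ^+ a) n v & Q = G * v)).
  - by exists 0; [apply: in_pencil0|rewrite mulr0].
  - move=> _ _ [v1 hv1 ->] [v2 hv2 ->]; exists (v1 + v2); first exact: in_pencilD.
    by rewrite mulrDr.
  move=> m; rewrite mcoeff_msupp => hm; have [h2 e] := mP m hm.
  have [E0 E1 En] := coprime_exponents cop a0 b0 e.
  exists (R@_m *: ((x ^+ b) ^+ (m i0 %/ b) * (y ^+ a) ^+ (m i1 %/ a))).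
    apply: in_pencilZ; rewrite /n -En; apply: in_pencilM; [exact: in_pencilPn|exact: in_pencilQn].
  rewrite mpolyX_I3 h2 expr0 mulr1 -scalerAr; congr (_ *: _).
  rewrite {1}(divn_eq (m i0) b) {1}(divn_eq (m i1) a) !exprD E0 E1 /G.
  by rewrite !(mulnC _ b) !(mulnC _ a) !exprM; ring.
have p0 : p != 0.
  apply: contraNneq R0 => p0; rewrite hv hp p0 /pencil big1 ?mulr0 // => j _.
  by rewrite coef0 scale0r.
have [rs [_ _ e]] := pencil_split (x ^+ b) (y ^+ a) sp p0.
have vanZ c P : c != 0 -> van (c *: P) -> van P.
  move=> c0 /vanP[Q hQ]; apply/vanP; exists (c^-1 *: Q).
  by rewrite -scalerAr -hQ scalerA mulVf // scale1r.
have nvx k : ~~ van (x ^+ k) by apply/negP => /vanXn; apply/negP.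
have nvy k : ~~ van (y ^+ k) by apply/negP => /vanXn; apply/negP.
have [r rrs vr] : exists2 r, r \in rs & van (y ^+ a - r *: x ^+ b).
  have := van_relation; rewrite hv hp e vanM vanM (negPf (nvx _)) (negPf (nvy _)) /=.
  move/vanZ; rewrite lead_coef_eq0 => /(_ p0); rewrite vanM -exprM (negPf (nvx _)) /=.
  elim: (rs) => [|r rs' IH]; first by rewrite big_nil (negPf van1).
  rewrite big_cons vanM => /orP[hr|/IH[r' hr' vr']]; first by exists r; rewrite ?mem_head.
  by exists r'; rewrite // inE hr' orbT.
have [T hT] : exists T, R = (y ^+ a - r *: x ^+ b) * T.
  rewrite hv hp e (big_rem r) //=; set F := y ^+ a - _; set T' := \prod_(_ <- rem _ _) _.
  exists (G * (lead_coef p *: ((x ^+ b) ^+ (n - size rs) * T'))).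
  by rewrite -!scalerAr; congr (_ *: _); ring.
have /vanP[S hS] := vr.
have [c c0 hc] : exists2 c, c != 0 & S = c%:MP.
  apply: (@mpoly_unit_const _ _ T); apply: (mulfI R0).
  by rewrite mulrA -hS -hT mulr1.
have r0 : r != 0.
  by apply/eqP => r0; have := nvy a; move: vr; rewrite r0 scale0r subr0 => ->.
exists (- (r / c)), (- r^-1), b, a; split.
- by rewrite oppr_eq0 mulf_neq0 // invr_eq0.
- by rewrite oppr_eq0 invr_eq0.
- by rewrite gcdnC; apply/eqP.
have -> : R = c^-1 *: (y ^+ a - r *: x ^+ b).
  by rewrite hS hc mulrC mul_mpolyC scalerA mulVf // scale1r.
rewrite scalerBr scalerDr !scalerA addrC; congr (_ + _).
  by rewrite -scaleNr [r / c]mulrC.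
by congr (_ *: _); rewrite mulrNN mulrAC mulfV // mul1r.
Qed.

Theorem relation_normal_form : exists h, in_x1x2 h /\ whomog_of w (w i2) h /\
  exists (lam : K) F, lam != 0 /\ normal_form w (z + h) F /\ R = lam *: F.
Proof.
have X0 : in_x1x2 x by apply: in_x1x2_X0.
have X1 : in_x1x2 y by apply: in_x1x2_X1.
have [al [be [ga [k [C [hC Cw RE Nal [Nbe Nga]]]]]]] := relation_shape.
have no_h : in_x1x2 (0 : {mpoly K[3]}) /\ whomog_of w (w i2) (0 : {mpoly K[3]}).
  by split; [apply: in_x1x2_0|apply/whomE/whom0].
have [al0|al0] := eqVneq al 0; last first.
  have N2 := Nal al0.
  have two0 : (2%:R : K) != 0 by rewrite natf_neq0_char0.
  (* Completing the square in [z]. *)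
  pose h := (2%:R * al)^-1 *: (be *: x ^+ k + ga *: y).
  have hx : in_x1x2 h by apply/in_x1x2Z/in_x1x2D; apply: in_x1x2Z => //; apply: in_x1x2Xn.
  have hw : whom w (w i2) h.
    apply/whomZ/whomD.
      have [->|/Nbe e] := eqVneq be 0; first by rewrite scale0r; apply: whom0.
      have -> : w i2 = (w i0 * k)%N by rewrite mulnC; move: e N2; clear; lia.
      by apply: whomZ; rewrite PoszM; apply/whomXn/whomU.
    have [->|/Nga e] := eqVneq ga 0; first by rewrite scale0r; apply: whom0.
    have -> : w i2 = w i1 by move: e N2; clear; lia.
    exact/whomZ/whomU.
  have RE' : R = al *: ((z + h) ^+ 2 + (al^-1 *: C - h ^+ 2)).
    have e1 : al *: (z * h *+ 2) = (be *: x ^+ k + ga *: y) * z.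
      rewrite -mulr_natl -[in LHS]mpolyC_nat mul_mpolyC scalerA /h -scalerAr scalerA.
      rewrite (_ : _ * _ = 1) ?scale1r; first by rewrite mulrC.
      by rewrite [al * _]mulrC mulfV // mulf_neq0.
    rewrite RE -e1 -[C in LHS](scalerKV al0) -!scalerDr; congr (_ *: _); ring.
  exists h; split=> //; split; first exact/whomE.
  exists al, ((z + h) ^+ 2 + (al^-1 *: C - h ^+ 2)); split=> //; split=> //.
  apply: (quadratic_normal_form al0 hx hw _ _ RE').
    by apply: in_x1x2B; [apply: in_x1x2Z|apply: in_x1x2Xn].
  by apply: whomB; [rewrite -N2; apply: whomZ|rewrite mulnC PoszM; apply: whomXn].
rewrite al0 scale0r add0r in RE.
have [ga0|ga0] := eqVneq ga 0.
  rewrite ga0 scale0r addr0 in RE.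
  have [be0|be0] := eqVneq be 0.
    rewrite be0 scale0r mul0r add0r in RE.
    have hRxy : in_x1x2 R by rewrite RE.
    have [lam [c [e1 [e2 [lam0 c0 g1 e]]]]] := curve_relation hRxy.
    exists 0; split; first exact: no_h.1; split; first exact: no_h.2.
    exists lam, (x ^+ e1 + c *: y ^+ e2); split=> //; split=> //.
    by do 2! right; left; exists c, e1, e2.
  have e := Nbe be0.
  have RE' : R = be *: (x ^+ k * z + be^-1 *: C).
    by rewrite scalerDr scalerA mulfV // scale1r scalerAl.
  have [k0|k0] := posnP k.
    exists (be^-1 *: C); split; first exact: in_x1x2Z.
    split; first by apply/whomE/whomZ; move: e; rewrite k0 mul0n add0n => ->.
    exists be, (z + be^-1 *: C); split=> //; split; first by right; left.
    by rewrite RE' k0 mul1r.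
  exists 0; split; first exact: no_h.1; split; first exact: no_h.2.
  exists be, (x ^+ k * z + be^-1 *: C); split=> //; split=> //.
  do 4! right; left; exists k, (be^-1 *: C); rewrite addr0; split=> //.
  split; first exact: in_x1x2Z.
  by split=> //; exists N; apply/whomE/whomZ.
have e := Nga ga0.
(* If [be = 0] then [a = 0] and [k] carries no information; the default 1 satisfies the condition
   [1 <= e1] of (4). *)
pose a := be / ga; pose e1 := if be == 0 then 1%N else k.
have we1 : a != 0 -> (e1 * w i0 = w i1)%N.
  rewrite /a /e1 mulf_eq0 negb_or => /andP[be0 _]; rewrite (negPf be0).
  by move: (Nbe be0) e; clear; lia.
have e10 : (0 < e1)%N.
  rewrite /e1; case: eqP => // /eqP be0; rewrite lt0n; apply/eqP => k0.
  by have := Nbe be0; have := w_gt0 i1; move: e; rewrite k0; clear; lia.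
pose L := y + a *: x ^+ e1.
have Lw : whom w (w i1) L.
  apply: whomD; first exact: whomU.
  have [->|/we1 <-] := eqVneq a 0; first by rewrite scale0r; apply: whom0.
  by apply: whomZ; rewrite mulnC PoszM; apply/whomXn/whomU.
pose m := (N %/ w i0)%N.
(* Division of [C] by [L], of degree 1 in [y]: each [y] is replaced by [- a *: x ^+ e1], and the
   homogeneous remainder is a multiple of one power of [x]. *)
have [H [c [Hx Hw EC cm]]] : exists H c, [/\ in_x1x2 H, whom w (w i2) H,
    C = L * H + c *: x ^+ m & c != 0 -> (m * w i0 = N)%N].
  pose good Q := exists H c, [/\ in_x1x2 H, whom w (w i2) H,
    Q = L * H + c *: x ^+ m & c != 0 -> (m * w i0 = N)%N].
  suff : good C by [].
  have goodD P Q : good P -> good Q -> good (P + Q).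
    move=> [H [c [h1 h2 -> h3]]] [H' [c' [h1' h2' -> h3']]]; exists (H + H'), (c + c'); split.
    + exact: in_x1x2D.
    + exact: whomD.
    + by rewrite scalerDl; ring.
    by have [->|c0 _] := eqVneq c 0; [rewrite add0r|apply: h3].
  have good0 : good 0.
    exists 0, 0; split; rewrite ?eqxx //; [exact: in_x1x2_0|exact: whom0|].
    by rewrite mulr0 scale0r addr0.
  have goodZ s P : good P -> good (s *: P).
    move=> [H [c [h1 h2 -> h3]]]; exists (s *: H), (s * c); split.
    + exact: in_x1x2Z.
    + exact: whomZ.
    + by rewrite scalerDr scalerAr scalerA.
    by rewrite mulf_eq0 negb_or => /andP[_].
  rewrite (mpolyE C) big_seq; apply: (big_ind good) => //.
  move=> mm hm; apply: (goodZ); have := hC mm hm; have := Cw mm; rewrite -mcoeff_msupp.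
  move=> /(_ hm) []; rewrite wdegE mpolyX_I3 => + m2; rewrite m2 mul0n addn0 expr0 mulr1.
  elim: (mm i1) (mm i0) => [|j IH] i Ei.
    exists 0, 1; split; rewrite ?mulr0 ?add0r ?scale1r //.
    + exact: in_x1x2_0.
    + exact: whom0.
    + by rewrite mulr1 /m -Ei mul0n addn0 mulnK.
    by rewrite /m -Ei mul0n addn0 mulnK.
  have -> : x ^+ i * y ^+ j.+1 = L * (x ^+ i * y ^+ j) + (- a) *: (x ^+ (i + e1) * y ^+ j).
    by rewrite /L mulrDl scaleNr -scalerAl exprD !exprS -addrA -scalerBr [X in _ *: X](_ : _ = 0)
      ?scaler0 ?addr0; ring.
  apply: (goodD).
    exists (x ^+ i * y ^+ j), 0; split; rewrite ?eqxx //.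
    + by apply: in_x1x2M; apply: in_x1x2Xn.
    + have -> : w i2 = (w i0 * i + w i1 * j)%N by move: Ei e; rewrite mulSn; clear; lia.
      by rewrite PoszD !PoszM; apply: whomM; apply/whomXn/whomU.
    by rewrite scale0r addr0.
  have [->|a0] := eqVneq a 0; first by rewrite oppr0 scale0r.
  apply: (goodZ); apply: IH; have := we1 a0; move: Ei; rewrite mulSn mulnDl; clear; lia.
pose h := ga^-1 *: H; pose c' := c / ga.
have EL : be *: x ^+ k + ga *: y = ga *: L.
  rewrite scalerDr scalerA /a mulrC divfK // addrC; congr (_ + _).
  by rewrite /e1; have [->|_] := eqVneq be 0; rewrite ?scale0r.
have RE' : R = ga *: (L * (z + h) + c' *: x ^+ m).
  have ec : ga * c' = c by rewrite mulrC divfK.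
  rewrite RE EL EC [in RHS]scalerDr scalerA ec addrA; congr (_ + _).
  move: {EL EC Lw} L => L; rewrite mulrDr scalerDr -scalerAl; congr (_ + _).
  by rewrite /h -scalerAr scalerA mulfV // scale1r.
(* Otherwise [R] is a product of forms of degrees [w i1] and [w i2], both smaller than their sum
   [N], against primality of the ideal. *)
have c'0 : c' != 0.
  apply/eqP => c'0; have R1 : R = L * (ga *: (z + h)).
    by rewrite RE' c'0 scale0r addr0 scalerAr.
  have := van_relation; rewrite {1}R1 vanM; have := R0; rewrite {1}R1 mulf_eq0 negb_or => /andP[L0 h0].
  have hw : whom w (w i2) (ga *: (z + h)) by apply/whomZ/whomD; [apply: whomU|apply: whomZ].
  case/orP => vv; [have := van_le vv L0 Lw|have := van_le vv h0 hw]; rewrite lez_nat.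
    by have := w_gt0 i2; move: e; clear; lia.
  by have := w_gt0 i1; move: e; clear; lia.
exists h; split; first exact: in_x1x2Z.
split; first exact/whomE/whomZ.
exists ga, (L * (z + h) + c' *: x ^+ m); split=> //; split=> //.
do 3! right; left; exists c', a, m, e1; split=> //; split=> //.
have /cm mw : c != 0 by apply: contraNneq c'0 => c00; rewrite /c' c00 mul0r.
(* [m * w i0 = w i1 + w i2] exceeds [w i0], hence [m >= 2]. *)
by case: (m) mw => [|[|//]]; have := w_gt0 i2; move: e w01 (w_gt0 i0); clear; lia.
Qed.

End Classification.

Theorem theorem3 (K : closedFieldType) (hchar : [pchar K] =i pred0)
  (f : 3.-tuple {mpoly K[3]}) (hf : poly_aut f)
  (h12 : (deg1 (tnth f i0) <= deg1 (tnth f i1))%N)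
  (h23 : (deg1 (tnth f i1) <= deg1 (tnth f i2))%N)
  (R : {mpoly K[3]})
  (hR : forall P : {mpoly K[3]},
      P \mPo [tuple top_comp (tnth f i) | i < 3] = 0 <->
      exists Q : {mpoly K[3]}, P = R * Q) :
  let w := fun i : 'I_3 => deg1 (tnth f i) in
  exists h : {mpoly K[3]},
    in_x1x2 h /\ whomog_of w (w i2) h /\
    exists (lambda : K) (F : {mpoly K[3]}),
      lambda != 0 /\ normal_form w ('X_i2 + h) F /\ R = lambda *: F.
Proof.
have [g [gf fg]] := hf.
have [R0|R0] := eqVneq R 0.
  exists 0; split; first by move=> m; rewrite msupp0.
  split; first by move=> m; rewrite msupp0.
  by exists 1, 0; rewrite oner_neq0 scaler0; split=> //; split=> //; left.
have [N [hN _ Nlt curve]] := leading_relation hchar gf fg hR R0.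
pose van (P : {mpoly K[3]}) := P \mPo [tuple top_comp (tnth f i) | i < 3] == 0.
apply: (@relation_normal_form K hchar _ R N van) => //.
- exact: w_gt0 fg.
- by move=> P; rewrite -hR /van; split=> /eqP.
- by move=> P Q; rewrite /van rmorphM mulf_eq0.
exact: top_f_neq0 fg.
Qed.
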